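(* Let $k$ be a field of characteristic zero and $A$ an affine Poisson $k$-algebra. Then a Poisson prime ideal $P$ of $A$ is Poisson rational if and only if the set of Poisson prime ideals $Q\supseteq P$ with $\mathrm{ht}(Q)=\mathrm{ht}(P)+1$ is finite.
   Context: A Poisson $k$-algebra is a commutative $k$-algebra $A$ with a $k$-bilinear Lie bracket $\{-,-\}$ such that $\{-,x\}$ is a derivation for each $x\in A$. Affine means finitely generated over $k$ and an integral domain. A Poisson prime ideal is a prime ideal $P$ with $\{P,A\}\subseteq P$. $P$ is Poisson rational if the Poisson centre $\{z:\{z,-\}\equiv0\}$ of $\operatorname{Frac}(A/P)$ (with induced bracket) is algebraic over $k$. $\mathrm{ht}$ denotes height. *)

(* Defs.v *)
From HB Require Import structures.
From mathcomp Require Import all_boot all_order all_algebra.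
From mathcomp Require Import boolp classical_sets cardinality.
Set Implicit Arguments. Unset Strict Implicit. Unset Printing Implicit Defensive.
Import GRing.Theory.
Local Open Scope ring_scope.
Local Open Scope classical_set_scope.

Section Poisson.
Variables (k : fieldType) (A : comAlgType k).

Definition is_domain : Prop := forall a b : A, a * b = 0 -> a = 0 \/ b = 0.

Definition subalgebra (B : set A) : Prop :=
  B 1 /\ (forall x y, B x -> B y -> B (x + y)) /\
  (forall x y, B x -> B y -> B (x * y)) /\ (forall (c : k) x, B x -> B (c *: x)).

Definition finitely_generated : Prop :=
  exists s : seq A, forall B : set A,
    subalgebra B -> (forall x, x \in s -> B x) -> B = setT.

Definition affine : Prop := finitely_generated /\ is_domain.

Definition poisson_bracket (br : A -> A -> A) : Prop :=
  [/\ (forall (c : k) x y z, br (c *: x + y) z = c *: br x z + br y z),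
      (forall (c : k) x y z, br z (c *: x + y) = c *: br z x + br z y),
      (forall x, br x x = 0),
      (forall x y z, br x (br y z) + br y (br z x) + br z (br x y) = 0) &
      (forall x y z, br (y * z) x = y * br z x + br y x * z)].

Definition ideal (I : set A) : Prop :=
  I 0 /\ (forall x y, I x -> I y -> I (x + y)) /\ (forall a x, I x -> I (a * x)).

Definition prime_ideal (P : set A) : Prop :=
  [/\ ideal P, ~ P 1 & forall a b, P (a * b) -> P a \/ P b].

Definition poisson_prime (br : A -> A -> A) (P : set A) : Prop :=
  prime_ideal P /\ forall p a, P p -> P (br p a).

Definition prime_chain (n : nat) (P : set A) : Prop :=
  exists f : nat -> set A,
    (forall i, (i <= n)%N -> prime_ideal (f i)) /\
    (forall i, (i < n)%N -> f i `<` f i.+1) /\ f n = P.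

Definition has_height (P : set A) (n : nat) : Prop :=
  prime_chain n P /\ ~ prime_chain n.+1 P.

(* Explicit construction of Frac(A/P): a fraction a/b (with a, b in A and
   b not in P) is represented by the pair (a, b); (a,b) = (c,d) in Frac(A/P)
   iff a*d - c*b \in P. In particular (a,b) is zero iff a \in P. *)
Definition frac_ok (P : set A) (z : A * A) : Prop := ~ P z.2.
Definition frac_zero (P : set A) (z : A * A) : Prop := P z.1.
Definition fadd (z w : A * A) : A * A := (z.1 * w.2 + w.1 * z.2, z.2 * w.2).
Definition fmul (z w : A * A) : A * A := (z.1 * w.1, z.2 * w.2).
Definition fscal (c : k) : A * A := (c%:A, 1).

(* Induced bracket on fractions (quotient rule):
   {a/b, c/d} = ({a,c}bd - a{b,c}d - b{a,d}c + ac{b,d}) / (b^2 d^2). *)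
Definition fbracket (br : A -> A -> A) (z w : A * A) : A * A :=
  let: (a, b) := z in let: (c, d) := w in
  (br a c * b * d - a * br b c * d - b * br a d * c + a * c * br b d,
   b ^+ 2 * d ^+ 2).

Definition fhorner (p : {poly k}) (z : A * A) : A * A :=
  foldr (fun c acc => fadd (fmul acc z) (fscal c)) (0, 1) (polyseq p).

Definition frac_poisson_central (br : A -> A -> A) (P : set A) (z : A * A) :=
  forall w, frac_ok P w -> frac_zero P (fbracket br z w).

Definition frac_algebraic (P : set A) (z : A * A) :=
  exists2 p : {poly k}, p != 0 & frac_zero P (fhorner p z).

Definition poisson_rational (br : A -> A -> A) (P : set A) : Prop :=
  forall z, frac_ok P z -> frac_poisson_central br P z -> frac_algebraic P z.

End Poisson.

(* Main.v *)
Require Import Defs.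
From HB Require Import structures.
From mathcomp Require Import all_boot all_order all_algebra all_field.
From mathcomp Require Import boolp classical_sets cardinality.
From mathcomp Require Import functions ring zify mpoly.
Set Implicit Arguments. Unset Strict Implicit. Unset Printing Implicit Defensive.
Import GRing.Theory.
Local Open Scope ring_scope.
Local Open Scope classical_set_scope.

(* Let K = Frac(A/P), let y be a Noether normalisation of A/P and R = k[y].

   If a/b is a transcendental Poisson-central element of K, then for all but finitely many
   integers c a prime minimal over P and a - c b, and not containing b, is Poisson: the ideal
   of those x with b^m x in (a - c b) + P is stable under brackets.  Factorisation of the
   constant term of a minimal polynomial over R produces infinitely many such primes.

   Conversely write K = E(theta) with E = Frac R, and let C = R[theta].  A Poisson prime Q
   minimal over P lies over a principal prime (q) of R.  Elements b_j of C of degree at most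
   deg q + O(1), congruent modulo Q to f'(theta) dq/dy_j and with b_j Q in q C, define a
   one-form W_Q with components b_j / q whose only pole over q is a logarithmic one along Q.
   Its Lie derivative along a Hamiltonian field has no pole along q, so it stays in a finite
   dimensional k-space that does not depend on Q.  Given infinitely many Q, suitable k-linear
   combinations of the W_Q are invariant, a K-linear relation of minimal length between these
   has Poisson-central coefficients, and by rationality the coefficients are algebraic over k.
   The pole along one of the Q then gives a contradiction. *)

(** * Ideals stable under derivations *)

(** The polynomial ring [R] matters because it is factorial and graded. Factoriality puts each
    successor of [P] over a principal prime, and total degree controls the poles: every term of the
    Lie derivative of [W_Q] has a numerator of degree deg q plus a constant, and since [q] divides
    their combination, the quotient has degree bounded independently of [Q]. The delicate point is
    thus the degree of the [b_j], because [C] need not be normal and a choice of [b_j] by ideal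
    theory alone says nothing about degrees. So the equations are homogenised by a variable [s]
    along a generic direction, in which [q] becomes monic. There the derivative of [q] carries the
    integral closure back into the ring, which produces [b_j] explicitly, and the exponent of [s]
    bounds its degree. The coordinate fields are multiplied by [f'(theta)] and the Hamiltonian
    fields by a common denominator [G], so that all of them preserve [C]. The finitely many [q]
    dividing a nonzero multiple [g0] of [f'(theta)] are discarded: for the others [f'(theta)] is
    outside [Q], and there [q] generates [Q] up to elements outside [Q]. *)

Definition rideal (R : comNzRingType) (I : set R) : Prop :=
  [/\ I 0, forall x y, I x -> I y -> I (x + y) & forall a x, I x -> I (a * x)].

Definition rprime (R : comNzRingType) (I : set R) : Prop :=
  [/\ rideal I, ~ I 1 & forall a b, I (a * b) -> I a \/ I b].

Definition mulclosed (R : comNzRingType) (M : set R) : Prop :=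
  M 1 /\ forall x y, M x -> M y -> M (x * y).

Definition derivation_to (R : comNzRingType) (S : comNzRingType) (f : R -> S)
    (d : R -> S) : Prop :=
  (forall x y, d (x + y) = d x + d y) /\
  (forall x y, d (x * y) = f x * d y + d x * f y).

Definition stable (T : Type) (D : set (T -> T)) (I : set T) : Prop :=
  forall d x, D d -> I x -> I (d x).

Section Ideals.
Variable R : comNzRingType.
Implicit Types (I J P M : set R).

Lemma rideal_opp I x : rideal I -> I x -> I (- x).
Proof. by case=> _ _ h /(h (-1)); rewrite mulN1r. Qed.

Lemma rideal_sub I x y : rideal I -> I x -> I y -> I (x - y).
Proof. by move=> hI hx hy; case: (hI) => _ h _; apply: h => //; apply: rideal_opp. Qed.

Lemma rideal_mulr I x a : rideal I -> I x -> I (x * a).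
Proof. by case=> _ _ h /(h a); rewrite mulrC. Qed.

Lemma rideal_sum I (T : Type) (s : seq T) (p : pred T) (F : T -> R) :
  rideal I -> (forall i, p i -> I (F i)) -> I (\sum_(i <- s | p i) F i).
Proof. by case=> h0 hD _ hF; elim/big_ind: _. Qed.

Lemma rprime_exp P x n : rprime P -> P (x ^+ n) -> P x.
Proof.
case=> _ h1 hP; elim: n => [|n IH]; first by rewrite expr0.
by rewrite exprS => /hP[].
Qed.

Lemma rideal_add I x y : rideal I -> I x -> I (x + y) -> I y.
Proof.
move=> hI hx hxy; rewrite -[y](addKr x) addrC.
by apply: rideal_sub.
Qed.

Lemma rprime_prod P (T : eqType) (s : seq T) (F : T -> R) :
  rprime P -> P (\prod_(i <- s) F i) -> exists2 i, i \in s & P (F i).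
Proof.
case=> _ h1 hP; elim: s => [|a s IH]; first by rewrite big_nil.
rewrite big_cons => /hP[h|/IH[i hi h]]; first by exists a => //; rewrite mem_head.
by exists i => //; rewrite inE hi orbT.
Qed.

Lemma derivation_exp (S : comNzRingType) (f : {rmorphism R -> S}) d x n :
  derivation_to f d -> d (x ^+ n.+1) = n.+1%:R * f x ^+ n * d x.
Proof.
move=> [_ hM]; elim: n => [|n IH]; first by rewrite expr0 mulr1 mul1r.
rewrite exprS hM IH rmorphXn.
by rewrite -[n.+2%:R]natr1 exprS; ring.
Qed.

Lemma derivation1 (S : comNzRingType) (f : {rmorphism R -> S}) d :
  derivation_to f d -> d 1 = 0.
Proof.
move=> [_ hM]; have := hM 1 1; rewrite rmorph1 !mulr1 mul1r => h.
by apply: (addrI (d 1)); rewrite addr0 -h.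
Qed.

Lemma derivation0 (S : comNzRingType) (f : R -> S) d :
  derivation_to f d -> d 0 = 0.
Proof. by move=> [hD _]; apply: (addrI (d 0)); rewrite -hD !addr0. Qed.

Lemma derivation_opp (S : comNzRingType) (f : R -> S) d x :
  derivation_to f d -> d (- x) = - d x.
Proof.
move=> h; apply/eqP; rewrite -addr_eq0 -(proj1 h) addNr (derivation0 h) //.
Qed.

Lemma derivation_sub (S : comNzRingType) (f : R -> S) d x y :
  derivation_to f d -> d (x - y) = d x - d y.
Proof. by move=> h; rewrite (proj1 h) (derivation_opp _ h). Qed.

Lemma derivation_sum (S : comNzRingType) (f : R -> S) d (T : Type) (s : seq T)
    (p : pred T) F : derivation_to f d ->
  d (\sum_(i <- s | p i) F i) = \sum_(i <- s | p i) d (F i).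
Proof. by move=> h; apply: (big_morph d (proj1 h)); apply: derivation0 h. Qed.

(* The exponents trade one factor [x] for two factors [d x] at each step, until
   only powers of [d x] remain. *)
Lemma radical_stable (I : set R) d x n :
  (forall m, exists c : R, c * m.+1%:R = 1) ->
  rideal I -> derivation_to id d -> (forall y, I y -> I (d y)) ->
  I (x ^+ n) -> exists m, I (d x ^+ m).
Proof.
move=> h0 hI hd hst hn; have [_ hD hM] := hI.
suff H m : (m <= n)%N -> exists l, I (x ^+ (n - m) * d x ^+ l).
  by case: (H n (leqnn n)) => l; rewrite subnn mul1r => ?; exists l.
elim: m => [|m IH] hm; first by exists 0%N; rewrite subn0 mulr1.
have [l hl] := IH (ltnW hm).
have {}hl : I (x ^+ (n - m) * d x ^+ l.+1).
  by rewrite exprSr mulrA; apply: rideal_mulr.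
have hnm : (n - m = (n - m.+1).+1)%N by rewrite subnSK.
move: hl; rewrite hnm; set j := (n - m.+1)%N => hl.
have := hst _ hl; rewrite (proj2 hd) !(derivation_exp (f := idfun) _ _ hd) /= => h.
have {}h : I (j.+1%:R * (x ^+ j * d x ^+ l.+3)).
  have h2 : I (l.+1%:R * d (d x) * (x ^+ j.+1 * d x ^+ l.+1)).
    exact: hM.
  have := rideal_sub hI (hM (d x) _ h) h2.
  by rewrite [X in I X](_ : _ = j.+1%:R * (x ^+ j * d x ^+ l.+3)) // !exprS; ring.
have [c hc] := h0 j; exists l.+3.
by have := hM c _ h; rewrite mulrA hc mul1r.
Qed.

(* Without derivations this is Krull's existence theorem for prime ideals; the
   differential version needs the integers to be invertible. *)
Lemma stable_prime_exists (D : set (R -> R)) (I0 M : set R) :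
  (forall d, D d -> derivation_to id d /\ forall m, exists c : R, c * m.+1%:R = 1) ->
  rideal I0 -> stable D I0 -> mulclosed M -> (forall x, I0 x -> ~ M x) ->
  exists P, [/\ rprime P, stable D P, I0 `<=` P & forall x, P x -> ~ M x].
Proof.
move=> hder hI0 hs0 [hM1 hMM] hdis.
pose good X := [/\ rideal X, stable D X & forall x, X x -> ~ M x].
(* Zorn is applied to the sets [X] whose union with [I0] is good: the empty chain has empty union,
   and adjoining [I0] turns it into an ideal. *)
have hchain (F : set (set R)) : F `<=` (fun X => good (X `|` I0)) ->
    total_on F subset -> good (\bigcup_(X in F) X `|` I0).
  move=> hF htot.
  have wit x : (\bigcup_(X in F) X `|` I0) x ->
      I0 x \/ exists2 X, F X & (X `|` I0) x.
    by case=> [[X FX Xx]|]; [right; exists X => //; left|left].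
  have inc X x : F X -> (X `|` I0) x -> (\bigcup_(X in F) X `|` I0) x.
    by move=> FX [Xx|]; [left; exists X|right].
  split=> [|d x Dd|x].
  - split; first by right; case: hI0.
    + move=> x y /wit[hx|[X FX hx]] /wit[hy|[Y FY hy]].
      * by right; case: hI0 => _ h _; apply: h.
      * apply: (inc Y) => //; case: (hF Y FY) => -[_ h _] _ _; apply: h => //.
        by right.
      * apply: (inc X) => //; case: (hF X FX) => -[_ h _] _ _; apply: h => //.
        by right.
      * have [sXY|sYX] := htot X Y FX FY.
          apply: (inc Y) => //; case: (hF Y FY) => -[_ h _] _ _; apply: h => //.
          by case: hx => [/sXY|] ?; [left|right].
        apply: (inc X) => //; case: (hF X FX) => -[_ h _] _ _; apply: h => //.
        by case: hy => [/sYX|] ?; [left|right].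
    + move=> a x /wit[hx|[X FX hx]].
        by right; case: hI0 => _ _; apply.
      by apply: (inc X) => //; case: (hF X FX) => -[_ _ h] _ _; apply: h.
  - move=> /wit[hx|[X FX hx]]; first by right; apply: hs0.
    by apply: (inc X) => //; case: (hF X FX) => _ h _; apply: h.
  - move=> /wit[hx|[X FX hx]]; first exact: hdis.
    by case: (hF X FX) => _ _; apply.
have [X0 [gX0 maxX0]] := Zorn_bigcup hchain.
pose I := X0 `|` I0; have [hI hsI hdI] : good I by [].
have maxI J : good J -> I `<=` J -> J `<=` I.
  move=> gJ sIJ x Jx; apply: contrapT => nIx.
  apply: (maxX0 J).
    split; first by move=> y X0y; apply: sIJ; left.
    by move=> /(_ x Jx) X0x; apply: nIx; left.
  suff -> : J `|` I0 = J by [].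
  by apply/setUidPl => y I0y; apply: sIJ; right.
(* The radical of [I] is stable by [radical_stable] and still avoids [M], so maximality makes [I]
   radical. *)
have radI x n : I (x ^+ n) -> I x.
  move=> hxn; pose J : set R := fun y => exists m, I (y ^+ m).
  have [_ hD hMu] := hI.
  apply: (maxI J); last by exists n.
    split.
    - split; first by exists 1%N; rewrite expr1; case: hI.
      + move=> y z [a ya] [b zb]; exists (a + b)%N; rewrite exprDn.
        apply: rideal_sum => // i _; rewrite -mulr_natl; apply: (hMu).
        have [hi|hi] := leqP b i.
          by apply: (hMu); rewrite -(subnK hi) exprD; apply: (hMu).
        apply: rideal_mulr => //.
        have h : (a <= a + b - i)%N by rewrite -addnBA ?leq_addr // ltnW.
        by rewrite -(subnK h) exprD; apply: (hMu).
      + by move=> a y [m ym]; exists m; rewrite exprMn; apply: (hMu).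
    - move=> d y Dd [m ym]; have [hd h0] := hder d Dd.
      exact: (radical_stable h0 hI hd (fun z => hsI d z Dd) ym).
    - move=> y [m ym] My; apply: (hdI _ ym).
      by elim: m {ym} => [|m IH]; rewrite ?expr0 // exprS; apply: hMM.
  by move=> y Iy; exists 1%N; rewrite expr1.
(* If [x y] lies in [I], then so does [(x d y)^2 = (x d y) d(x y) - (d x)(d y) x y], and [I] is
   radical; hence [(I : x)] is stable. *)
have colon x : good I -> rideal (fun y => I (x * y)) /\ stable D (fun y => I (x * y)).
  have [h0 hD hMu] := hI.
  move=> _; split; first split.
  - by rewrite mulr0.
  - by move=> y z hy hz; rewrite mulrDr; apply: (hD).
  - by move=> a y hy; rewrite mulrCA; apply: (hMu).
  move=> d y Dd hy; have [hd _] := hder d Dd.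
  apply: (radI _ 2%N); have := hMu (x * d y) _ (hsI d _ Dd hy).
  rewrite (proj2 hd) /= mulrDr => h.
  have := rideal_sub hI h (hMu (d x * d y) _ hy).
  by rewrite [X in I X](_ : _ = (x * d y) ^+ 2) //; ring.
exists I; split => //; last by move=> x; right.
split=> // [I1|a b Iab]; first exact: (hdI 1 I1).
have [Ia|nIa] := pselect (I a); [by left|right].
(* For [m] in [M] the ideal [(I : m)] avoids [M], hence equals [I] by maximality. This in turn shows
   that [(I : a)] avoids [M] when [a] is not in [I]. *)
have colonM m : M m -> forall y, I (m * y) -> I y.
  move=> Mm y Imy; have [h1 h2] := colon m (And3 hI hsI hdI : good I).
  apply: (maxI (fun y => I (m * y))) => //; last first.
    by move=> z Iz; case: hI => _ _; apply.
  split=> // z Imz Mz; apply: (hdI _ Imz); exact: hMM.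
have [h1 h2] := colon a (And3 hI hsI hdI).
apply: (maxI (fun y => I (a * y))) => //; last first.
  by move=> z Iz; case: hI => _ _; apply.
split=> // z Iaz Mz; apply: nIa; apply: (colonM z) => //.
by rewrite mulrC.
Qed.

Lemma prime_exists (I0 M : set R) :
  rideal I0 -> mulclosed M -> (forall x, I0 x -> ~ M x) ->
  exists P, [/\ rprime P, I0 `<=` P & forall x, P x -> ~ M x].
Proof.
move=> h1 h2 h3.
have [|d x []|P [? _ ? ?]] := @stable_prime_exists set0 I0 M _ h1 _ h2 h3; first by [].
by exists P.
Qed.

End Ideals.

(** * Unique factorisation in polynomial rings *)

Definition divides (R : idomainType) (q a : R) : Prop := exists c, a = c * q.

Definition prime_elt (R : idomainType) (q : R) : Prop :=
  [/\ q != 0, q \isn't a GRing.unit &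
      forall a b, divides q (a * b) -> divides q a \/ divides q b].

(* Kaplansky's characterisation of unique factorisation domains. *)
Definition factorial (R : idomainType) : Prop :=
  forall P : set R, rprime P -> forall x, P x -> x != 0 ->
  exists2 q, prime_elt q & P q.

Section Factorial.
Variable R : idomainType.
Implicit Types (a b c q x y : R) (s : seq R).

Lemma divides_ideal q : rideal (divides q).
Proof.
split; first by exists 0; rewrite mul0r.
  by move=> x y [a ->] [b ->]; exists (a + b); rewrite mulrDl.
by move=> a x [b ->]; exists (a * b); rewrite mulrA.
Qed.

Lemma prime_elt_rprime q : prime_elt q -> rprime (divides q).
Proof.
case=> q0 qu hq; split=> //; first exact: divides_ideal.
by case=> c h; case/negP: qu; apply/unitrPr; exists c; rewrite mulrC.
Qed.

Definition factored x := exists (u : R) s,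
  [/\ u \is a GRing.unit, forall q, q \in s -> prime_elt q & x = u * \prod_(q <- s) q].

Lemma factored_divl a b : factored (a * b) -> factored a.
Proof.
case=> u [s [hu hs]]; elim: s u a b hu hs => [|q s IH] u a b hu hs.
  rewrite big_nil mulr1 => e; exists a, [::]; split=> //; last by rewrite big_nil mulr1.
  by have := hu; rewrite -e unitrM => /andP[].
have hq : prime_elt q by apply: hs; rewrite mem_head.
have hs' p : p \in s -> prime_elt p by move=> h; apply: hs; rewrite inE h orbT.
have q0 : q != 0 by case: hq.
rewrite big_cons mulrCA => e.
have : divides q (a * b) by exists (u * \prod_(j <- s) j); rewrite e mulrC.
case: (hq) => _ _ h /h [[c ec]|[c ec]].
  have [] := IH u c b hu hs'.
    by apply: (mulfI q0); rewrite mulrA -e ec [q * c]mulrC.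
  move=> v [r [hv hr er]]; exists v, (q :: r); split=> //.
    by move=> p; rewrite inE => /predU1P[->|/hr].
  by rewrite big_cons ec er; rewrite mulrCA mulrC mulrA mulrC.
apply: (IH u a c hu hs').
by apply: (mulfI q0); rewrite -e ec; rewrite mulrCA [q * c]mulrC.
Qed.

(** If [x] had no factorisation, its multiples would avoid the set of factored elements, which is
    saturated by [factored_divl]. A prime ideal containing [x] and avoiding that set would contain a
    prime element, which is factored. *)
Lemma factorialP : factorial R -> forall x, x != 0 -> factored x.
Proof.
move=> hR x x0; apply: contrapT => nx.
have [||y [a ->] h|P [hP sP dP]] := @prime_exists R (divides x) (fun y => factored y).
- exact: divides_ideal.
- split; first by exists 1, [::]; rewrite big_nil mulr1 unitr1; split.
  move=> a b [u [s [hu hs ->]]] [v [r [hv hr ->]]].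
  exists (u * v), (s ++ r); split; first by rewrite unitrM hu.
    by move=> q; rewrite mem_cat => /orP[/hs|/hr].
  by rewrite big_cat mulrACA.
- by apply: nx; move: h; rewrite mulrC => /factored_divl.
have [|q hq Pq] := hR P hP x _ x0; first by apply: sP; exists 1; rewrite mul1r.
apply: (dP q Pq); exists 1, [:: q].
split; [exact: unitr1 | by move=> p; rewrite inE => /eqP-> | by rewrite big_seq1 mul1r].
Qed.

Lemma prime_elt_exp q x n : prime_elt q -> divides q (x ^+ n) -> divides q x.
Proof. by move/prime_elt_rprime; apply: rprime_exp. Qed.

Lemma divides_prime q s : prime_elt q -> (forall p, p \in s -> prime_elt p) ->
  forall u, u \is a GRing.unit -> divides q (u * \prod_(p <- s) p) ->
  exists2 p, p \in s & exists2 v, v \is a GRing.unit & p = v * q.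
Proof.
move=> hq hs u hu; have [hi h1 hP] := prime_elt_rprime hq; case/hP => [[c ec]|].
  by case: (hq) => _ /negP qu _; case: qu; move: hu; rewrite ec unitrM => /andP[].
move=> h; have [p ps [v ev]] := rprime_prod (F := id) (And3 hi h1 hP) h.
exists p => //; exists v => //; have [p0 pu pP] := hs p ps.
have [|[w ew]|[w ew]] := pP v q; first by exists 1; rewrite mul1r.
  have q0 : q != 0 by case: hq.
  have : p * (w * q) = p * 1 by rewrite mulrCA mulr1 mulrA -ew.
  by move/(mulfI p0) => h'; case: (hq) => _ /negP qu _; case: qu; apply/unitrPr; exists w; rewrite mulrC.
have : q * (w * v) = q * 1 by rewrite mulr1 mulrC -mulrA -ev.
have q0 : q != 0 by case: hq.
by move/(mulfI q0) => h'; apply/unitrPr; exists w; rewrite mulrC.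
Qed.

(** A prime dividing all coefficients divides the leading one, so primes can be removed from [f] at
    most as often as the leading coefficient has prime factors; the induction is on that number. *)
Lemma factorial_primitive : factorial R -> forall f : {poly R}, f != 0 ->
  exists c (f0 : {poly R}), [/\ c != 0, f = c *: f0 & forall q, prime_elt q -> ~ divides q%:P f0].
Proof.
move=> hR f f0.
suff H n : forall f u s, u \is a GRing.unit -> (forall q, q \in s -> prime_elt q) ->
    (size s <= n)%N -> lead_coef f = u * \prod_(q <- s) q -> f != 0 ->
    exists c (f0 : {poly R}), [/\ c != 0, f = c *: f0 & forall q, prime_elt q -> ~ divides q%:P f0].
  have [|u [s [hu hs e]]] := factorialP hR (x := lead_coef f).
    by rewrite lead_coef_eq0.
  exact: (H (size s) f u s).
elim: n {f f0} => [|n IH] f u s hu hs sn e f0.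
all: have [h|nh] := pselect (exists2 q, prime_elt q & divides q%:P f); last first.
1,3: by exists 1, f; rewrite scale1r oner_neq0; split=> // q hq hqf; apply: nh; exists q.
all: have [q hq [g eg]] := h.
all: have ql : divides q (u * \prod_(p <- s) p) by
  exists (lead_coef g); rewrite -e eg lead_coefM lead_coefC.
all: have [p ps [v hv ep]] := divides_prime hq hs hu ql.
  by move: ps; move: sn; rewrite leqn0 size_eq0 => /eqP->.
have q0 : q != 0 by case: hq.
have g0 : g != 0 by apply: contraNneq f0 => g0; rewrite eg g0 mul0r.
have [||||c [f1 [c0 e1 h1]]] := IH g (u * v) (rem p s) _ _ _ _ g0.
- by rewrite unitrM hu.
- by move=> r /mem_rem; apply: hs.
- by rewrite size_rem // -ltnS prednK //; case: (s) ps.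
- apply: (mulIf q0); move: e.
  rewrite (perm_big _ (perm_to_rem ps)) /= big_cons {1}ep eg lead_coefM lead_coefC => ->.
  by rewrite -!mulrA; congr (_ * (_ * _)); rewrite mulrC.
exists (q * c), f1; rewrite mulf_neq0 // -scalerA -e1; split=> //.
by rewrite eg mulrC mul_polyC.
Qed.

(** Gauss's argument: for the least indices [i], [j] of coefficients of [f] and [g] not divisible by
    [q], all other terms in coefficient [i + j] of [f * g] are divisible by [q]. *)
Lemma prime_elt_polyC q : prime_elt q -> prime_elt q%:P.
Proof.
move=> hq; have [hI _ hPr] := prime_elt_rprime hq; case: hq => q0 qu _.
have dE (f : {poly R}) : divides q%:P f <-> forall i, divides q f`_i.
  split=> [[g ->] i|/choice[c hc]]; first by exists g`_i; rewrite coefMC.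
  exists (\poly_(i < size f) c i); apply/polyP => i; rewrite coefMC coef_poly.
  by case: ltnP => h; [exact: hc|rewrite nth_default // mul0r].
split; first by rewrite polyC_eq0.
  by rewrite poly_unitE coefC size_polyC q0 /= qu.
move=> f g /dE hfg; apply: contrapT => /not_orP[nf ng].
have ex (h : {poly R}) : ~ divides q%:P h ->
    exists i, ~ divides q h`_i /\ forall j, (j < i)%N -> divides q h`_j.
  move=> /dE/existsNP[i hi].
  have exP : exists i, `[< ~ divides q h`_i >] by exists i; apply/asboolP.
  case: (ex_minnP exP) => m /asboolP hm min; exists m; split=> // j jm.
  apply: contrapT => nj; have := min j; move/asboolP: nj => /[swap] /[apply].
  by rewrite leqNgt jm.
have [i [hi mi]] := ex f nf; have [j [hj mj]] := ex g ng.
have hij : divides q (f`_i * g`_j).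
  have := hfg (i + j)%N; rewrite coefM.
  have hi' : (i < (i + j).+1)%N by rewrite ltnS leq_addr.
  rewrite (bigD1 (Ordinal hi')) //= addKn addrC => h.
  apply: (rideal_add hI _ h).
  apply: rideal_sum => // l; rewrite -val_eqE /= => li.
  have [lt|gt|eq] := ltngtP l i.
  - by apply: rideal_mulr => //; apply: mi.
  - case: hI => _ _ hM; apply: hM; apply: mj.
    by rewrite ltn_subLR ?ltn_add2r // -ltnS ltn_ord.
  - by rewrite eq eqxx in li.
by case: (hPr _ _ hij).
Qed.

(** The primes of [c] are cancelled one at a time: each divides [g * f], and since [f] is primitive
    it divides [g]. *)
Lemma primitive_cancel : factorial R -> forall (f g a : {poly R}) (c : R), c != 0 ->
  (forall q, prime_elt q -> ~ divides q%:P f) -> c *: a = g * f -> divides f a.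
Proof.
move=> hR f g a c c0 hf.
have [u [s [hu hs ->]]] := factorialP hR c0.
elim: s hs g => [|q s IH] hs g.
  rewrite big_nil mulr1 => e; exists (u^-1 *: g).
  by rewrite -scalerAl -e scalerA mulVr // scale1r.
have hq : prime_elt q by apply: hs; rewrite mem_head.
have q0 : q%:P != 0 by rewrite polyC_eq0; case: hq.
rewrite big_cons mulrCA -scalerA => e.
have [_ _ hP] := prime_elt_polyC hq.
have [|[h eh]|] := hP g f.
- by exists ((u * \prod_(j <- s) j) *: a); rewrite -e [RHS]mulrC mul_polyC.
- apply: (IH _ h) => [p ps|]; first by apply: hs; rewrite inE ps orbT.
  by apply: (mulfI q0); rewrite mul_polyC e eh; ring.
- by move/(hf q hq).
Qed.

(** If [P] contains a nonzero constant, it contains a prime of [R]. Otherwise pseudo-division by the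
    primitive part of an element of least degree in [P] shows that this primitive part generates
    [P]. *)
Lemma factorial_poly : factorial R -> factorial {poly R}.
Proof.
move=> hR P hP x Px x0; have [hI h1 hPr] := hP.
have [[r r0 Pr]|hc] := pselect (exists2 r : R, r != 0 & P r%:P).
  have hQ : rprime (fun r => P r%:P).
    split=> //; first split=> [|a b ha hb|a b hb].
    - by case: hI.
    - by rewrite polyCD; case: hI => _ h _; apply: h.
    - by rewrite polyCM; case: hI => _ _ h; apply: h.
    - by move=> a b; rewrite polyCM => /hPr.
  have [q hq Pq] := hR _ hQ r Pr r0.
  by exists q%:P => //; apply: prime_elt_polyC.
have hc0 c : c != 0 -> ~ P c%:P by move=> c0 Pc; apply: hc; exists c.
have exP : exists n, `[< exists2 g : {poly R}, g != 0 & P g /\ size g = n >].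
  by exists (size x); apply/asboolP; exists x.
case: (ex_minnP exP) => m /asboolP[g g0 [Pg sg]] min.
have [c [f [c0 eg hf]]] := factorial_primitive hR g0.
have Pf : P f.
  have : P (c%:P * f) by rewrite mul_polyC -eg.
  by case/hPr => // /(hc0 c c0).
have f0 : f != 0 by apply: contraNneq g0 => f0; rewrite eg f0 scaler0.
have sf : size f = m by rewrite -sg eg size_scale.
have gen (a : {poly R}) : P a -> divides (f : {poly R}) a.
  move=> Pa.
  have e := Pdiv.Idomain.divp_eq a f.
  have Pr : P (a %% f).
    have : P (lead_coef f ^+ scalp a f *: a).
      by rewrite -mul_polyC; case: hI => _ _; apply.
    rewrite e => h; apply: (rideal_add hI _ h).
    by case: hI => _ _; apply.
  have r0 : a %% f = 0.
    apply/eqP; apply: contrapT => /negP r0.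
    have : (m <= size (modp a f))%N by apply: min; apply/asboolP; exists (modp a f).
    by rewrite -sf leqNgt ltn_modp f0.
  apply: (primitive_cancel hR _ hf (c := lead_coef f ^+ scalp a f) (g := a %/ f)).
    by rewrite expf_neq0 // lead_coef_eq0.
  by rewrite e r0 addr0.
exists f => //; split=> //.
  apply/negP => /unitrPr[y hy]; apply: h1; rewrite -hy.
  exact: rideal_mulr.
move=> a b [d ed].
have : P (a * b) by rewrite ed; case: hI => _ _; apply.
by case/hPr => /gen; [left|right].
Qed.

End Factorial.

Lemma factorial_iso (R S : idomainType) (f : {rmorphism R -> S}) (g : {rmorphism S -> R}) :
  cancel f g -> cancel g f -> factorial R -> factorial S.
Proof.
move=> fg gf hR P hP x Px x0; have [[h0 hD hM] h1 hPr] := hP.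
have hQ : rprime (fun r => P (f r)).
  split=> [||a b].
  - split=> [|a b ha hb|a b hb]; rewrite ?rmorph0 ?rmorphD ?rmorphM //.
      exact: (hD).
    exact: (hM).
  - by rewrite rmorph1.
  - by rewrite rmorphM => /hPr.
have [||q [q0 qu qp] Pq] := hR _ hQ (g x).
- by rewrite /= gf.
- by apply: contraNneq x0 => e; rewrite -[x]gf e rmorph0.
exists (f q) => //; split.
- by apply: contraNneq q0 => e; rewrite -[q]fg e rmorph0.
- by apply: contraNN qu => h; rewrite -[q]fg rmorph_unit.
have dE a : divides q (g a) -> divides (f q) a.
  by case=> c e; exists (f c); rewrite -rmorphM -e gf.
move=> a b [c e]; have [||] := qp (g a) (g b).
- by exists (g c); rewrite -[q]fg -!rmorphM e.
- by move/dE; left.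
- by move/dE; right.
Qed.

Lemma mpoly_rmorph_ext (k : comNzRingType) n (S : comNzRingType)
    (f g : {rmorphism {mpoly k[n]} -> S}) :
  (forall c, f c%:MP = g c%:MP) -> (forall i, f 'X_i = g 'X_i) -> f =1 g.
Proof.
move=> hc hX p; rewrite -[p]comp_mpoly_id comp_mpolyE !rmorph_sum.
apply: eq_bigr => m _; rewrite -mul_mpolyC !rmorphM hc; congr (_ * _).
rewrite !rmorph_prod; apply: eq_bigr => i _; rewrite !rmorphXn.
by rewrite tnth_mktuple hX.
Qed.

Section MpolyFactorial.
Variable k : fieldType.

Definition mmult n : {poly {mpoly k[n]}} -> {mpoly k[n.+1]} :=
  horner_eval ('X_ord_max) \o map_poly (@mwiden n k).

HB.instance Definition _ n := GRing.RMorphism.on (@mmult n).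

Lemma muniXwiden n (i : 'I_n) : muni ('X_(widen_ord (leqnSn n) i) : {mpoly k[n.+1]}) = ('X_i)%:P.
Proof.
rewrite /muni mmapX mmap1U; case: splitP => [j /= e|j /= e].
  by congr ('X__)%:P; apply/val_inj.
by have := ltn_ord i; rewrite e ord1 addn0 ltnn.
Qed.

Lemma muniXmax n : muni ('X_ord_max : {mpoly k[n.+1]}) = 'X.
Proof.
rewrite /muni mmapX mmap1U; case: splitP => // j /= e.
by have := ltn_ord j; rewrite -e ltnn.
Qed.

Lemma muniK n : cancel (@muni n k) (@mmult n).
Proof.
move=> p; apply: (mpoly_rmorph_ext (f := @mmult n \o @muni n k) (g := idfun)) => /=.
  by move=> c; rewrite muniC /mmult /= map_polyC /horner_eval hornerC /= mwidenC.
move=> i; have [j ->|->] := unliftP ord_max i.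
  have -> : lift ord_max j = widen_ord (leqnSn n) j by apply/val_inj; rewrite [LHS]lift_max.
  rewrite muniXwiden /mmult /= map_polyC /horner_eval hornerC.
  by rewrite /= mwidenX mnmwiden1.
by rewrite muniXmax /mmult /= map_polyX /horner_eval hornerX.
Qed.

Lemma mmultK n : cancel (@mmult n) (@muni n k).
Proof.
move=> p; rewrite /mmult /= /horner_eval horner_coef rmorph_sum /=.
rewrite size_map_inj_poly; [|exact: inj_mwiden|exact: mwiden0].
rewrite [RHS](_ : p = \sum_(i < size p) p`_i *: 'X^i); last by rewrite -poly_def coefK.
apply: eq_bigr => i _; rewrite coef_map rmorphM rmorphXn /= muniXmax -mul_polyC.
congr (_ * _).
apply: (mpoly_rmorph_ext (f := @muni n k \o @mwiden n k) (g := polyC)) => /=.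
  by move=> c; rewrite mwidenC muniC.
by move=> j; rewrite mwidenX mnmwiden1 muniXwiden.
Qed.

Lemma factorial_mpoly n : factorial {mpoly k[n]}.
Proof.
elim: n => [|n IH]; last first.
  exact: (factorial_iso (@mmultK n) (@muniK n) (factorial_poly IH)).
move=> P [hI h1 _] x Px x0; case: h1.
have ex : x = (x@_0)%:MP.
  apply/mpolyP => m; rewrite mcoeffC; have -> : m = 0%MM by apply/mnmP; case.
  by rewrite eqxx mulr1.
have c0 : x@_0 != 0 by apply: contraNneq x0 => c0; rewrite ex c0 mpolyC0.
rewrite [1](_ : _ = (x@_0)^-1%:MP * x); first by case: hI => _ _; apply.
by rewrite [X in _ * X]ex -mpolyCM mulVf // mpolyC1.
Qed.

End MpolyFactorial.

(** Quantifying over every field containing [R] avoids fixing a model of the fraction field;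
    [int_closed_frac] specialises it to any field of quotients. *)
Definition int_closed (R : idomainType) : Prop :=
  forall (K : fieldType) (f : {rmorphism R -> K}), injective f ->
  forall a b, b != 0 -> integralOver f (f a / f b) -> divides b a.

(** Rational root argument: an integral equation of degree [m] for [a / b], cleared of denominators,
    makes [a ^+ m] a multiple of [b]. A prime factor of [b] thus divides [a] and can be
    cancelled. *)
Lemma factorial_int_closed (R : idomainType) : factorial R -> int_closed R.
Proof.
move=> hR K f finj a b b0 hi.
have f0 x : x != 0 -> f x != 0.
  by apply: contraNneq => h; apply/eqP; apply: finj; rewrite h rmorph0.
have [u [s [hu hs eb]]] := factorialP hR b0.
elim: s b b0 a hi hs eb => [|q s IH] b b0 a hi hs eb.
  by exists (a * u^-1); rewrite eb big_nil mulr1 -mulrA mulVr // mulr1.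
have hq : prime_elt q by apply: hs; rewrite mem_head.
have q0 : q != 0 by case: hq.
have [b' eb'] : exists b', b = b' * q.
  by exists (u * \prod_(j <- s) j); rewrite eb big_cons; ring.
have b'0 : b' != 0 by apply: contraNneq b0 => e; rewrite eb' e mul0r.
have qa : divides q a.
  have [p mp rp] := hi.
  have [m sp] : exists m, size p = m.+1.
    by exists (size p).-1; rewrite prednK // lt0n size_poly_eq0 monic_neq0.
  apply: (@prime_elt_exp _ _ _ m) => //.
  have fb0 := f0 _ b0.
  have e : f (\sum_(i < m.+1) p`_i * a ^+ i * b ^+ (m - i)) = 0.
    have := rp; rewrite /root horner_coef size_map_poly_id0; last first.
      by rewrite f0 // lead_coef_eq0 monic_neq0.
    move=> /eqP/(congr1 (fun z => z * f b ^+ m)); rewrite mul0r => <-.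
    rewrite rmorph_sum mulr_suml sp; apply: eq_bigr => i _.
    rewrite coef_map /= expr_div_n !rmorphM !rmorphXn -!mulrA; congr (_ * _).
    congr (_ * _); have -> : f b ^+ m = f b ^+ i * f b ^+ (m - i).
      by rewrite -exprD subnKC // -ltnS.
    by rewrite mulrA mulVf ?mul1r // expf_neq0.
  have {e} : \sum_(i < m.+1) p`_i * a ^+ i * b ^+ (m - i) = 0.
    by apply: finj; rewrite e rmorph0.
  rewrite big_ord_recr /= subnn expr0 mulr1.
  have -> : p`_m = 1 by have := monicP mp; rewrite lead_coefE sp.
  rewrite mul1r addrC => /eqP; rewrite addr_eq0 => /eqP ->.
  apply: (rideal_opp (divides_ideal q)); apply: rideal_sum => [|i _].
    exact: divides_ideal.
  have -> : (m - i = (m - i).-1.+1)%N by rewrite prednK // subn_gt0.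
  by exists (p`_i * a ^+ i * b ^+ (m - i).-1 * b'); rewrite exprSr {2}eb'; ring.
have [c ec] := qa.
have [|||d ed] := IH b' b'0 c.
- move: hi; rewrite ec eb' !rmorphM -mulf_div divff ?mulr1 //; exact: f0.
- by move=> r rs; apply: hs; rewrite inE rs orbT.
- by apply: (mulIf q0); rewrite -eb' eb big_cons; ring.
by exists d; rewrite ec ed eb' mulrA.
Qed.

(** * Integrally closed domains *)

Lemma irreducible_divisor (F : fieldType) (p : {poly F}) :
  (1 < size p)%N -> exists2 r, irreducible_poly r & r %| p.
Proof.
move=> sp.
have exP : exists n, `[< exists2 r : {poly F}, (1 < size r)%N & r %| p /\ size r = n >].
  by exists (size p); apply/asboolP; exists p => //; rewrite dvdpp.
case: (ex_minnP exP) => m /asboolP[r sr [rp er]] min; exists r => //; split=> // d sd dr.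
have d0 : d != 0.
  by apply: contraTneq dr => ->; rewrite dvd0p -size_poly_eq0 -lt0n (ltn_trans _ sr).
have sd1 : (1 < size d)%N by rewrite ltn_neqAle eq_sym sd lt0n size_poly_eq0.
apply/eqP; rewrite -dvdp_size_eqp // eqn_leq dvdp_leq ?er ?min //=.
  by apply/asboolP; exists d => //; split=> //; apply: dvdp_trans rp.
by rewrite -size_poly_gt0 (ltn_trans _ sr).
Qed.

Lemma splitting_exists (F : fieldType) (p : {poly F}) : p \is monic ->
  exists (L : fieldType) (i : {rmorphism F -> L}) (s : seq L),
    map_poly i p = \prod_(x <- s) ('X - x%:P).
Proof.
move: {2}(size p) (leqnn (size p)) => n; elim: n F p => [|n IH] F p.
  by rewrite leqn0 size_poly_eq0 => /eqP-> /monic_neq0; rewrite eqxx.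
move=> sp mp; have [sp1|sp1] := leqP (size p) 1.
  exists F, idfun, [::]; rewrite big_nil map_poly_id //.
  have /size_poly1P[c c0 ec] : size p == 1%N.
    by rewrite eqn_leq sp1 lt0n size_poly_eq0 monic_neq0.
  by move/monicP: mp; rewrite ec lead_coefC => ->.
have [r ir rp] := irreducible_divisor sp1.
have [L _ [z rz _]] := irredp_FAdjoin ir.
have {rz} /factor_theorem[p' ep] : root (map_poly (in_alg L) p) z.
  by rewrite -(divpK rp) rmorphM rootM rz orbT.
have mp' : p' \is monic.
  by rewrite -(monicMr _ (monicXsubC z)) -ep map_monic.
have sp' : (size p' <= n)%N.
  by move: sp; rewrite -(size_map_poly (in_alg L)) ep size_Mmonic ?monicXsubC ?monic_neq0
     // size_XsubC addn2 ltnS.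
have [M [j [s es]]] := IH L p' sp' mp'.
exists M, (j \o in_alg L), (j z :: s).
by rewrite map_poly_comp /= ep rmorphM /= es big_cons mulrC rmorphB /= map_polyX map_polyC.
Qed.


(** [f] may have a kernel: [E] is then the fraction field of the image, which is how residue fields
    of prime ideals are presented. *)
Definition isfrac (R : comNzRingType) (E : fieldType) (f : R -> E) :=
  forall x, exists a b, f b != 0 /\ x = f a / f b.

Lemma isfrac_tofrac (R : idomainType) : isfrac (@tofrac R).
Proof.
elim/quotW=> x; exists \n_x, \d_x.
have d0 : (tofrac \d_x) != 0 by rewrite tofrac_eq0 denom_ratioP.
split=> //; apply: (mulIf d0); rewrite mulfVK //.
rewrite !piE /= ; apply/eqP; rewrite FracField.equivf_def.
by rewrite /FracField.mulf !numden_Ratio ?mulr1 ?oner_neq0 ?mulf_neq0 ?denom_ratioP // mulrC.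
Qed.

Lemma frac_lift (R : comNzRingType) (E L : fieldType) (f : {rmorphism R -> E})
    (g : {rmorphism R -> L}) :
  isfrac f -> (forall r, f r = 0 <-> g r = 0) ->
  exists h : {rmorphism E -> L}, forall r, h (f r) = g r.
Proof.
move=> hf h0.
have n0 r : f r != 0 -> g r != 0.
  by apply: contraNneq => /h0 ->.
have ex x : exists y, forall a b, f b != 0 -> x = f a / f b -> y = g a / g b.
  have [a [b [b0 ->]]] := hf x; exists (g a / g b) => c d d0 e.
  apply/eqP; rewrite eqr_div ?n0 // -!rmorphM -subr_eq0 -rmorphB; apply/eqP/h0.
  by rewrite rmorphB !rmorphM; apply/eqP; rewrite subr_eq0 -eqr_div // e.
have [h hh] := choice ex.
have hF r : h (f r) = g r.
  by rewrite (hh _ r 1) ?rmorph1 ?oner_neq0 ?divr1.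
have hB : zmod_morphism h.
  move=> x y; have [a [b [b0 ex']]] := hf x; have [c [d [d0 ey]]] := hf y.
  rewrite (hh _ _ _ b0 ex') (hh _ _ _ d0 ey) (hh _ (a * d - c * b) (b * d)).
  - by rewrite rmorphB !rmorphM; field; rewrite !n0.
  - by rewrite rmorphM mulf_neq0.
  - by rewrite ex' ey rmorphB !rmorphM; field; rewrite b0 d0.
have hM : monoid_morphism h.
  split=> [|x y]; first by rewrite -(rmorph1 f) hF rmorph1.
  have [a [b [b0 ex']]] := hf x; have [c [d [d0 ey]]] := hf y.
  rewrite (hh _ _ _ b0 ex') (hh _ _ _ d0 ey) (hh _ (a * c) (b * d)).
  - by rewrite mulf_div !rmorphM.
  - by rewrite rmorphM mulf_neq0.
  - by rewrite ex' ey mulf_div !rmorphM.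
pose hZ := GRing.isZmodMorphism.Build _ _ h hB.
pose hR := GRing.isMonoidMorphism.Build _ _ h hM.
pose h' : {rmorphism E -> L} := HB.pack h hZ hR.
by exists h'.
Qed.

Lemma int_closed_frac (R : idomainType) (E L : fieldType) (f : {rmorphism R -> E})
    (g : {rmorphism E -> L}) x :
  int_closed R -> injective f -> isfrac f -> integralOver (g \o f) (g x) ->
  exists c, x = f c.
Proof.
move=> hR finj hf; have [a [b [b0 ->]]] := hf x.
rewrite rmorph_div ?unitfE // => hi.
have [||c ->] := hR _ _ _ a b _ hi.
- by move=> r s /fmorph_inj/finj.
- by apply: contraNneq b0 => ->; rewrite rmorph0.
by exists c; rewrite rmorphM mulfK.
Qed.

Lemma integral_fmorph (R : comNzRingType) (E L : fieldType) (f : {rmorphism R -> E})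
    (g : {rmorphism E -> L}) x :
  integralOver (g \o f) (g x) -> integralOver f x.
Proof.
case=> p mp rp; exists p => //; move: rp.
by rewrite map_poly_comp fmorph_root.
Qed.

Lemma integral_prod_XsubC (R : comNzRingType) (L : fieldType) (f : {rmorphism R -> L})
    (s : seq L) : (forall x, x \in s -> integralOver f x) ->
  forall i, integralOver f (\prod_(x <- s) ('X - x%:P))`_i.
Proof.
elim: s => [|x s IH] hs i.
  by rewrite big_nil coef1; apply: integral_nat.
rewrite big_cons mulrBl coefB coefXM coefCM; apply: integral_sub.
  case: ifP => _; first exact: integral0.
  by apply: IH => y ys; apply: hs; rewrite inE ys orbT.
apply: integral_mul; first by apply: hs; rewrite mem_head.
by apply: IH => y ys; apply: hs; rewrite inE ys orbT.
Qed.

Lemma integral_coefM (R : comNzRingType) (L : fieldType) (f : {rmorphism R -> L})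
    (p q : {poly L}) : (forall i, integralOver f p`_i) -> (forall i, integralOver f q`_i) ->
  forall i, integralOver f (p * q)`_i.
Proof.
move=> hp hq i; rewrite coefM; elim/big_ind: _ => [|x y|j _]; first exact: integral0.
  exact: integral_add.
exact: integral_mul.
Qed.

(** In a splitting field the roots of [p] are roots of the monic integral polynomial [p * q], hence
    integral, and the coefficients of [p] are polynomials in them. *)
Lemma integral_monic_factor (R : comNzRingType) (L : fieldType) (f : {rmorphism R -> L})
    (p q : {poly L}) : p \is monic -> q \is monic ->
  (forall i, integralOver f (p * q)`_i) -> forall i, integralOver f p`_i.
Proof.
move=> mp mq hpq i; have [M [j [s es]]] := splitting_exists mp.
apply: (integral_fmorph (g := j)).
rewrite -coef_map es; apply: (integral_prod_XsubC (f := j \o f)) => x xs.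
apply: (integral_root_monic (p := map_poly j (p * q))).
- by rewrite map_monic monicMl.
- by rewrite rmorphM rootM /= es root_prod_XsubC xs.
- by apply/integral_poly => l; rewrite coef_map; apply: integral_rmorph.
Qed.

Lemma poly_image (R S : nzRingType) (f : {rmorphism R -> S}) (p : {poly S}) :
  (forall i, exists c, p`_i = f c) -> exists q, p = map_poly f q.
Proof.
move=> /choice[c hc]; exists (\poly_(i < size p) c i); apply/polyP => i.
rewrite coef_map coef_poly; case: ltnP => h; first exact: hc.
by rewrite raddf0 nth_default.
Qed.

Lemma monic_factor_descent (R : idomainType) (E : fieldType) (f : {rmorphism R -> E})
    (p q : {poly E}) (P : {poly R}) : int_closed R -> injective f -> isfrac f ->
  p \is monic -> q \is monic -> p * q = map_poly f P -> exists p0, p = map_poly f p0.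
Proof.
move=> hR finj hf mp mq e; apply: poly_image => i.
apply: (@int_closed_frac _ _ _ f idfun) => //.
apply: (@integral_monic_factor _ _ (idfun \o f) p q) => // j.
by rewrite e coef_map; apply: (integral_id (idfun \o f)).
Qed.

Lemma monic_div_descent (R : idomainType) (E : idomainType) (f : {rmorphism R -> E})
    (p q : {poly R}) (z : {poly E}) : injective f -> q \is monic ->
  map_poly f p = z * map_poly f q -> divides q p.
Proof.
move=> finj mq e; have q0 := monic_neq0 mq.
have ep := Pdiv.IdomainMonic.divp_eq mq p.
have h : map_poly f (modp p q) = (z - map_poly f (divp p q)) * map_poly f q.
  by rewrite mulrBl -e {2}ep rmorphD rmorphM /= addrAC subrr add0r.
exists (divp p q); rewrite {1}ep.
suff -> : modp p q = 0 by rewrite addr0.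
apply: (map_inj_poly finj (rmorph0 f)); rewrite rmorph0 h.
have [->|w0] := eqVneq (z - map_poly f (divp p q)) 0; first by rewrite mul0r.
have : (size (modp p q) < size q)%N by rewrite ltn_modp.
have sz (r : {poly R}) : size (map_poly f r) = size r.
  exact: (size_map_inj_poly finj (rmorph0 f)).
rewrite -(sz (modp p q)) h size_Mmonic ?monic_map // sz.
have sw : (0 < size (z - map_poly f (divp p q))%R)%N by rewrite size_poly_gt0.
by rewrite -(prednK sw) addSn /= ltnNge leq_addl.
Qed.

(** * The conductor of a plane curve at a residue field *)

(* The derivative of [q] lies in the conductor of [R[Y]/(q)] in its integral closure:
   interpolate the values at the conjugate roots. *)
Lemma conductor_interpolation (R : idomainType) (E M : fieldType) (i : {rmorphism R -> E})
    (j : {rmorphism E -> M}) (q h : {poly E}) (s : seq M) (sigma : M -> M) :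
  int_closed R -> injective i -> isfrac i ->
  map_poly j q = \prod_(x <- s) ('X - x%:P) -> uniq s -> (size h < size q)%N ->
  (forall x, x \in s -> (map_poly j h).[x] = (map_poly j q^`()).[x] * sigma x) ->
  (forall x, x \in s -> integralOver (j \o i) x) ->
  (forall x, x \in s -> integralOver (j \o i) (sigma x)) ->
  exists h0, h = map_poly i h0.
Proof.
move=> hR iinj ifrac eq us sh hv hs hsig.
(* Lagrange interpolation: at a root [x] only the summand of [x] survives, with value
   [q'(x) * sigma x]. The coefficients of [H] are sums of products of integral elements. *)
pose H := \sum_(x <- s) sigma x *: \prod_(y <- rem x s) ('X - y%:P).
have eH : map_poly j h = H.
  apply/eqP; rewrite -subr_eq0; apply/eqP.
  have sq : size q = (size s).+1.
    by rewrite -(size_map_poly j) eq size_prod_XsubC.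
  apply: (roots_geq_poly_eq0 (rs := s)) => //; last first.
    apply: leq_trans (size_polyD _ _) _; rewrite geq_max size_polyN size_map_poly.
    rewrite -ltnS -sq sh /=.
    apply: leq_trans (size_sum _ _ _) _; apply/bigmax_leqP_seq => x xs _.
    apply: leq_trans (size_scale_leq _ _) _.
    by rewrite size_prod_XsubC size_rem // prednK //; case: (s) xs.
  apply/allP => x xs; rewrite /root hornerD hornerN hv //.
  rewrite /H (bigD1_seq x) //= hornerD hornerZ horner_sum.
  rewrite [X in _ - (_ + X)]big1_seq => [|y /andP[yx ys]]; last first.
    rewrite hornerZ (big_rem x) /=; last by rewrite mem_rem_uniq // inE eq_sym yx.
    by rewrite hornerM hornerXsubC subrr mul0r mulr0.
  rewrite addr0 -deriv_map eq (big_rem x) //= derivM derivXsubC mul1r hornerD.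
  by rewrite hornerM hornerXsubC subrr mul0r addr0 mulrC subrr.
apply: poly_image => l; apply: (int_closed_frac (g := j)) => //.
rewrite -coef_map eH coef_sum big_seq; elim/big_ind: _ => [|x y|x xs].
- exact: integral0.
- exact: integral_add.
rewrite coefZ; apply: integral_mul; first exact: hsig.
by apply: (@integral_prod_XsubC _ _ (j \o i)) => y /mem_rem; apply: hs.
Qed.

Section PlaneCurvePoint.
Variables (R : idomainType) (E L : fieldType).
Variables (i : {rmorphism R -> E}) (psi : {rmorphism E -> L}) (rho tau : L).
Hypotheses (hR : int_closed R) (iinj : injective i) (ifrac : isfrac i).
Hypothesis charE : [pchar E] =i pred0.
Variables (q : {poly R}) (f : {poly {poly R}}).

Let ev1 : {rmorphism {poly E} -> L} := horner_eval rho \o map_poly psi.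
Let ev2 : {rmorphism {poly {poly E}} -> L} := horner_eval tau \o map_poly ev1.
Let i1 : {rmorphism {poly R} -> {poly E}} := map_poly i.
Let i2 : {rmorphism {poly {poly R}} -> {poly {poly E}}} := map_poly i1.

Hypotheses (mq : q \is monic) (mf : f \is monic).
Hypothesis hq : forall p, ev1 (i1 p) = 0 <-> divides q p.
Hypotheses (hf : ev2 (i2 f) = 0) (hf' : ev2 (i2 f^`()) != 0).

Let ev2C p : ev2 p%:P = ev1 p.
Proof. by rewrite /= map_polyC /horner_eval hornerC. Qed.

Let i1inj : injective i1.
Proof. by apply: map_inj_poly; rewrite ?rmorph0. Qed.

Let qE_min (p : {poly E}) : ev1 p = 0 -> divides (i1 q) p.
Proof.
have [b [b0 [P eP]]] : exists b, b != 0 /\ exists P, i b *: p = i1 P.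
  have /choice[c hc] : forall j, exists ab, i ab.2 != 0 /\ p`_j = i ab.1 / i ab.2.
    by move=> j; have [a [b [b0 e]]] := ifrac p`_j; exists (a, b).
  have b0 : forall j, (c j).2 != 0.
    by move=> j; apply: contraTneq (proj1 (hc j)) => ->; rewrite rmorph0 eqxx.
  exists (\prod_(j < size p) (c j).2); split; first by apply/prodf_neq0.
  apply: poly_image => j; rewrite coefZ.
  have [hj|hj] := ltnP j (size p); last by exists 0; rewrite nth_default // mulr0 rmorph0.
  rewrite (bigD1 (Ordinal hj)) //= (proj2 (hc j)).
  exists ((c j).1 * \prod_(i0 < size p | i0 != Ordinal hj) (c i0).2).
  by rewrite !rmorphM /=; field; case: (hc j).
move=> hp; have /hq [d ed] : ev1 (i1 P) = 0.
  by rewrite -eP -mul_polyC rmorphM hp mulr0.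
have ib : i b != 0 by rewrite -(rmorph0 i) (inj_eq iinj).
exists ((i b)^-1 *: i1 d); apply: (scalerI ib).
by rewrite -scalerAl scalerA mulfV // scale1r eP ed rmorphM.
Qed.

Let mqE : i1 q \is monic. Proof. exact: monic_map. Qed.

Let ev1q : ev1 (i1 q) = 0.
Proof. by apply/hq; exists 1; rewrite mul1r. Qed.

Let qE_coprime (p : {poly E}) : ~ divides (i1 q) p -> exists u v : {poly E}, u * p + v * i1 q = 1.
Proof.
move=> np; have q0 := monic_neq0 mqE.
have c : coprimep p (i1 q).
  rewrite /coprimep; set d := gcdp _ _.
  have dp : d %| p by apply: dvdp_gcdl.
  have [w ew] : exists w, i1 q = w * d.
    by exists (i1 q %/ d); rewrite divpK // dvdp_gcdr.
  have d0 : d != 0 by apply: contraNneq q0 => h; rewrite ew h mulr0.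
  have w0 : w != 0 by apply: contraNneq q0 => h; rewrite ew h mul0r.
  have /eqP : ev1 w * ev1 d = 0 by rewrite -rmorphM -ew ev1q.
  rewrite mulf_eq0 => /orP[] /eqP hd.
    have [z ez] := qE_min hd.
    have : size w = size (z * (w * d)) by rewrite {1}ez ew.
    have z0 : z != 0 by apply: contraNneq w0 => h; rewrite ez h mul0r.
    rewrite size_mul ?mulf_neq0 // size_mul // => e1; apply/eqP; move: e1.
    move: (size_poly_gt0 z) (size_poly_gt0 w) (size_poly_gt0 d); rewrite z0 w0 d0.
    by case: (size z) (size w) (size d) => [//|a] [//|b] [//|e] _ _ _; clear; lia.
  case: np; have [z ez] := qE_min hd; exists (p %/ d * z).
  by rewrite -mulrA -ez divpK.
have /Bezout_eq1_coprimepP[[u v] /= e] := c.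
by exists u, v.
Qed.

(* [f1] stands for the minimal polynomial of [tau] over the field generated by [rho]. *)
Let f1_exists : exists2 f1 : {poly {poly E}}, f1 \is monic /\ ev2 f1 = 0 &
  (forall a, ev2 a = 0 -> exists v : {poly {poly E}}, a = divp a f1 * f1 + v * (i1 q)%:P) /\
  (forall h : {poly {poly E}}, h \is monic -> ev2 h = 0 -> (size f1 <= size h)%N).
Proof.
have exP : exists n, `[< exists2 h : {poly {poly E}}, h \is monic & ev2 h = 0 /\ size h = n >].
  exists (size (i2 f)); apply/asboolP; exists (i2 f) => //; exact: monic_map.
case: (ex_minnP exP) => m /asboolP[f1 mf1 [e1 s1]] min; exists f1 => //.
split=> [a ha|h mh eh]; last by rewrite s1; apply: min; apply/asboolP; exists h.
(* Below the degree of [f1], whatever vanishes at [tau] has leading coefficient divisible by [q]: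
   otherwise Bezout would make it monic modulo [q], against minimality. The leading term is then
   stripped off. *)
have small n : forall r : {poly {poly E}}, (size r <= n)%N -> (size r < size f1)%N ->
    ev2 r = 0 -> exists v : {poly {poly E}}, r = v * (i1 q)%:P.
  elim: n => [|n IH] r sr rf1 er.
    by exists 0; rewrite mul0r; apply/eqP; rewrite -size_poly_eq0 -leqn0.
  have [->|r0] := eqVneq r 0; first by exists 0; rewrite mul0r.
  have sr0 : (0 < size r)%N by rewrite size_poly_gt0.
  have [[z ez]|nd] := pselect (divides (i1 q) (lead_coef r)); last first.
    have [u [v e]] := qE_coprime nd.
    pose h := u%:P * r + (v * i1 q)%:P * 'X^((size r).-1).
    have sh : (size h <= size r)%N.
      apply: leq_trans (size_polyD _ _) _; rewrite geq_max; apply/andP; split.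
        by rewrite mul_polyC; apply: size_scale_leq.
      rewrite mul_polyC; apply: leq_trans (size_scale_leq _ _) _.
      by rewrite size_polyXn prednK.
    have ch : h`_(size r).-1 = 1.
      by rewrite coefD coefCM coefCM coefXn eqxx mulr1 -e.
    have sh' : size h = size r.
      apply/eqP; rewrite eqn_leq sh /= -(prednK sr0) ltnNge; apply/negP => hs.
      by move: ch; rewrite nth_default // => /eqP; rewrite eq_sym oner_eq0.
    have mh : h \is monic by rewrite monicE lead_coefE sh' ch.
    have eh : ev2 h = 0.
      by rewrite /h rmorphD [ev2 (u%:P * r)]rmorphM er mulr0 add0r rmorphM ev2C rmorphM ev1q mulr0 mul0r.
    have : (m <= size h)%N by apply: min; apply/asboolP; exists h.
    by rewrite sh' -s1 leqNgt rf1.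
  pose r' := r - (lead_coef r)%:P * 'X^((size r).-1).
  have sr' : (size r' < size r)%N.
    rewrite -(prednK sr0) ltnS; apply/leq_sizeP => j; rewrite leq_eqVlt => /predU1P[<-|hj].
      by rewrite coefB coefCM coefXn eqxx mulr1 -lead_coefE subrr.
    rewrite coefB coefCM coefXn (gtn_eqF hj) mulr0 subr0 nth_default //.
    by rewrite -(prednK sr0).
  have er' : ev2 r' = 0.
    by rewrite /r' rmorphB rmorphM er ev2C ez !rmorphM ev1q !(mulr0, mul0r) subr0.
  have sn' : (size r' <= n)%N by rewrite -ltnS; apply: leq_trans sr' sr.
  have [v ev] := IH r' sn' (ltn_trans sr' rf1) er'.
  exists (v + z%:P * 'X^((size r).-1)); rewrite mulrDl -ev /r' ez polyCM.
  by rewrite -[_%:P * 'X^_ * _]mulrA ['X^_ * _]mulrC mulrA subrK.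
have ea := Pdiv.IdomainMonic.divp_eq mf1 a.
have sa : (size (modp a f1) < size f1)%N by rewrite ltn_modp monic_neq0.
have [|v ev] := small _ _ (leqnn _) sa.
  have : ev2 (divp a f1 * f1 + modp a f1) = 0 by rewrite -ea.
  by rewrite rmorphD rmorphM e1 mulr0 add0r.
by exists v; rewrite -ev.
Qed.

Let sep_q : separable_poly (i1 q).
Proof.
have [->|q1] := eqVneq (i1 q) 1.
  by rewrite separable_poly.unlock; apply: coprime1p.
have dq : (i1 q)^`() != 0.
  have s1 : (1 < size (i1 q))%N.
    rewrite ltnNge; apply: contra q1 => s1.
    have /size_poly1P[c c0 ec] : size (i1 q) == 1%N.
      by rewrite eqn_leq s1 size_poly_gt0 monic_neq0.
    by move: mqE; rewrite ec monicE lead_coefC => /eqP->.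
  apply: contraTneq (eqxx (1 : E)) => h.
  have := congr1 (fun p : {poly E} => p`_(size (i1 q)).-2) h.
  have es : ((size (i1 q)).-2.+1 = (size (i1 q)).-1)%N by case: (size _) s1 => [//|[]].
  rewrite coef_deriv coef0 es -lead_coefE (monicP mqE) => /eqP.
  by move/pcharf0P: charE => ->; case: (size _) s1 => [//|[]].
rewrite separable_poly.unlock coprimep_sym.
have nd : ~ divides (i1 q) (i1 q)^`().
  case=> z ez; have := lt_size_deriv (monic_neq0 mqE).
  rewrite ez size_Mmonic ?mqE //; last by apply: contraNneq dq => h; rewrite ez h mul0r.
  have : (0 < size z)%N.
    by rewrite size_poly_gt0; apply: contraNneq dq => h; rewrite ez h mul0r.
  by case: (size z) => [//|a] _; rewrite addSn /= ltnNge leq_addl.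
have [u [v e]] := qE_coprime nd.
by apply/Bezout_eq1_coprimepP; exists (u, v).
Qed.

(** Modulo [q] one has [f = f2 * f1], and [G] lifts [q' f1' f2]. At [tau] this is [q' f'] because
    [f1] vanishes there; and [G a] is in the ideal of [q] and [f] because [f1] divides [a] modulo
    [q]. The coefficients of [f1' f2] are only integral over [R[Y]/(q)], and the factor [q'] brings
    them back into that ring. *)
Lemma residue_lift : exists G : {poly {poly R}},
  ev2 (i2 G) = ev1 (i1 q^`()) * ev2 (i2 f^`()) /\
  forall a, ev2 (i2 a) = 0 -> exists u v, G * a = u * q%:P + v * f.
Proof.
have [f1 [mf1 ef1] [hf1 min1]] := f1_exists.
have mfE : i2 f \is monic by apply: monic_map.
pose f2 : {poly {poly E}} := divp (i2 f) f1.
have [v0 e0] : exists v0 : {poly {poly E}}, i2 f = f2 * f1 + v0 * (i1 q)%:P by exact: hf1.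
have mf2 : f2 \is monic.
  have e := Pdiv.IdomainMonic.divp_eq mf1 (i2 f).
  rewrite -(monicMr _ mf1) -/f2 monicE -(monicP mfE) [in X in _ == X]e -/f2.
  have sr : (size (modp (i2 f) f1) < size (f2 * f1)%R)%N.
    apply: (leq_trans (n := size f1)); first by rewrite ltn_modp monic_neq0.
    have f20 : f2 != 0.
      apply/eqP => h; have := min1 _ mfE hf; rewrite {1}e -/f2 h mul0r add0r leqNgt.
      by rewrite ltn_modp monic_neq0.
    rewrite size_Mmonic //; move: f20; rewrite -size_poly_gt0.
    by case: (size f2) => // n _; rewrite addSn /= leq_addl.
  by rewrite lead_coefDl.
pose G0 : {poly {poly E}} := (i1 q^`())%:P * f1^`() * f2.
pose GE := \poly_(j < size G0) modp G0`_j (i1 q).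
have [W eG] : exists W : {poly {poly E}}, G0 = GE + W * (i1 q)%:P.
  exists (\poly_(j < size G0) divp G0`_j (i1 q)); apply/polyP => j.
  rewrite coefD coefMC !coef_poly; case: ltnP => h.
    by rewrite addrC -Pdiv.IdomainMonic.divp_eq.
  by rewrite nth_default // mul0r addr0.
have [G EG] : exists G, GE = i2 G.
  apply: poly_image => l; rewrite coef_poly; case: ifP => [hl|_]; last first.
    by exists 0; rewrite rmorph0.
  have [M [j [s es]]] := splitting_exists mqE.
  have us : uniq s.
    by rewrite -separable_prod_XsubC -es separable_map sep_q.
  pose evx x : {rmorphism {poly E} -> M} := horner_eval x \o map_poly j.
  have evxq x : x \in s -> evx x (i1 q) = 0.
    by move=> xs; apply/eqP; rewrite /= es -/(root _ _) root_prod_XsubC.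
  have intx x : x \in s -> integralOver (j \o i) x.
    move=> xs; exists q => //; rewrite map_poly_comp /= -/i1.
    by apply/eqP; apply: evxq.
  have facx x : x \in s -> map_poly (evx x) (i2 f) = map_poly (evx x) (f2 * f1).
    move=> xs; rewrite e0 rmorphD [X in _ + X]rmorphM /= map_polyC /=.
    by rewrite -[horner_eval _ _]/(evx x (i1 q)) evxq // mulr0 addr0.
  have facM x : x \in s ->
      map_poly (evx x) (i2 f) = map_poly (evx x) f2 * map_poly (evx x) f1.
    by move=> xs; rewrite facx // rmorphM.
  have intfx x n : x \in s -> integralOver (j \o i) (evx x (i2 f)`_n).
    move=> xs; rewrite coef_map -[evx x _]/((map_poly j (i1 f`_n)).[x]).
    rewrite /i1 /= -map_poly_comp; apply: integral_horner; last exact: intx.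
    by apply/integral_poly => m; rewrite coef_map; apply: integral_id.
  (* Here [sigma x] is a coefficient of [f1' f2] at the conjugate root [x]. It is integral since
     [f2 * f1] specialises at [x] to a monic polynomial with integral coefficients, whose monic
     factors are integral. *)
  apply: (@conductor_interpolation _ _ _ i j (i1 q) _ s
    (fun x => (map_poly (evx x) (f1^`() * f2))`_l)) => //.
  - by rewrite ltn_modp monic_neq0.
  - move=> x xs.
    have -> : (map_poly j (modp G0`_l (i1 q))).[x] = evx x (G0`_l).
      rewrite [in RHS](Pdiv.IdomainMonic.divp_eq mqE G0`_l).
      by rewrite rmorphD rmorphM evxq // mulr0 add0r.
    rewrite /G0 -mulrA coefCM rmorphM [in RHS]coef_map.
    by congr (_ * _); rewrite -[RHS]/(evx x (i1 q)^`()); congr (evx x _); exact: esym (deriv_map i q).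
  - move=> x xs; have -> : map_poly (evx x) (f1^`() * f2) = map_poly (evx x) f1^`() * map_poly (evx x) f2.
      by rewrite rmorphM.
    apply: integral_coefM => l'.
      rewrite -(deriv_map (evx x) f1) coef_deriv -mulr_natr; apply: integral_mul; last exact: integral_nat.
      apply: (@integral_monic_factor _ _ (j \o i) _ (map_poly (evx x) f2)).
      + exact: monic_map.
      + exact: monic_map.
      + by move=> n; rewrite mulrC -facM // coef_map; apply: intfx.
    rewrite -[map_poly _ f2]/(map_poly (evx x) f2).
    apply: (@integral_monic_factor _ _ (j \o i) _ (map_poly (evx x) f1)).
    + exact: monic_map.
    + exact: monic_map.
    + by move=> n; rewrite -facM // coef_map; apply: intfx.
exists G; split.
  rewrite -EG.
  have -> : ev2 GE = ev2 G0 by rewrite eG rmorphD rmorphM (ev2C (i1 q)) ev1q mulr0 addr0.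
  rewrite /G0 !rmorphM ev2C -mulrA; congr (_ * _).
  have -> : i2 f^`() = (i2 f)^`() by exact: esym (deriv_map i1 f).
  rewrite e0 derivD !derivM derivC mulr0 addr0 !rmorphD !rmorphM ef1 (ev2C (i1 q)) ev1q.
  by rewrite !(mulr0, addr0, add0r) mulrC.
move=> a ha; have [v ea] := hf1 _ ha.
pose w := divp (i2 a) f1.
have [Z eZ] : exists Z : {poly {poly E}},
    i2 (G * a) = (i1 q^`())%:P * f1^`() * w * i2 f + Z * (i1 q)%:P.
  have eGE : i2 G = G0 - W * (i1 q)%:P by rewrite eG -EG addrK.
  have e1 : f2 * f1 = i2 f - v0 * (i1 q)%:P by rewrite e0 addrK.
  exists (G0 * v - W * i2 a - (i1 q^`())%:P * f1^`() * w * v0).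
  have ea0 : G0 * i2 a = (i1 q^`())%:P * f1^`() * w * (f2 * f1) + G0 * v * (i1 q)%:P.
    by rewrite {1}ea -/w /G0; ring.
  by rewrite rmorphM eGE mulrBl ea0 e1; ring.
(* Descent of the relation from [E] to [R]: after division by [f] on both sides, sizes force
   [Y = 0], so the remainder [r] equals [Z2 * q] over [E], and then [q], being monic, divides its
   coefficients over [R]. *)
pose V := divp (G * a) f; pose r := modp (G * a) f.
have er : G * a = V * f + r by apply: Pdiv.IdomainMonic.divp_eq.
pose Z1 := divp Z (i2 f); pose Z2 : {poly {poly E}} := modp Z (i2 f).
have eZ12 : Z = Z1 * i2 f + Z2 by apply: Pdiv.IdomainMonic.divp_eq.
pose Y : {poly {poly E}} := (i1 q^`())%:P * f1^`() * w - i2 V + Z1 * (i1 q)%:P.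
have eY : i2 r - Z2 * (i1 q)%:P = Y * i2 f.
  have -> : i2 r = i2 (G * a) - i2 V * i2 f.
    by rewrite er rmorphD rmorphM addrAC subrr add0r.
  by rewrite eZ eZ12 /Y; ring.
have Y0 : Y = 0.
  apply/eqP; apply: contraT => Y0.
  have : (size (Y * i2 f)%R < size (i2 f))%N.
    rewrite -eY; apply: leq_ltn_trans (size_polyD _ _) _.
    rewrite gtn_max size_polyN (size_map_inj_poly i1inj (rmorph0 i1)).
    rewrite (size_map_inj_poly i1inj (rmorph0 i1)) ltn_modp monic_neq0 //=.
    rewrite mulrC mul_polyC; apply: leq_ltn_trans (size_scale_leq _ _) _.
    rewrite -(size_map_inj_poly i1inj (rmorph0 i1)) -/(i2 f) ltn_modp monic_neq0 //.
  rewrite size_Mmonic //; move: Y0; rewrite -size_poly_gt0.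
  by case: (size Y) => // n _; rewrite addSn /= ltnNge leq_addl.
have er2 : i2 r = Z2 * (i1 q)%:P.
  by apply/eqP; rewrite -subr_eq0 eY Y0 mul0r.
have /choice[c hc] j : divides q r`_j.
  apply: (monic_div_descent (f := i) (z := Z2`_j)) => //.
  by rewrite -[LHS]/(i1 r`_j) -coef_map -/i2 er2 coefMC.
exists (\poly_(j < size r) c j), V; rewrite er addrC; congr (_ + _).
apply/polyP => j; rewrite coefMC coef_poly; case: ltnP => h; first exact: hc.
by rewrite nth_default // mul0r.
Qed.

End PlaneCurvePoint.

Lemma poly_rmorph_ext (R : nzRingType) (S : comNzRingType)
    (f g : {rmorphism {poly R} -> S}) :
  (forall c, f c%:P = g c%:P) -> f 'X = g 'X -> f =1 g.
Proof.
move=> hc hX p; rewrite -[p]coefK poly_def !rmorph_sum; apply: eq_bigr => i _.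
by rewrite -mul_polyC !rmorphM !rmorphXn hc hX.
Qed.

(** [B] comes without a notion of unit, so inverses are chosen classically to equip it with the
    integral domain structure that the fraction field construction expects. *)
Lemma domain_fraction (B : comNzRingType) :
  (forall x y : B, x * y = 0 -> x = 0 \/ y = 0) ->
  exists (K : fieldType) (f : {rmorphism B -> K}), injective f /\ isfrac f.
Proof.
move=> hB.
pose unit (x : B) := `[< exists y, y * x = 1 >].
have /choice[inv hinv] : forall x : B, exists z,
    (unit x -> z * x = 1) /\ (~~ unit x -> z = x).
  move=> x; have [/[dup] hx /asboolP[y hy]|nx] := boolP (unit x).
    by exists y; split=> // /negP.
  by exists x; split=> // hx; case/negP: nx.
have h1 : {in unit, left_inverse 1 inv *%R} by move=> x ux; apply: (hinv x).1.
have h2 : forall x y : B, y * x = 1 -> unit x by move=> x y e; apply/asboolP; exists y.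
have h3 : {in [predC unit], inv =1 id} by move=> x ux; apply: (hinv x).2.
pose mU := GRing.ComNzRing_hasMulInverse.Build B h1 h2 h3.
pose B1 : comUnitRingType := HB.pack (GRing.ComNzRing.sort B) (GRing.ComNzRing.class B) mU.
have h4 : GRing.integral_domain_axiom B1.
  by move=> x y /hB[] ->; rewrite eqxx ?orbT.
pose mI := GRing.ComUnitRing_isIntegral.Build B1 h4.
pose B2 : idomainType := HB.pack (GRing.ComUnitRing.sort B1) (GRing.ComUnitRing.class B1) mI.
pose t : {rmorphism B2 -> {fraction B2}} := @tofrac B2.
exists {fraction B2}, t; split=> [x y e|]; last exact: isfrac_tofrac.
by apply/eqP; rewrite -(@tofrac_eq B2); apply/eqP.
Qed.

Lemma residue_field (A : comNzRingType) (P : set A) : rprime P ->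
  exists (K : fieldType) (f : {rmorphism A -> K}), (forall a, f a = 0 <-> P a) /\ isfrac f.
Proof.
case=> [[h0 hD hM] h1 hP].
pose S : A -> bool := fun x => `[< P x >].
have hI : idealr_closed S.
  split; [exact/asboolP|exact/asboolP|move=> a u v /asboolP Pu /asboolP Pv].
  by apply/asboolP; apply: (hD) => //; apply: (hM).
have hpr : prime_idealr_closed S.
  by move=> u v /asboolP/hP[] h; apply/orP; [left|right]; apply/asboolP.
pose I : prime_idealr A := HB.pack S (isIdealr.Build A S hI) (isPrimeIdealrClosed.Build A S hpr).
pose B : comNzRingType := {ideal_quot I}.
have [x y|K [f [finj ff]]] := @domain_fraction B.
  by move/(@Quotient.rquot_IdomainAxiom A I)/orP => [] /eqP; [left|right].
pose pi : A -> B := fun x => \pi_({ideal_quot I})%qT x.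
have piB : zmod_morphism pi by move=> x y; rewrite /pi !piE.
have piM : monoid_morphism pi by split=> [|x y]; rewrite /pi !piE.
pose p : {rmorphism A -> B} :=
  HB.pack pi (GRing.isZmodMorphism.Build A B pi piB) (GRing.isMonoidMorphism.Build A B pi piM).
have p0 a : p a = 0 <-> P a.
  split=> [h|Pa].
    suff /asboolP : S a by [].
    have /eqP : pi a == pi 0 by apply/eqP; apply: (etrans h); apply: esym; exact: (rmorph0 p).
    by move/eqquotP; rewrite /Quotient.equiv subr0.
  rewrite -(rmorph0 p); apply/eqquotP.
  by rewrite /Quotient.equiv subr0; apply/asboolP.
exists K, (f \o p); split=> [a|x].
  rewrite -p0; split=> [h|h]; last by rewrite -[LHS]/(f (p a)) h rmorph0.
  by apply: finj; rewrite rmorph0.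
have [a [b [b0 ->]]] := ff x.
exists (repr a), (repr b).
have e (c : B) : p (repr c) = c by rewrite /= /pi reprK.
by rewrite -[_ (repr a)]/(f (p (repr a))) -[_ (repr b)]/(f (p (repr b))) !e.
Qed.

(** [residue_lift] expressed by a single morphism: the fraction field of [R] maps to [L] because [F]
    is injective on [R], and [rho], [tau] are the images of the two variables. *)
Lemma residue_lift_morph (R : idomainType) (L : fieldType)
    (F : {rmorphism {poly {poly R}} -> L}) (q : {poly R}) (f : {poly {poly R}}) :
  int_closed R -> (forall r, F r%:P%:P = 0 -> r = 0) -> [pchar L] =i pred0 ->
  q \is monic -> f \is monic -> (forall p, F p%:P = 0 <-> divides q p) ->
  F f = 0 ->
  exists G, F G = F (q^`())%:P * F f^`() /\
    forall a, F a = 0 -> exists u v, G * a = u * q%:P + v * f.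
Proof.
move=> hR hinj char0 mq mf hq hf.
pose g : {rmorphism R -> L} := F \o polyC \o polyC.
have [|psi hpsi] := @frac_lift R {fraction R} L (@tofrac R) g (@isfrac_tofrac R).
  move=> r; split=> [/eqP|/hinj ->]; last exact: rmorph0.
  by rewrite tofrac_eq0 => /eqP ->; exact: rmorph0.
pose rho := F 'X%:P; pose tau := F 'X.
pose ev1 : {rmorphism {poly {fraction R}} -> L} := horner_eval rho \o map_poly psi.
pose ev2 : {rmorphism {poly {poly {fraction R}}} -> L} := horner_eval tau \o map_poly ev1.
pose i1 : {rmorphism {poly R} -> {poly {fraction R}}} := map_poly (@tofrac R).
pose i2 : {rmorphism {poly {poly R}} -> {poly {poly {fraction R}}}} := map_poly i1.
have e1 p : ev1 (i1 p) = F p%:P.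
  apply: (poly_rmorph_ext (f := ev1 \o i1) (g := F \o polyC)) => [c|].
    by rewrite /ev1 /i1 /= !map_polyC /horner_eval hornerC -[LHS]/(psi (@tofrac R c)) hpsi.
  by rewrite /ev1 /i1 /= !map_polyX /horner_eval hornerX.
have e2 a : ev2 (i2 a) = F a.
  apply: (poly_rmorph_ext (f := ev2 \o i2) (g := F)) => [c|].
    by rewrite -e1 /ev2 /i2 /= !map_polyC /horner_eval hornerC.
  by rewrite /ev2 /i2 /= !map_polyX /horner_eval hornerX.
have char0' : [pchar {fraction R}] =i pred0 by move=> p; rewrite -(fmorph_pchar psi) char0.
have tinj : injective (@tofrac R).
  by move=> x y /eqP; rewrite tofrac_eq => /eqP.
have [||G [hG1 hG2]] := @residue_lift R {fraction R} L (@tofrac R) psi rho tau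
  hR tinj (@isfrac_tofrac R) char0' q f mq mf.
- by move=> p; rewrite -hq -e1.
- exact: (etrans (e2 f)).
exists G; split=> [|a ha]; first by rewrite -e2 -e1 -e2; exact: hG1.
by apply: hG2; exact: (etrans (e2 a)).
Qed.

(** * Noether normalisation *)

(** A leading coefficient relative to a prescribed degree [a]. As [c] may vanish, the notion is
    multiplicative without case distinctions. *)
Definition has_top (S : nzRingType) (p : {poly S}) (a : nat) (c : S) : Prop :=
  (size p <= a.+1)%N /\ p`_a = c.

Lemma has_top1 (S : comNzRingType) : has_top (1 : {poly S}) 0 1.
Proof. by split; rewrite ?size_poly1 ?coef1. Qed.

Lemma has_topM (S : comNzRingType) (p q : {poly S}) a b c d :
  has_top p a c -> has_top q b d -> has_top (p * q) (a + b) (c * d).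
Proof.
move=> [sp pa] [sq qb]; split.
  apply: leq_trans (size_polyMleq _ _) _.
  by move: (size p) (size q) sp sq => u v; clear; lia.
rewrite coefM (bigD1 (inord a)) //= inordK ?ltnS ?leq_addr // addKn pa qb.
rewrite big1 ?addr0 // => j; rewrite -val_eqE /= inordK ?ltnS ?leq_addr // => ja.
have [lt|gt|eq] := ltngtP j a; last by rewrite eq eqxx in ja.
  have h : (b < a + b - j)%N by rewrite ltn_subRL ltn_add2r.
  by rewrite [q`__]nth_default ?mulr0 // (leq_trans sq).
by rewrite [p`__]nth_default ?mul0r // (leq_trans sp).
Qed.

Lemma has_topX (S : comNzRingType) (p : {poly S}) a c n :
  has_top p a c -> has_top (p ^+ n) (n * a) (c ^+ n).
Proof.
move=> h; elim: n => [|n IH]; first by rewrite mul0n !expr0; apply: has_top1.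
by rewrite !exprS mulSn; apply: has_topM.
Qed.

Lemma has_top_prod (S : comNzRingType) (T : finType) (P : T -> {poly S}) (a : T -> nat) c :
  (forall i, has_top (P i) (a i) (c i)) ->
  has_top (\prod_i P i) (\sum_i a i) (\prod_i c i).
Proof.
move=> h; elim: (index_enum T) => [|x s IH]; first by rewrite !big_nil; apply: has_top1.
by rewrite !big_cons; apply: has_topM.
Qed.

Section TopForm.
Variables (k : fieldType) (n : nat).
Implicit Types (p : {mpoly k[n.+1]}) (m : 'X_{1..n.+1}).

Local Notation wid := (widen_ord (leqnSn n)).

Definition mrestr m : 'X_{1..n} := [multinom m (wid i) | i < n].

Lemma mdeg_restr m : mdeg m = (mdeg (mrestr m) + m ord_max)%N.
Proof.
rewrite !mdegE big_ord_recr /=; congr (_ + _)%N.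
by apply: eq_bigr => i _; rewrite mnmE.
Qed.

(* The leading form of [p] at total degree [e], dehomogenised in the last variable. *)
Definition top_form p (e : nat) : {mpoly k[n]} :=
  \sum_(m <- msupp p | mdeg m == e) p@_m *: 'X_[mrestr m].

Lemma top_form_neq0 p : p != 0 -> top_form p (msize p).-1 != 0.
Proof.
move=> p0; set e := (msize p).-1.
have [m0 m0s dm0] : exists2 m0, m0 \in msupp p & mdeg m0 = e.
  exists (mlead p); first by rewrite mlead_supp.
  by rewrite /e -(mlead_deg p0).
apply/eqP => /mpolyP /(_ (mrestr m0)); rewrite mcoeff0 /top_form raddf_sum /=.
rewrite big_mkcond (bigD1_seq m0) ?msupp_uniq //= dm0 eqxx.
rewrite mcoeffZ mcoeffX eqxx mulr1 big1 ?addr0 => [h|m mm].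
  by move: m0s; rewrite mcoeff_msupp h eqxx.
case: eqP => // dm; rewrite mcoeffZ mcoeffX; case: eqP => [h|]; last by rewrite mulr0.
case/eqP: mm; apply/mnmP => i.
have hm : m ord_max = m0 ord_max.
  by apply/eqP; move/eqP: (etrans dm (esym dm0)); rewrite !mdeg_restr h eqn_add2l.
have [j ->|-> //] := unliftP ord_max i.
have -> : lift ord_max j = wid j by apply/val_inj; rewrite [LHS]lift_max.
by have /mnmP/(_ j) := h; rewrite !mnmE.
Qed.

Definition shear_subst (S : comNzRingType) (f : k -> S) (c : 'I_n -> S)
    (lam : 'I_n -> k) (i : 'I_n.+1) : {poly S} :=
  if unlift ord_max i is Some j then (c j)%:P + (f (lam j))%:P * 'X else 'X.

(** Noether's substitution, made homogeneous of degree [e] by powers of [s]. With [s = 1] it serves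
    the normalisation, with [s] a variable the degree bounds. The truncated [e - mdeg m] is
    meaningful because [e] is taken at least the degree of [p]. *)
Definition shear_homog (S : comNzRingType) (f : {rmorphism k -> S}) (c : 'I_n -> S)
    (s : S) (lam : 'I_n -> k) (e : nat) p : {poly S} :=
  \sum_(m <- msupp p) (f p@_m * s ^+ (e - mdeg m))%:P *
     \prod_i shear_subst f c lam i ^+ m i.

(** A monomial becomes a polynomial of degree at most its total degree, so only monomials of degree
    [e] reach ['X^e], each through the powers of the [lam j]. *)
Lemma shear_top (S : comNzRingType) (f : {rmorphism k -> S}) c s lam e p :
  (msize p <= e.+1)%N ->
  has_top (shear_homog f c s lam e p) e (f (top_form p e).@[lam]).
Proof.
move=> sp.
have tm m : has_top (\prod_i shear_subst f c lam i ^+ m i) (mdeg m)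
    (f (\prod_(j < n) lam j ^+ mrestr m j)).
  have -> : f (\prod_(j < n) lam j ^+ mrestr m j) = \prod_(i < n.+1)
      (if unlift ord_max i is Some j then f (lam j) else 1) ^+ m i.
    rewrite big_ord_recr /= unlift_none expr1n mulr1 rmorph_prod; apply: eq_bigr => j _.
    have -> : widen_ord (leqnSn n) j = lift ord_max j by apply/val_inj; rewrite [RHS]lift_max.
    rewrite liftK rmorphXn; congr (_ ^+ _); rewrite mnmE; congr (m _).
    by apply/val_inj; rewrite [RHS]lift_max.
  rewrite mdegE; apply: (has_top_prod (a := fun i => m i)) => i.
  rewrite -[X in has_top _ X _]muln1; apply: has_topX; rewrite /shear_subst.
  case: (unlift _ i) => [j|]; last by split; rewrite ?size_polyX ?coefX.
  split; last by rewrite coefD coefC add0r coefCM coefX mulr1.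
  apply: leq_trans (size_polyD _ _) _; rewrite geq_max (leq_trans (size_polyC_leq1 _)) //=.
  rewrite mul_polyC; apply: leq_trans (size_scale_leq _ _) _.
  by rewrite size_polyX.
have tm' m : m \in msupp p -> has_top ((f p@_m * s ^+ (e - mdeg m))%:P *
    \prod_i shear_subst f c lam i ^+ m i) e
    (if mdeg m == e then f p@_m * f (\prod_(j < n) lam j ^+ mrestr m j) else 0).
  move=> ms; have hm : (mdeg m <= e)%N.
    by rewrite -ltnS; apply: leq_trans sp; apply: msize_mdeg_lt.
  have [szm cm] := tm m; rewrite mul_polyC; split.
    by apply: leq_trans (size_scale_leq _ _) _; apply: leq_trans szm _; rewrite ltnS.
  rewrite coefZ; case: eqP => [em|/eqP ne].
    by rewrite -em cm subnn expr0 mulr1.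
  by rewrite nth_default ?mulr0 //; apply: leq_trans szm _; rewrite ltn_neqAle ne.
split.
  rewrite /shear_homog; apply: leq_trans (size_sum _ _ _) _.
  by apply/bigmax_leqP_seq => m ms _; case: (tm' m ms).
have -> : (top_form p e).@[lam] =
    \sum_(m <- msupp p | mdeg m == e) (p@_m *: 'X_[mrestr m]).@[lam].
  exact: (raddf_sum (meval lam)).
rewrite /shear_homog coef_sum (raddf_sum f) /= [RHS]big_mkcond /=.
rewrite big_seq [RHS]big_seq; apply: eq_bigr => m ms.
case: (tm' m ms) => _ ->; case: eqP => // _.
by rewrite mevalZ mevalX rmorphM.
Qed.

End TopForm.

Lemma mpoly_nonvanishing (k : fieldType) n (p : {mpoly k[n]}) :
  [pchar k] =i pred0 -> p != 0 -> exists v, p.@[v] != 0.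
Proof.
move=> k0; elim: n p => [|n IH] p p0.
  exists (fun=> 0); have ex : p = (p@_0)%:MP.
    apply/mpolyP => m; rewrite mcoeffC; have -> : m = 0%MM by apply/mnmP; case.
    by rewrite eqxx mulr1.
  by rewrite ex mevalC; apply: contraNneq p0 => c0; rewrite ex c0 mpolyC0.
have P0 : muni p != 0 by apply: contraNneq p0 => h; rewrite -[p]muniK h rmorph0.
have [v hv] : exists v, (lead_coef (muni p)).@[v] != 0 by apply: IH; rewrite lead_coef_eq0.
pose r := map_poly (meval v) (muni p).
have r0 : r != 0.
  apply/eqP => /polyP /(_ (size (muni p)).-1); rewrite coef_map coef0 -lead_coefE => h.
  by rewrite h eqxx in hv.
have [t ht] : exists t, ~~ root r t.
  apply: contrapT => h.
  have hr t : root r t by apply: contrapT => /negP nt; apply: h; exists t.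
  pose s : seq k := [seq i%:R | i <- iota 0 (size r)].
  have us : uniq s.
    rewrite map_inj_in_uniq ?iota_uniq // => i j _ _.
    wlog : i j / (i <= j)%N.
      by move=> hw; have [/hw//|/ltnW/hw hji] := leqP i j => /esym/hji.
    move=> ij /eqP; rewrite eq_sym -subr_eq0 -natrB //.
    have /pcharf0P -> := k0; rewrite subn_eq0 => ji.
    by apply/eqP; rewrite eqn_leq ij.
  have := roots_geq_poly_eq0 (p := r) (rs := s) _ us _.
  rewrite size_map size_iota leqnn => h'; case/eqP: r0; apply: h' => //.
  by apply/allP => x _; apply: hr.
pose w (i : 'I_n.+1) := if unlift ord_max i is Some j then v j else t.
exists w; suff -> : p.@[w] = r.[t] by [].
apply: (mpoly_rmorph_ext (f := meval w)
   (g := horner_eval t \o map_poly (meval v) \o @muni n k)) => [c|i] /=.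
  by rewrite mevalC muniC map_polyC /horner_eval hornerC /= mevalC.
rewrite mevalXU /w; have [j ->|->] := unliftP ord_max i.
  have -> : lift ord_max j = widen_ord (leqnSn n) j.
    by apply/val_inj; rewrite [LHS]lift_max.
  by rewrite muniXwiden map_polyC /horner_eval hornerC /= mevalXU.
by rewrite muniXmax map_polyX /horner_eval hornerX.
Qed.

Section Evaluation.
Variables (k : fieldType) (A : comAlgType k).

Definition evm n (y : 'I_n -> A) : {mpoly k[n]} -> A := mmap (in_alg A) y.

HB.instance Definition _ n (y : 'I_n -> A) := GRing.RMorphism.on (evm y).

Lemma evmC n (y : 'I_n -> A) c : evm y c%:MP = c%:A.
Proof. by rewrite /evm mmapC. Qed.

Lemma evmX n (y : 'I_n -> A) i : evm y 'X_i = y i.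
Proof. by rewrite /evm mmapX mmap1U. Qed.

Definition integral_mod n (y : 'I_n -> A) (P : set A) (a : A) : Prop :=
  exists2 p : {poly {mpoly k[n]}}, p \is monic & P ((map_poly (evm y) p).[a]).

Definition independent_mod n (y : 'I_n -> A) (P : set A) : Prop :=
  forall p, P (evm y p) -> p = 0.

Definition normalizes n (y : 'I_n -> A) (P : set A) : Prop :=
  forall a, integral_mod y P a.

(** The dimension of [A / P], encoded by a Noether normalisation; [chain_bound] and [chain_above]
    identify [d] with a maximal chain length. *)
Definition has_dim (P : set A) (d : nat) : Prop :=
  exists y : 'I_d -> A, independent_mod y P /\ normalizes y P.

Lemma integral_modE n (y : 'I_n -> A) (P : set A) (K : fieldType) (f : {rmorphism A -> K}) a :
  (forall a, f a = 0 <-> P a) -> integral_mod y P a <-> integralOver (f \o evm y) (f a).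
Proof.
move=> f0; split=> -[p mp h]; exists p => //.
  by rewrite /root map_poly_comp horner_map; apply/eqP/f0.
by move: h; rewrite /root map_poly_comp horner_map => /eqP/f0.
Qed.

Lemma integral_mod_sub n (y : 'I_n -> A) (P Q : set A) a :
  P `<=` Q -> integral_mod y P a -> integral_mod y Q a.
Proof. by move=> h [p mp Pp]; exists p => //; apply: h. Qed.

Lemma integral_evm n (y : 'I_n -> A) (R : comNzRingType) (K : fieldType)
    (g : {rmorphism R -> K}) (f : {rmorphism A -> K}) :
  (forall c, integralOver g (f c%:A)) -> (forall i, integralOver g (f (y i))) ->
  forall p, integralOver g (f (evm y p)).
Proof.
move=> hC hy; apply: mpolyind => [|c m p _ _ IH].
  by rewrite !rmorph0; apply: integral0.
rewrite !rmorphD; apply: integral_add => //.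
rewrite -mul_mpolyC !rmorphM /= evmC; apply: integral_mul; first exact: hC.
rewrite mpolyXE_id !rmorph_prod /=; elim/big_ind: _ => [|a b|i _].
- exact: integral1.
- exact: integral_mul.
rewrite !rmorphXn /= evmX; elim: (m i) => [|j IHj]; first exact: integral1.
by rewrite exprS; apply: integral_mul.
Qed.

Lemma shear_homog_evm n (y : 'I_n.+1 -> A) (lam : 'I_n -> k) e p :
  (map_poly (evm (fun j => y (lift ord_max j) - lam j *: y ord_max))
     (shear_homog (@mpolyC n k) (fun j => 'X_j) 1 lam e p)).[y ord_max] = evm y p.
Proof.
rewrite {2}/evm [in RHS]/mmap /shear_homog rmorph_sum /= horner_sum.
apply: eq_bigr => m _; rewrite rmorphM /= hornerM map_polyC hornerC /=.
rewrite expr1n mulr1 evmC; congr (_ * _).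
rewrite rmorph_prod horner_prod /mmap1; apply: eq_bigr => i _.
rewrite rmorphXn horner_exp; congr (_ ^+ _); rewrite /shear_subst.
have [j ->|->] := unliftP ord_max i; last by rewrite /= map_polyX hornerX.
rewrite rmorphD rmorphM /= !map_polyC map_polyX hornerD hornerM !hornerC hornerX /=.
by rewrite evmX evmC mulr_algl subrK.
Qed.

Hypothesis char0 : [pchar k] =i pred0.

Lemma shear_monic n (p : {mpoly k[n.+1]}) : p != 0 -> exists lam (c : k), c != 0 /\
  forall (S : comNzRingType) (f : {rmorphism k -> S}) x s,
  has_top (shear_homog f x s lam (msize p).-1 p) (msize p).-1 (f c).
Proof.
move=> p0; have [lam hl] := mpoly_nonvanishing char0 (top_form_neq0 p0).
exists lam, (top_form p (msize p).-1).@[lam]; split=> // S f x s.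
by apply: shear_top; apply: leqSpred.
Qed.

(** In the sheared variables the relation [p] is, up to the unit [c], a monic equation for the last
    variable; the other old variables are linear combinations of it and the new ones. *)
Lemma integral_shear n (y : 'I_n.+1 -> A) (P : set A) p lam e c : rprime P ->
  c != 0 -> has_top (shear_homog (@mpolyC n k) (fun j => 'X_j) 1 lam e p) e c%:MP ->
  P (evm y p) -> normalizes y P ->
  normalizes (fun j => y (lift ord_max j) - lam j *: y ord_max) P.
Proof.
move=> hP c0 htop Pp hy; set z := fun j => _.
have [K [f [f0 _]]] := residue_field hP.
pose T := shear_homog (@mpolyC n k) (fun j => 'X_j) 1 lam e p.
have [sT cT] : has_top T e c%:MP by [].
have imax : integralOver (f \o evm z) (f (y ord_max)).
  apply/(integral_modE _ _ f0); exists (c^-1%:MP *: T).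
    have sT' : size T = e.+1.
      apply/eqP; rewrite eqn_leq sT /= ltnNge; apply/negP => h.
      by move: cT; rewrite nth_default // => /esym/eqP; rewrite mpolyC_eq0 (negbTE c0).
    rewrite monicE lead_coefE size_scale; last first.
      by rewrite mpolyC_eq0 invr_eq0.
    by rewrite sT' coefZ /= cT -mpolyCM mulVf // mpolyC1.
  rewrite map_polyZ hornerZ shear_homog_evm; case: (hP) => -[_ _ h] _ _.
  exact: h.
have iC d : integralOver (f \o evm z) (f d%:A).
  by rewrite -(evmC z); apply: (integral_id (f \o evm z)).
have iy i : integralOver (f \o evm z) (f (y i)).
  have [j ->|->] := unliftP ord_max i; last exact: imax.
  have -> : y (lift ord_max j) = z j + lam j *: y ord_max by rewrite subrK.
  rewrite rmorphD -mulr_algl rmorphM; apply: integral_add; last exact: integral_mul.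
  by rewrite -(evmX z); apply: (integral_id (f \o evm z)).
move=> a; apply/(integral_modE _ _ f0).
have /(integral_modE _ _ f0) [r mr rr] := hy a.
apply: (integral_root_monic (p := map_poly (f \o evm y) r)) => //.
  exact: monic_map.
apply/integral_poly => i; rewrite coef_map /=.
exact: integral_evm.
Qed.

Lemma integral_eliminate n (y : 'I_n.+1 -> A) (P : set A) p : rprime P ->
  p != 0 -> P (evm y p) -> normalizes y P ->
  exists lam, normalizes (fun j => y (lift ord_max j) - lam j *: y ord_max) P.
Proof.
move=> hP p0 Pp hy; have [lam [c [c0 htop]]] := shear_monic p0.
by exists lam; apply: integral_shear c0 (htop _ _ _ _) Pp hy.
Qed.

Lemma has_dim_exists (P : set A) : finitely_generated A -> rprime P ->
  exists d, has_dim P d.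
Proof.
case=> s hs hP.
have : exists y : 'I_(size s) -> A, normalizes y P.
  exists (fun i => s`_i) => a; set y := fun i => _.
  pose B : set A := fun x => exists p, x = evm y p.
  have h : B = setT.
    apply: hs; last first.
      move=> x /(nthP 0)[i si <-]; exists 'X_(Ordinal si).
      by rewrite evmX.
    split; first by exists 1; rewrite rmorph1.
    split; first by move=> _ _ [p ->] [q ->]; exists (p + q); rewrite rmorphD.
    split; first by move=> _ _ [p ->] [q ->]; exists (p * q); rewrite rmorphM.
    by move=> c _ [p ->]; exists (c%:MP * p); rewrite rmorphM /= evmC mulr_algl.
  have [p ->] : B a by rewrite h.
  exists ('X - p%:P); first exact: monicXsubC.
  rewrite rmorphB /= map_polyX map_polyC hornerXsubC subrr.
  by case: hP => -[].
elim: (size s) => [|n IH] [y hy].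
  exists 0%N, y; split=> // p Pp; apply/eqP; apply: contrapT => /negP p0.
  case: hP => -[_ _ hM] h1 _; apply: h1.
  have ep : p = (p@_0)%:MP.
    apply/mpolyP => m; rewrite mcoeffC; have -> : m = 0%MM by apply/mnmP; case.
    by rewrite eqxx mulr1.
  have c0 : p@_0 != 0 by apply: contraNneq p0 => c0; rewrite ep c0 mpolyC0.
  rewrite [1](_ : _ = (p@_0)^-1%:A * evm y p); first exact: hM.
  by rewrite [X in evm y X]ep evmC mulr_algl scalerA mulVf // scale1r.
have [hi|/existsNP[p /not_implyP[Pp /eqP p0]]] := pselect (independent_mod y P).
  by exists n.+1, y.
by have [lam hz] := integral_eliminate hP p0 Pp hy; apply: IH; exists (fun j => y (lift ord_max j) - lam j *: y ord_max).
Qed.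

End Evaluation.

(** * Going down and heights *)

Lemma minpoly_integral_frac (R : idomainType) (E K : fieldType) (i : {rmorphism R -> E})
    (h : {rmorphism E -> K}) x :
  int_closed R -> injective i -> isfrac i -> integralOver (h \o i) x ->
  exists m : {poly R}, [/\ m \is monic, root (map_poly (h \o i) m) x &
    forall p, root (map_poly (h \o i) p) x -> divides m p].
Proof.
move=> hR iinj ifrac [p0 mp0 rp0].
have exP : exists n, `[< exists2 p : {poly E}, p \is monic &
    root (map_poly h p) x /\ size p = n >].
  exists (size (map_poly i p0)); apply/asboolP.
  by exists (map_poly i p0); rewrite ?monic_map // -map_poly_comp.
case: (ex_minnP exP) => n /asboolP[m mm [rm sm]] min.
have dvd (p : {poly E}) : root (map_poly h p) x -> exists c, p = c * m.
  move=> rp; have e := divp_eq p m; exists (p %/ m).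
  suff r0 : p %% m = 0 by rewrite {1}e r0 addr0.
  apply/eqP; apply: contraT => r0.
  have rr : root (map_poly h (p %% m)) x.
    have : root (map_poly h (p %/ m * m + p %% m)) x by rewrite -e.
    by rewrite /root rmorphD rmorphM hornerD hornerM (eqP rm) mulr0 add0r.
  have lc0 : lead_coef (p %% m) != 0 by rewrite lead_coef_eq0.
  have : (n <= size (modp p m))%N.
    apply: min; apply/asboolP; exists ((lead_coef (p %% m))^-1 *: (p %% m)).
      by rewrite monicE lead_coefZ mulVf.
    split; last by rewrite size_scale // invr_eq0.
    by rewrite map_polyZ /root hornerZ (eqP rr) mulr0.
  by rewrite -sm leqNgt ltn_modp monic_neq0.
have [c ec] : exists c, map_poly i p0 = c * m by apply: dvd; rewrite -map_poly_comp.
have mc : c \is monic by rewrite -(monicMr _ mm) -ec monic_map.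
have [m0 em0] : exists m0, m = map_poly i m0.
  apply: (monic_factor_descent (q := c) (P := p0)) => //.
  by rewrite ec mulrC.
have mm0 : m0 \is monic.
  move: mm; rewrite em0 !monicE lead_coef_map_inj ?rmorph0 // -[1](rmorph1 i).
  by rewrite (inj_eq iinj).
exists m0; split=> //; first by rewrite map_poly_comp -em0.
move=> p; rewrite map_poly_comp => /dvd[d ed].
by apply: (monic_div_descent (f := i) (z := d)) => //; rewrite -em0.
Qed.

Lemma tofrac_inj (R : idomainType) : injective (@tofrac R).
Proof. by move=> a b /eqP; rewrite tofrac_eq => /eqP. Qed.

Lemma fraction_embed (R : idomainType) (K : fieldType) (g : {rmorphism R -> K}) :
  injective g -> exists (E : fieldType) (i : {rmorphism R -> E}) (h : {rmorphism E -> K}),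
  [/\ injective i, isfrac i & forall r, h (i r) = g r].
Proof.
move=> ginj; have [|h hh] := @frac_lift R {fraction R} K (@tofrac R) g (@isfrac_tofrac R).
  move=> r; split=> [/eqP|/eqP].
    by rewrite tofrac_eq0 => /eqP->; rewrite rmorph0.
  by rewrite -(rmorph0 g) (inj_eq ginj) => /eqP->; rewrite rmorph0.
exists {fraction R}, (@tofrac R), h; split=> //; [exact: tofrac_inj|exact: isfrac_tofrac].
Qed.

(** Integral closedness gives the minimal polynomial over the fraction field coefficients in [R],
    and division by a monic polynomial agrees over both rings; so [m] generates the ideal of all
    relations. *)
Lemma minpoly_integral (R : idomainType) (K : fieldType) (g : {rmorphism R -> K}) x :
  int_closed R -> injective g -> integralOver g x ->
  exists m : {poly R}, [/\ m \is monic, root (map_poly g m) x &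
    forall p, root (map_poly g p) x -> divides m p].
Proof.
move=> hR ginj [p mp rp].
have [E [i [h [iinj ifrac hi]]]] := fraction_embed ginj.
have mapE : map_poly (h \o i) =1 map_poly g by apply: eq_map_poly.
have [|m [mm rm dm]] := minpoly_integral_frac (h := h) (x := x) hR iinj ifrac.
  by exists p; rewrite ?mapE.
by exists m; split=> [||r]; rewrite -?mapE //; apply: dm.
Qed.

(** This is [t ^+ N * p (s X / t)], with [N] the degree of [p], written without denominators: it
    kills [w] when [s w = t z] for a root [z] of [p]. *)
Definition scale_poly (R : comNzRingType) (p : {poly R}) (s t : R) : {poly R} :=
  \poly_(i < size p) (p`_i * t ^+ ((size p).-1 - i) * s ^+ i).

Lemma scale_poly_root (R : comNzRingType) (K : fieldType) (g : {rmorphism R -> K})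
    (p : {poly R}) s t z w :
  w * g s = z * g t -> root (map_poly g p) z -> root (map_poly g (scale_poly p s t)) w.
Proof.
move=> e; rewrite /root => /eqP rp; apply/eqP.
rewrite -(mulr0 (g t ^+ (size p).-1)) -rp /scale_poly poly_def rmorph_sum horner_sum.
have -> : (map_poly g p).[z] = \sum_(i < size p) g p`_i * z ^+ i by rewrite /map_poly horner_poly.
rewrite mulr_sumr; apply: eq_bigr => i _.
rewrite /= map_polyZ map_polyXn hornerZ hornerXn /=.
rewrite !rmorphM !rmorphXn /= -!mulrA -[g s ^+ i * _]exprMn [g s * w]mulrC e exprMn.
have -> : g t ^+ (size p).-1 = g t ^+ ((size p).-1 - i) * g t ^+ i.
  by rewrite -exprD subnK // -ltnS prednK // (leq_ltn_trans _ (ltn_ord i)).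
ring.
Qed.

Lemma size_scale_poly (R : idomainType) (p : {poly R}) s t :
  s != 0 -> p \is monic -> size (scale_poly p s t) = size p.
Proof.
move=> s0 mp; apply: size_poly_eq; rewrite subnn expr0 mulr1 -lead_coefE (monicP mp).
by rewrite mul1r expf_neq0.
Qed.

Lemma divides_minpoly_coef (R : idomainType) (K : fieldType) (g : {rmorphism R -> K}) x y q u :
  int_closed R -> injective g -> integralOver g x -> integralOver g y ->
  prime_elt q -> ~ divides q u -> x * g u = y * g q ->
  exists m : {poly R}, [/\ m \is monic, root (map_poly g m) x &
    forall i, (i < (size m).-1)%N -> divides q m`_i].
Proof.
move=> hR ginj ix iy hq hu e; have [qI q1 qP] := prime_elt_rprime hq.
have u0 : u != 0 by apply/eqP => h; apply: hu; rewrite h; case: qI.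
have q0 : q != 0 by case: hq.
have [mx [mmx rmx dmx]] := minpoly_integral hR ginj ix.
have [my [mmy rmy dmy]] := minpoly_integral hR ginj iy.
have [h eh] := dmx _ (scale_poly_root e rmy).
have [h' eh'] := dmy _ (scale_poly_root (esym e) rmx).
have s1 := size_scale_poly q u0 mmy; have s2 := size_scale_poly u q0 mmx.
have n1 : scale_poly my u q != 0 by rewrite -size_poly_eq0 s1 size_poly_eq0 monic_neq0.
have n2 : scale_poly mx q u != 0 by rewrite -size_poly_eq0 s2 size_poly_eq0 monic_neq0.
have h0 : h != 0 by apply: contraNneq n1 => z; rewrite eh z mul0r.
have h'0 : h' != 0 by apply: contraNneq n2 => z; rewrite eh' z mul0r.
have [z ez] : exists2 z, h = z%:P & size mx = size my.
  move: s1 s2; rewrite eh eh' !size_Mmonic //.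
  move: (size_poly_gt0 h) (size_poly_gt0 h'); rewrite h0 h'0 => p1 p2 e1 e2.
  exists h`_0; last by move: (size h) (size h') (size mx) (size my) p1 p2 e1 e2; clear; lia.
  apply: size1_polyC.
  by move: (size h) (size h') (size mx) (size my) p1 p2 e1 e2; clear; lia.
move=> sxy; exists mx; split=> // i hi.
have := congr1 (fun p : {poly R} => p`_i) eh.
rewrite /scale_poly ez coefCM coef_poly -sxy.
have hi' : (i < size mx)%N by apply: leq_trans hi (leq_pred _).
rewrite hi' => ei.
have zu : z = u ^+ (size mx).-1.
  have := congr1 (fun p : {poly R} => p`_(size mx).-1) eh.
  rewrite /scale_poly ez coefCM coef_poly -sxy prednK ?(leq_ltn_trans _ hi') // leqnn.
  rewrite subnn expr0 mulr1 -lead_coefE (monicP mmx) mulr1 => <-.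
  by rewrite sxy -lead_coefE (monicP mmy) mul1r.
have : divides q (z * mx`_i).
  exists (my`_i * q ^+ ((size mx).-1 - i).-1 * u ^+ i); rewrite -ei.
  have -> : ((size mx).-1 - i = ((size mx).-1 - i).-1.+1)%N by rewrite prednK // subn_gt0.
  by rewrite exprS /=; ring.
case/qP => //; rewrite zu => /(prime_elt_exp hq); by [].
Qed.

Section Dimension.
Variables (k : fieldType) (A : comAlgType k).
Hypothesis char0 : [pchar k] =i pred0.
Implicit Types (P Q : set A).

Lemma int_closed_mpoly n : int_closed {mpoly k[n]}.
Proof. exact: factorial_int_closed (@factorial_mpoly k n). Qed.

Lemma independent_inj n (y : 'I_n -> A) P (K : fieldType) (f : {rmorphism A -> K}) :
  (forall a, f a = 0 <-> P a) -> independent_mod y P -> injective (f \o evm y).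
Proof.
move=> f0 hi p q /eqP; rewrite -subr_eq0 -rmorphB => /eqP/f0/hi/eqP.
by rewrite subr_eq0 => /eqP.
Qed.

(* If [phi c * u = phi a * q] with [q] not dividing [u], comparing the minimal polynomials of
   [c] and [a] shows that [q] divides all lower coefficients of the former. *)
Lemma going_down n (y : 'I_n -> A) P P1 q : rprime P -> rprime P1 -> P `<=` P1 ->
  independent_mod y P -> normalizes y P -> prime_elt q -> P1 (evm y q) ->
  exists P', [/\ rprime P', P `<=` P', P' `<=` P1 &
    forall r, P' (evm y r) <-> divides q r].
Proof.
move=> hP hP1 sPP1 hi hn hq P1q.
have [K [f [f0 _]]] := residue_field hP.
pose g : {rmorphism {mpoly k[n]} -> K} := f \o evm y.
have ginj : injective g by exact: independent_inj f0 hi.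
have [qI q1 qP] := prime_elt_rprime hq.
have [I1 n1 pr1] := hP1.
(* Modulo [P], [M] consists of products of an element outside [P1] and a polynomial outside [(q)]; a
   prime avoiding [M] lies inside [P1] and contracts into [(q)]. *)
pose M : set A := fun x => exists c u, [/\ ~ P1 c, ~ divides q u & f x = f c * g u].
pose I : set A := fun x => exists a, f x = f a * g q.
have [|||P' [hP' sIP' dP']] := @prime_exists A I M.
- split; first by exists 0; rewrite !rmorph0 mul0r.
    by move=> x z [a ea] [b eb]; exists (a + b); rewrite !rmorphD mulrDl ea eb.
  by move=> a x [b eb]; exists (a * b); rewrite !rmorphM eb mulrA.
- split; first by exists 1, 1; split=> //; rewrite !rmorph1 mulr1.
  move=> x z [c [u [hc hu ex]]] [d [v [hd hv ez]]]; exists (c * d), (u * v); split.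
  + by case/pr1.
  + by case/qP.
  + by rewrite !rmorphM ex ez mulrACA.
- move=> x [a ea] [c [u [hc hu ec]]].
  have ew : f c * g u = f a * g q by rewrite -ec ea.
  have [||m [mm rm dm]] := divides_minpoly_coef (@int_closed_mpoly n) ginj _ _ hq hu ew.
  + by apply/(integral_modE y _ f0).
  + by apply/(integral_modE y _ f0).
  have [N sN] : exists N, size m = N.+1.
    by exists (size m).-1; rewrite prednK // size_poly_gt0 monic_neq0.
  have Pc : P (\sum_(i < N.+1) evm y m`_i * c ^+ i).
    apply/f0; rewrite -(eqP rm) map_poly_comp horner_map horner_coef.
    rewrite size_map_poly_id0 ?sN; last first.
      rewrite (monicP mm) rmorph1 oner_neq0 //.
    by congr (f _); apply: eq_bigr => i _; rewrite coef_map.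
  (* The lower coefficients are multiples of [q], hence in [P1], so the equation of [c] puts
     [c ^+ N] in [P1]. *)
  apply: hc; apply: (rprime_exp (n := N) hP1); move/sPP1: Pc.
  rewrite big_ord_recr /= => h.
  have -> : c ^+ N = evm y m`_N * c ^+ N.
    by rewrite (_ : m`_N = 1) ?rmorph1 ?mul1r // -(monicP mm) lead_coefE sN.
  apply: (rideal_add I1 _ h); apply: rideal_sum => // i _.
  have [|d ->] := dm i; first by rewrite sN.
  by rewrite rmorphM -mulrA; case: (I1) => _ _ hM; apply: (hM); apply: rideal_mulr.
exists P'; split=> //.
- by move=> x Px; apply: sIP'; exists 0; rewrite rmorph0 mul0r; apply/f0.
- move=> x P'x; apply: contrapT => nx; apply: (dP' _ P'x); exists x, 1; split=> //.
  by rewrite rmorph1 mulr1.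
move=> r; split=> [P'r|[d ->]].
  apply: contrapT => nr; apply: (dP' _ P'r); exists 1, r; split=> //.
  by rewrite rmorph1 mul1r.
by apply: sIP'; exists (evm y d); rewrite rmorphM rmorphM.
Qed.

End Dimension.

Lemma mpolyU_neq0 (k : fieldType) n (i : 'I_n) : ('X_i : {mpoly k[n]}) != 0.
Proof.
apply/eqP => /(congr1 (meval (fun=> 1))); rewrite mevalXU meval0.
by move/eqP; rewrite oner_eq0.
Qed.

Lemma const_factor (S : idomainType) (p : S) (u v : {poly S}) e c :
  p%:P = u * v -> has_top v e c -> c != 0 -> (0 < e)%N -> p = 0.
Proof.
move=> euv [sv cv] c0 e0; apply/eqP; apply: contraT => p0.
have u0 : u != 0.
  by apply: contraNneq p0 => h; move: euv; rewrite h mul0r => /eqP; rewrite polyC_eq0.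
have v0 : v != 0 by apply: contraNneq c0 => h; rewrite -cv h coef0.
have sv1 : (1 < size v)%N.
  rewrite ltnNge; apply/negP => h; move/eqP: c0; apply; rewrite -cv nth_default //.
  exact: leq_trans h e0.
have : (size (u * v)%R <= 1)%N by rewrite -euv size_polyC_leq1.
rewrite (size_mul u0 v0); move: u0; rewrite -size_poly_gt0.
move: (size u) (size v) sv1 => m n; clear; case: m => [//|m] n1 _.
by rewrite addSn /= leqNgt (leq_trans n1) ?leq_addl.
Qed.

Lemma rprime_preim (R S : comNzRingType) (g : {rmorphism R -> S}) (P : set S) :
  rprime P -> rprime (fun r => P (g r)).
Proof.
case=> [[h0 hD hM] h1 hpr]; split; first split=> [|a b ha hb|a b hb].
- by rewrite rmorph0.
- by rewrite rmorphD; apply: (hD).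
- by rewrite rmorphM; apply: (hM).
- by rewrite rmorph1.
- by move=> a b; rewrite rmorphM => /hpr.
Qed.

Section Heights.
Variables (k : fieldType) (A : comAlgType k).
Hypothesis char0 : [pchar k] =i pred0.
Implicit Types (P Q : set A).

(** The constant term of an integral equation of [x] modulo [P] lies in [Q], hence in [P]. Dropping
    it leaves [x] times a shorter monic equation, and [P] is prime. *)
Lemma incomparable n (y : 'I_n -> A) P Q : rprime P -> rprime Q -> P `<=` Q ->
  normalizes y P -> (forall r, Q (evm y r) -> P (evm y r)) -> Q `<=` P.
Proof.
move=> [IP P1 Ppr] [IQ _ _] sPQ hn hQP x Qx; have [p mp Pp] := hn x.
elim/poly_ind: p mp Pp => [|p c IH]; first by move/monic_neq0; rewrite eqxx.
have [->|p0] := eqVneq p 0.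
  rewrite mul0r add0r monicE lead_coefC => /eqP->.
  by rewrite map_polyC hornerC /= rmorph1.
move=> mp; rewrite rmorphD rmorphM /= map_polyX map_polyC !hornerE => h.
have Pc : P (evm y c).
  apply: hQP; apply: (rideal_add IQ _ (sPQ _ h)).
  by case: (IQ) => _ _ hM; apply: (hM).
have {h} : P ((map_poly (evm y) p).[x] * x).
  by apply: (rideal_add IP Pc); rewrite addrC.
case/Ppr => //; apply: IH; move: mp.
rewrite !monicE lead_coefDl ?lead_coefMX // size_mulX // ltnS.
by apply: leq_trans (size_polyC_leq1 _) _; rewrite size_poly_gt0.
Qed.

Lemma contraction_neq0 n (y : 'I_n -> A) P Q : rprime P -> rprime Q -> P `<` Q ->
  normalizes y P -> exists r, Q (evm y r) /\ ~ P (evm y r).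
Proof.
move=> hP hQ [sPQ nQP] hn; apply: contrapT => h; apply: nQP.
apply: incomparable (hn) _ => // r Qr; apply: contrapT => nPr; apply: h.
by exists r.
Qed.

(* [Q] lies over a principal prime of the polynomial ring, so nothing fits between [P] and [Q]. *)
Lemma minimal_over n (y : 'I_n -> A) P Q q : rprime P -> rprime Q -> P `<=` Q ->
  independent_mod y P -> normalizes y P -> prime_elt q ->
  (forall r, Q (evm y r) <-> divides q r) ->
  forall P2, rprime P2 -> P `<` P2 -> P2 `<=` Q -> Q `<=` P2.
Proof.
move=> hP hQ sPQ hi hn hq hQq P2 hP2 sPP2 sP2Q.
have hn2 : normalizes y P2 by move=> a; apply: integral_mod_sub (proj1 sPP2) (hn a).
have [r [P2r nPr]] := contraction_neq0 hP hP2 sPP2 hn.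
have [||p hp P2p] := @factorial_mpoly k n (fun r => P2 (evm y r)) _ r P2r.
- exact: rprime_preim.
- by apply: contra_not_neq nPr => ->; rewrite rmorph0; case: hP => -[].
have [c ec] : divides q p by apply/hQq; apply: sP2Q.
have P2q : P2 (evm y q).
  have [|[d ed]|[d ed]] := (let: And3 _ _ h := hp in h) c q.
  - by exists 1; rewrite mul1r.
  - case: (hp) => p0 _ _; case: (hq) => _ /negP qu _; case: qu.
    apply/unitrPr; exists d; apply: (mulIf p0).
    by rewrite mul1r {2}ec ed; ring.
  - by rewrite ed rmorphM; case: (hP2) => -[_ _ hM] _ _; apply: (hM).
apply: incomparable (hn2) _ => // s /hQq[d ->].
by rewrite rmorphM; case: (hP2) => -[_ _ hM] _ _; apply: (hM).
Qed.

(** Going down from a prime element [q] in the contraction of [P1] gives [P'] lying exactly over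
    [(q)]. After a shear [q] is monic in the last variable, which can then be dropped from the
    normalisation. *)
Lemma dim_step P P1 d : rprime P -> rprime P1 -> P `<` P1 -> has_dim P d ->
  exists d' P', [/\ d = d'.+1, rprime P', P `<` P', P' `<=` P1 & has_dim P' d'].
Proof.
move=> hP hP1 hPP1 [y [hi hn]].
have [r [P1r nPr]] := contraction_neq0 hP hP1 hPP1 hn.
have [||q hq P1q] := @factorial_mpoly k d (fun r => P1 (evm y r)) _ r P1r.
- exact: rprime_preim.
- by apply: contra_not_neq nPr => ->; rewrite rmorph0; case: hP => -[].
have [P' [hP' sPP' sP'P1 hP'q]] := going_down hP hP1 (proj1 hPP1) hi hn hq P1q.
have q0 : q != 0 by case: hq.
have P'q : P' (evm y q) by apply/hP'q; exists 1; rewrite mul1r.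
have sq : (1 < msize q)%N.
  rewrite ltnNge; apply/negP => /msize1_polyC eq; case: (hq) => _ /negP + _; case.
  have c0 : q@_0 != 0 by apply: contraNneq q0 => h; rewrite eq h mpolyC0.
  by apply/unitrPr; exists ((q@_0)^-1)%:MP; rewrite {1}eq -mpolyCM mulfV // mpolyC1.
have nP'P : ~ P' `<=` P by move=> h; move/eqP: q0; apply; apply: hi; apply: h.
case: d y hi hn r P1r nPr q hq P1q hP'q q0 P'q sq =>
  [|d] y hi hn r P1r nPr q hq P1q hP'q q0 P'q sq.
  have : q = (q@_0)%:MP.
    apply/mpolyP => m; rewrite mcoeffC; have -> : m = 0%MM by apply/mnmP; case.
    by rewrite eqxx mulr1.
  by move=> e; move: sq; rewrite e msizeC; case: (_ != 0).
exists d, P'; split=> //.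
have hn' : normalizes y P' by move=> a; apply: integral_mod_sub sPP' (hn a).
have [lam [c [c0 htop]]] := shear_monic char0 q0.
exists (fun j => y (lift ord_max j) - lam j *: y ord_max); split; last first.
  by apply: integral_shear c0 (htop _ _ _ _) P'q hn'.
move=> p; set z := (X in evm X p) => P'p.
(* [th] and [em] change coordinates. A relation [p] among the new variables becomes a multiple of
   [q]; but in sheared coordinates [p] is constant in the last variable, where [q] has positive
   degree and a nonzero constant as top coefficient. *)
pose th : {rmorphism {mpoly k[d.+1]} -> {poly {mpoly k[d]}}} :=
  mmap (polyC \o @mpolyC d k) (shear_subst (@mpolyC d k) (fun j => 'X_j) lam).
have thE r' : th r' = shear_homog (@mpolyC d k) (fun j => 'X_j) 1 lam (msize q).-1 r'.
  by apply: eq_bigr => m _; rewrite expr1n mulr1.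
pose em : {rmorphism {mpoly k[d]} -> {mpoly k[d.+1]}} :=
  mmap (@mpolyC d.+1 k) (fun j => 'X_(lift ord_max j) - lam j *: 'X_ord_max).
have thX i : th 'X_i = shear_subst (@mpolyC d k) (fun j => 'X_j) lam i.
  by rewrite /th /= mmapX mmap1U.
have the : forall p', th (em p') = p'%:P.
  apply: (mpoly_rmorph_ext (f := th \o em) (g := polyC)) => [a|j] /=.
    by rewrite /em /th /= !mmapC.
  rewrite /em /= mmapX mmap1U -mul_mpolyC rmorphB rmorphM.
  rewrite !thX /shear_subst liftK unlift_none /th /= mmapC /=.
  by rewrite addrK.
have [c' ec'] : divides q (em p).
  apply/hP'q; suff -> : evm y (em p) = evm z p by [].
  apply: (mpoly_rmorph_ext (f := evm y \o em) (g := evm z)) => [a|j] /=.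
    by rewrite /em /= mmapC !evmC.
  rewrite /em /= mmapX mmap1U evmX -mul_mpolyC rmorphB rmorphM /= !evmX evmC.
  by rewrite mulr_algl.
have eth : p%:P = th c' * th q by rewrite -the ec' rmorphM.
have htq : has_top (th q) (msize q).-1 c%:MP by rewrite thE; apply: htop.
apply: const_factor eth htq _ _; first by rewrite mpolyC_eq0.
by rewrite -ltnS prednK // ltnW.
Qed.

(** The first variable generates a proper ideal modulo [P]: an inverse would be integral over the
    polynomial ring and a quotient of its elements, hence would lie in it. *)
Lemma prime_above P d : rprime P -> has_dim P d.+1 ->
  exists2 P1, rprime P1 & P `<` P1.
Proof.
move=> hP [y [hi hn]]; have [K [f [f0 ff]]] := residue_field hP.
have ginj : injective (f \o evm y) := independent_inj f0 hi.
pose I : set A := fun x => exists a, f x = f a * f (y ord0).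
pose M : set A := fun x => x = 1.
have [|||P' [hP' sIP' _]] := @prime_exists A I M.
- split; first by exists 0; rewrite !rmorph0 mul0r.
    by move=> x z [a ea] [b eb]; exists (a + b); rewrite !rmorphD mulrDl ea eb.
  by move=> a x [b eb]; exists (a * b); rewrite !rmorphM eb mulrA.
- by split=> // _ _ -> ->; rewrite /M mulr1.
- move=> x [a ea] x1.
  have X0 : ('X_ord0 : {mpoly k[d.+1]}) != 0 by apply: mpolyU_neq0.
  have e1 : 1 = f a * f (y ord0) by rewrite -ea x1 rmorph1.
  have y0 : f (y ord0) != 0.
    by apply: contra_eq_neq e1 => ->; rewrite mulr0 oner_neq0.
  have [c /(congr1 (meval (fun=> 0)))] : divides ('X_ord0 : {mpoly k[d.+1]}) 1.
    apply: (@int_closed_mpoly k d.+1 _ _ ginj) => //.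
    have -> : (f \o evm y) 1 / (f \o evm y) 'X_ord0 = f a.
      by rewrite rmorph1 /= evmX e1 mulfK.
    exact/(integral_modE _ _ f0).
  by rewrite mevalM mevalXU mulr0 meval1 => /eqP; rewrite oner_eq0.
exists P' => //; split.
  by move=> x Px; apply: sIP'; exists 0; rewrite rmorph0 mul0r; apply/f0.
move=> /(_ (y ord0)) h; have : P (y ord0) by apply: h; apply: sIP'; exists 1; rewrite rmorph1 mul1r.
by rewrite -evmX => /hi/eqP; rewrite (negbTE (mpolyU_neq0 _ _)).
Qed.

Definition strict_chain (n : nat) (f : nat -> set A) : Prop :=
  (forall i, (i <= n)%N -> rprime (f i)) /\ forall i, (i < n)%N -> f i `<` f i.+1.

Lemma chain_bound d P n f : rprime P -> has_dim P d -> strict_chain n f ->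
  P `<=` f 0%N -> (n <= d)%N.
Proof.
elim: d P n f => [|d IH] P [|n] f hP hd [hf hs] sP //.
  have [||d' [P' [//]]] := dim_step hP (hf 1%N _) _ hd => //.
  split; first by apply: subset_trans sP _; case: (hs 0%N).
  by case: (hs 0%N) => // _ h h'; apply: h; apply: subset_trans h' sP.
have [||d' [P' [[<-] hP' _ sP' hd']]] := dim_step hP (hf 1%N _) _ hd => //.
  split; first by apply: subset_trans sP _; case: (hs 0%N).
  by case: (hs 0%N) => // _ h h'; apply: h; apply: subset_trans h' sP.
apply: (IH P' n (fun i => f i.+1)) => //.
by split=> i hi; [apply: hf|apply: hs].
Qed.

Lemma chain_above d P : rprime P -> has_dim P d -> exists2 f, strict_chain d f & f 0%N = P.
Proof.
elim: d P => [|d IH] P hP hd; first by exists (fun=> P).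
have [P1 hP1 sPP1] := prime_above hP hd.
have [d' [P' [[<-] hP' sP' _ hd']]] := dim_step hP hP1 sPP1 hd.
have [f [hf hs] f0] := IH P' hP' hd'.
exists (fun i => if i is j.+1 then f j else P) => //.
by split=> [[|i]|[|i]] //= hi; [apply: hf|rewrite f0|apply: hs].
Qed.

Lemma chain_below d P0 P : rprime P0 -> rprime P -> has_dim P0 d -> P0 `<=` P ->
  exists m d', [/\ (m + d' = d)%N, has_dim P d' &
    exists f, [/\ strict_chain m f, f 0%N = P0 & f m = P]].
Proof.
move: d P0; elim/ltn_ind => d IH P0 hP0 hP hd s0.
have [e|n0] := pselect (P `<=` P0).
  have <- : P0 = P by apply/seteqP; split.
  by exists 0%N, d; split=> //; exists (fun=> P0).
have [d' [P' [e hP' s1 s2 hd']]] := dim_step hP0 hP (conj s0 n0) hd.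
have [|m [d2 [e2 hd2 [f [[hf hs] f0 fm]]]]] := IH d' _ P' hP' hP hd' s2; first by rewrite e.
exists m.+1, d2; split=> //; first by rewrite addSn e2 e.
exists (fun i => if i is j.+1 then f j else P0); split=> //.
by split=> [[|i]|[|i]] //= hi; [apply: hf|rewrite f0|apply: hs].
Qed.

Lemma prime_idealE P : prime_ideal P <-> rprime P.
Proof.
split=> [[[h0 [hD hM]] h1 hP]|[[h0 hD hM] h1 hP]]; last by split.
by split.
Qed.

(** A longer chain ending at [P], continued by the chain of length [d] above [P] from [chain_above],
    would have more than [N] steps, against [chain_bound]. *)
Lemma height_of_chain N m d (P0 P : set A) f : rprime P0 -> (forall Q, rprime Q -> P0 `<=` Q) ->
  has_dim P0 N -> has_dim P d -> strict_chain m f -> f m = P -> (m + d = N)%N ->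
  has_height P m.
Proof.
move=> hP0 min hN hd [hf hs] fm emd; split.
  by exists f; split=> [i hi|]; [apply/prime_idealE/hf|].
case=> g [hg [gs gm]].
have [|h [hh hhs] h0] := chain_above _ hd; first by rewrite -fm; apply: hf.
pose c i := if (i <= m.+1)%N then g i else h (i - m.+1)%N.
have hc : strict_chain (m.+1 + d) c.
  split=> i hi; rewrite /c.
    case: leqP => him; first by apply/prime_idealE/hg.
    by apply: hh; rewrite leq_subLR.
  have [lt|gt|eq] := ltngtP i m.+1.
  - exact: gs.
  - rewrite subSn ?(ltnW gt) //.
    by apply: hhs; rewrite ltn_subLR // ltnW.
  - rewrite eq subSnn gm -h0; apply: hhs.
    by move: hi; rewrite eq -{1}[m.+1]addn0 ltn_add2l.
suff : (m.+1 + d <= N)%N by rewrite -emd addSn ltnn.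
apply: chain_bound hP0 hN hc _.
by apply: min; rewrite /c; apply/prime_idealE/hg.
Qed.

(** With nothing between [P] and [Q], the prime found by [dim_step] is [Q] itself, so the dimension
    drops by exactly one; [height_of_chain] turns dimensions into heights. *)
Lemma height_succ P Q : affine A -> rprime P -> rprime Q -> P `<` Q ->
  (forall P2, rprime P2 -> P `<` P2 -> P2 `<=` Q -> Q `<=` P2) ->
  exists n, has_height P n /\ has_height Q n.+1.
Proof.
move=> [hfg hdom] hP hQ hPQ hmin.
pose P0 : set A := fun x => x = 0.
have hP0 : rprime P0.
  split=> [||a b]; last exact: hdom.
  - split=> // [_ _ -> ->|a _ ->]; rewrite /P0 ?addr0 ?mulr0 //.
  - by move=> /eqP; rewrite oner_eq0.
have min0 Q' : rprime Q' -> P0 `<=` Q' by case=> -[h _ _] _ _ _ ->.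
have [N hN] := has_dim_exists char0 hfg hP0.
have [m [d [emd hd [f [hf f0 fm]]]]] := chain_below hP0 hP hN (min0 P hP).
have [d' [P' [ed hP' sP' sQ hd']]] := dim_step hP hQ hPQ hd.
have eQ : P' = Q by apply/seteqP; split=> //; apply: hmin.
rewrite -{}eQ in hPQ hQ hmin sQ *.
exists m; split; first exact: (height_of_chain hP0 min0 hN hd hf fm emd).
pose g i := if (i <= m)%N then f i else P'.
apply: (@height_of_chain N m.+1 d' P0 P' g) => //; last by rewrite addSnnS -ed.
  case: hf => hf hs; split=> i hi; rewrite /g.
    by case: ifP => // /hf.
  have /orP[/eqP->|him] : (i == m) || (i < m)%N by rewrite -leq_eqVlt.
    by rewrite leqnn ltnn fm.
  by rewrite (ltnW him) him; apply: hs.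
by rewrite /g ltnn.
Qed.

End Heights.

(** * Finitely many successors imply rationality *)

(** [r] is the constant term of an equation of [b], after powers of [b] have been cancelled to make
    it nonzero. It replaces the denominator [b] by a polynomial in [y]. *)
Lemma inverse_denominator (k : fieldType) (A : comAlgType k) n (y : 'I_n -> A) (P : set A) b :
  rprime P -> normalizes y P -> ~ P b -> exists b' r, r != 0 /\ P (b * b' - evm y r).
Proof.
move=> [IP P1 Ppr] hn nb; have [p mp Pp] := hn b.
have p0 := monic_neq0 mp; elim/poly_ind: p p0 {mp} Pp => [|p c IH]; first by rewrite eqxx.
move=> pc0; rewrite rmorphD rmorphM /= map_polyX map_polyC hornerD hornerM hornerX hornerC => h.
have {}h : P ((map_poly (evm y) p).[b] * b + evm y c) by [].
have [c0|c0] := eqVneq c 0.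
  have e0 : evm y c = 0 by rewrite c0; exact: rmorph0.
  have {}h : P ((map_poly (evm y) p).[b] * b) by move: h; rewrite e0 addr0.
  case: (Ppr _ _ h) => // {}h; apply: IH => //.
  by apply: contraNneq pc0 => ->; rewrite c0 mul0r add0r.
exists (- (map_poly (evm y) p).[b]), c; split=> //.
rewrite [X in P X](_ : _ = - ((map_poly (evm y) p).[b] * b + evm y c)); last by ring.
exact: rideal_opp.
Qed.

Section PoissonBasics.
Variables (k : fieldType) (A : comAlgType k) (br : A -> A -> A).
Hypothesis hbr : poisson_bracket br.

Lemma br_derivation x : derivation_to id (fun y => br y x).
Proof.
case: hbr => hl _ _ _ hM; split=> [y z|y z]; last by rewrite hM.
by have := hl 1 y z x; rewrite !scale1r.
Qed.

Lemma br_anti x y : br x y = - br y x.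
Proof.
case: hbr => hl hr h0 _ _; apply/eqP; rewrite -addr_eq0; apply/eqP.
have := h0 (x + y); have := hl 1 x y (x + y); rewrite !scale1r => ->.
have := hr 1 x y x; have := hr 1 x y y; rewrite !scale1r => -> ->.
by rewrite !h0 add0r addr0.
Qed.

Lemma brZ c x y : br (c *: x) y = c *: br x y.
Proof.
case: (hbr) => hl _ _ _ _; have := hl c x 0 y.
by rewrite addr0 (derivation0 (br_derivation y)) addr0.
Qed.

Lemma br1 x : br x 1 = 0.
Proof. by rewrite br_anti (derivation1 (f := idfun) (br_derivation x)) oppr0. Qed.

Definition brackets : set (A -> A) := fun d => exists x, d = fun y => br y x.

Lemma poisson_primeE (P : set A) : poisson_prime br P <-> rprime P /\ stable brackets P.
Proof.
split=> [[/prime_idealE hP hs]|[hP hs]].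
  by split=> // _ y [x ->]; apply: hs.
split; first exact/prime_idealE.
by move=> p a Pp; apply: (hs (fun y => br y a) p _ Pp); exists a.
Qed.

Lemma alg_char0 : [pchar k] =i pred0 -> forall m, exists c : A, c * m.+1%:R = 1.
Proof.
move=> /pcharf0P h m; exists (m.+1%:R^-1 : k)%:A.
by rewrite mulr_algl -scaler_nat scalerA mulVf ?scale1r // h.
Qed.

End PoissonBasics.

Section Fractions.
Variables (k : fieldType) (A : comAlgType k) (P : set A).
Variables (K : fieldType) (f : {rmorphism A -> K}).
Hypotheses (f0 : forall a, f a = 0 <-> P a).

Lemma fhorner_value (p : {poly k}) z : frac_ok P z ->
  f (fhorner p z).2 != 0 /\
  f (fhorner p z).1 / f (fhorner p z).2 = (map_poly (f \o in_alg A) p).[f z.1 / f z.2].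
Proof.
move=> hz; have z2 : f z.2 != 0 by apply/eqP => /f0.
have -> : (map_poly (f \o in_alg A) p).[f z.1 / f z.2] =
    foldr (fun c acc => acc * (f z.1 / f z.2) + f c%:A) 0 p.
  by rewrite map_polyE horner_Poly; elim: (polyseq p) => //= c s ->.
rewrite /fhorner; elim: (polyseq p) => [|c s [IH1 IH2]] /=.
  by rewrite rmorph0 rmorph1 mul0r oner_neq0.
set r := foldr _ _ s in IH1 IH2 *; rewrite !rmorphM rmorph1 mulr1 !mulf_neq0 //; split=> //.
rewrite -IH2 rmorphD !rmorphM rmorph1; field.
by rewrite IH1 z2.
Qed.

Lemma frac_algebraicE z : frac_ok P z ->
  frac_algebraic P z <-> algebraicOver (f \o in_alg A) (f z.1 / f z.2).
Proof.
move=> hz; split=> -[p p0 h]; exists p => //; have [h2 e] := fhorner_value p hz.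
  by rewrite /root -e mulf_eq0 invr_eq0 (negbTE h2) orbF; apply/eqP/f0.
move: h; rewrite /root -e mulf_eq0 invr_eq0 (negbTE h2) orbF => /eqP/f0.
by [].
Qed.


End Fractions.

Lemma prime_elt_assoc (R : idomainType) (p q : R) :
  prime_elt p -> prime_elt q -> divides q p -> divides p q.
Proof.
move=> hp hq [c ec]; have [|[d ed]|//] := (let: And3 _ _ h := hp in h) c q.
  by exists 1; rewrite mul1r.
case: (hp) => p0 _ _; case: (hq) => _ /negP qu _; case: qu.
by apply/unitrPr; exists d; apply: (mulIf p0); rewrite mul1r {2}ec ed; ring.
Qed.

(** Recording divisors up to units by bit masks makes them range over a finite type, ready for a
    pigeonhole argument. *)
Lemma divisor_mask (R : idomainType) (s : seq R) (u h h2 : R) :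
  (forall p, p \in s -> prime_elt p) -> u \is a GRing.unit ->
  h * h2 = u * \prod_(p <- s) p ->
  exists (m : (size s).-tuple bool) (v : R), v \is a GRing.unit /\
    h = v * \prod_(p <- mask m s) p.
Proof.
elim: s u h h2 => [|q s IH] u h h2 hs hu.
  rewrite big_nil mulr1 => e; exists [tuple], h; rewrite big_nil mulr1; split=> //.
  by move: hu; rewrite -e unitrM => /andP[].
have hq : prime_elt q by apply: hs; rewrite mem_head.
have hs' p : p \in s -> prime_elt p by move=> ps; apply: hs; rewrite inE ps orbT.
have q0 : q != 0 by case: hq.
rewrite big_cons => e.
have : divides q (h * h2) by exists (u * \prod_(j <- s) j); rewrite e; ring.
case: (hq) => _ _ pr /pr [[c ec]|[c ec]].
  have [|m [v [hv ev]]] := IH u c h2 hs' hu.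
    by apply: (mulfI q0); rewrite mulrA [q * c]mulrC -ec e; ring.
  by exists (cons_tuple true m), v; split=> //=; rewrite big_cons ec ev; ring.
have [|m [v [hv ev]]] := IH u h c hs' hu.
  by apply: (mulfI q0); transitivity (h * h2); [rewrite ec; ring|rewrite e; ring].
by exists (cons_tuple false m), v.
Qed.

Lemma factorial_divides_exp (R : idomainType) : factorial R -> forall (e h : R) (D : nat),
  e != 0 -> h != 0 -> (forall q, prime_elt q -> divides q h -> divides q e) ->
  (forall (u : R) s, u \is a GRing.unit -> (forall q, q \in s -> prime_elt q) ->
     h = u * \prod_(q <- s) q -> (size s <= D)%N) ->
  divides h (e ^+ D).
Proof.
move=> hR e h D e0 h0 hqe hD; have [u [s [hu hs eh]]] := factorialP hR h0.
have sD := hD u s hu hs eh.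
have hse q : q \in s -> divides q e.
  move=> qs; apply: hqe; first exact: hs.
  by rewrite eh (perm_big _ (perm_to_rem qs)) big_cons; exists (u * \prod_(j <- rem q s) j); rewrite /=; ring.
have [c ec] : divides (\prod_(q <- s) q) (e ^+ D).
  suff [c ec] : divides (\prod_(q <- s) q) (e ^+ size s).
    by exists (e ^+ (D - size s) * c); rewrite -(subnK sD) exprD ec mulrA addnK.
  elim: s {eh hs sD} hse => [|q s IH] hs; first by rewrite big_nil; exists 1; rewrite mulr1.
  rewrite big_cons exprS.
  have [b eb] : divides (\prod_(q0 <- s) q0) (e ^+ size s).
    by apply: IH => p ps; apply: hs; rewrite inE ps orbT.
  have [d ed] : divides q e by apply: hs; rewrite mem_head.
  by exists (d * b); rewrite eb {1}ed; ring.
by exists (c * u^-1); rewrite eh -mulrA mulKr.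
Qed.

Section Reverse.
Variables (k : fieldType) (A : comAlgType k).
Hypothesis char0 : [pchar k] =i pred0.

(** If [t x = u] modulo [P] with [u] a polynomial in [y], reversing an integral equation of [t]
    gives a polynomial that kills [x] and has constant term [u ^+ N]. It is a multiple of [mu], so
    [q] divides [u]. Hence the ideal of [x] avoids the polynomials outside [(q)]. *)
Lemma prime_through n (y : 'I_n -> A) (P : set A) x (mu : {poly {mpoly k[n]}}) q :
  rprime P -> independent_mod y P -> normalizes y P -> ~ P x ->
  (forall p, P ((map_poly (evm y) p).[x]) -> divides mu p) ->
  prime_elt q -> divides q mu`_0 ->
  exists P', [/\ rprime P', P `<=` P', P' x & forall r, P' (evm y r) <-> divides q r].
Proof.
move=> hP hi hn nx hmu hq hq0; have [K [f [f0 _]]] := residue_field hP.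
pose g : {rmorphism {mpoly k[n]} -> K} := f \o evm y.
have [qI q1 qP] := prime_elt_rprime hq.
pose M : set A := fun z => exists2 u, ~ divides q u & f z = g u.
pose I : set A := fun z => exists t, f z = f t * f x.
have [|||P' [hP' sIP' dP']] := @prime_exists A I M.
- split; first by exists 0; rewrite !rmorph0 mul0r.
    by move=> z w [a ea] [b eb]; exists (a + b); rewrite !rmorphD mulrDl ea eb.
  by move=> a z [b eb]; exists (a * b); rewrite !rmorphM eb mulrA.
- split; first by exists 1; rewrite // !rmorph1.
  move=> z w [u hu ez] [v hv ew]; exists (u * v); last by rewrite !rmorphM ez ew.
  by move=> h; case: (qP _ _ h).
- move=> z [t et] [u hu eu]; apply: hu; have [p mp Pp] := hn t.
  have e : f t * f x = g u by rewrite -et.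
  have [N sN] : exists N, size p = N.+1.
    by exists (size p).-1; rewrite prednK // size_poly_gt0 monic_neq0.
  pose r := \sum_(i < N.+1) (p`_i * u ^+ i) *: 'X^(N - i).
  apply: (prime_elt_exp (n := N)) => //.
  have -> : u ^+ N = r`_0.
    rewrite /r coef_sum big_ord_recr /= coefZ subnn expr0 coef1 mulr1.
    rewrite big1 ?add0r => [|i _].
      have -> : p`_N = 1 by rewrite -(monicP mp) lead_coefE sN.
      by rewrite mul1r.
    by rewrite coefZ coefXn eq_sym subn_eq0 leqNgt ltn_ord mulr0.
  have [h ->] : divides mu r.
    apply: hmu; apply/f0; rewrite -horner_map -map_poly_comp -/g.
    rewrite /r raddf_sum horner_sum.
    rewrite (eq_bigr (fun i : 'I_N.+1 => f x ^+ N * (g p`_i * f t ^+ i))) => [|i _].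
      rewrite -mulr_sumr; move/f0: Pp; rewrite -horner_map -map_poly_comp -/g.
      have -> : (map_poly g p).[f t] = \sum_(i < N.+1) g p`_i * f t ^+ i.
        by rewrite /map_poly horner_poly sN.
      by move=> ->; rewrite mulr0.
    rewrite /= map_polyZ map_polyXn hornerZ hornerXn rmorphM rmorphXn -e exprMn.
    have -> : f x ^+ N = f x ^+ i * f x ^+ (N - i) by rewrite -exprD subnKC // -ltnS.
    by ring.
  by rewrite coef0M; apply: (let: And3 _ _ hM := qI in hM).
have pin z : P z -> P' z by move=> Pz; apply: sIP'; exists 0; rewrite rmorph0 mul0r; apply/f0.
have nq r : P' (evm y r) -> divides q r.
  by move=> P'r; apply: contrapT => nr; apply: (dP' _ P'r); exists r.
have P'x : P' x by apply: sIP'; exists 1; rewrite rmorph1 mul1r.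
exists P'; split=> // r; split; first exact: nq.
suff P'q : P' (evm y q) by case=> d ->; rewrite rmorphM; case: hP' => -[_ _ hM] _ _; apply: (hM).
have hn' : normalizes y P' by move=> a; apply: integral_mod_sub pin (hn a).
have [|r0 [P'r nPr]] := contraction_neq0 hP hP' _ hn; first by split=> // /(_ x P'x).
have [||p hp P'p] := @factorial_mpoly k n (fun r => P' (evm y r)) _ r0 P'r.
- exact: rprime_preim.
- by apply: contra_not_neq nPr => ->; rewrite rmorph0; case: hP => -[].
have [d ->] := prime_elt_assoc hp hq (nq _ P'p).
by rewrite rmorphM; case: hP' => -[_ _ hM] _ _; apply: (hM).
Qed.

End Reverse.

Lemma infinite_injection (T : Type) (S : set T) : ~ finite_set S ->
  exists u : nat -> T, injective u /\ forall i, S (u i).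
Proof.
move=> /infiniteP/card_leP[f].
exists (fun i => val (f (to_setT i))); split=> [i j|i].
  move=> /val_inj e; have /(congr1 val) : to_setT i = to_setT j.
    by apply: (@inj _ _ _ f) => //; rewrite in_setE.
  by [].
exact: set_valP.
Qed.

Lemma infinite_bigcup_mem (I T : Type) (S : set T) (D : set I) (F : I -> set T) :
  ~ finite_set S -> finite_set D -> (forall x, S x -> exists2 i, D i & F i x) ->
  exists2 i, D i & ~ finite_set (F i).
Proof.
move=> hS hD hF; apply: contrapT => h; apply: hS.
apply: (@sub_finite_set _ _ (\bigcup_(i in D) F i)) => [x /hF[i Di Fx]|]; first by exists i.
by apply: bigcup_finite => // i Di; apply: contrapT => nf; apply: h; exists i.
Qed.

Lemma msize_prod_primes (k : fieldType) n (s : seq {mpoly k[n]}) :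
  (forall q, q \in s -> prime_elt q) -> (size s < msize (\prod_(q <- s) q))%N.
Proof.
elim: s => [|q s IH] hs; first by rewrite big_nil msize1.
rewrite big_cons msizeM; last 2 first.
- by case: (hs q (mem_head _ _)).
- rewrite prodf_seq_neq0; apply/allP => p ps /=.
  by case: (hs p _); rewrite // inE ps orbT.
have hq : prime_elt q by apply: hs; rewrite mem_head.
have sq : (1 < msize q)%N.
  have q0 : q != 0 by case: hq.
  rewrite ltnNge; apply/negP => /msize1_polyC eq; case: (hq) => _ /negP + _; case.
  have c0 : q@_0 != 0 by apply: contraNneq q0 => h; rewrite eq h mpolyC0.
  by apply/unitrPr; exists ((q@_0)^-1)%:MP; rewrite {1}eq -mpolyCM mulfV // mpolyC1.
have : (size s < msize (\prod_(j <- s) j))%N.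
  by apply: IH => p ps; apply: hs; rewrite inE ps orbT.
by move: (msize _) (msize _) sq => u v; rewrite /=; clear; lia.
Qed.

Lemma mpoly_unitC (k : fieldType) n (p : {mpoly k[n]}) : p \is a GRing.unit ->
  exists2 c : k, c != 0 & p = c%:MP.
Proof.
case/andP=> /eqP e; rewrite unitfE => h; by exists p@_0.
Qed.

(** Interpolation at the points of [s], monomial by monomial, shows that each coefficient [W i] of
    [mu (e X)] is a [k]-multiple of [v]. Cancelling [v] from [mu (e z) = 0] leaves an equation for
    [z] over [k]. *)
Lemma proportional_values (k : fieldType) n (K : fieldType) (g : {rmorphism {mpoly k[n]} -> K})
    (mu : {poly {mpoly k[n]}}) e v z (s : seq k) : injective g ->
  mu \is monic -> e != 0 -> v != 0 -> root (map_poly g mu) (g e * z) ->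
  uniq s -> (size mu <= size s)%N ->
  (forall c, c \in s -> exists a : k, mu.[c%:MP * e] = a *: v) ->
  algebraicOver (g \o @mpolyC n k) z.
Proof.
move=> ginj mmu e0 v0 rmu us ss hs.
pose W i := mu`_i * e ^+ i; pose alpha := mlead v.
have va : v@_alpha != 0 by rewrite -/(mleadc v) mleadc_eq0.
pose pb b : {poly k} := \poly_(i < size mu) (W i)@_b.
have ev b c : (mu.[c%:MP * e])@_b = (pb b).[c].
  rewrite horner_coef /pb horner_poly raddf_sum /=; apply: eq_bigr => i _.
  have -> : (c%:MP * e) ^+ i = (c ^+ i)%:MP * e ^+ i by rewrite exprMn rmorphXn.
  by rewrite mulrCA mul_mpolyC mcoeffZ mulrC.
have prop b : v@_alpha *: pb b = v@_b *: pb alpha.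
  apply/eqP; rewrite -subr_eq0; apply/eqP; apply: (roots_geq_poly_eq0 (rs := s)) => //.
    apply/allP => c cs; rewrite /root hornerD hornerN !hornerZ -!ev.
    by have [a ->] := hs c cs; rewrite !mcoeffZ subr_eq0; apply/eqP; ring.
  apply: leq_trans ss; apply: leq_trans (size_polyD _ _) _.
  rewrite geq_max size_polyN; apply/andP; split;
  by apply: leq_trans (size_scale_leq _ _) (size_poly _ _).
pose kap i := (W i)@_alpha / v@_alpha.
have Wk i : (i < size mu)%N -> W i = kap i *: v.
  move=> hi; apply/mpolyP => b; rewrite mcoeffZ; apply: (mulfI va).
  have := congr1 (fun p : {poly k} => p`_i) (prop b).
  by rewrite !coefZ !coef_poly hi /kap => ->; field.
have smu : (0 < size mu)%N by rewrite size_poly_gt0 monic_neq0.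
pose p : {poly k} := \poly_(i < size mu) kap i.
exists p.
  apply/eqP => /polyP/(_ (size mu).-1); rewrite coef_poly coef0 prednK // leqnn => h.
  have := Wk (size mu).-1; rewrite prednK // leqnn h scale0r => /(_ isT)/eqP.
  by rewrite /W -lead_coefE (monicP mmu) mul1r expf_eq0 (negbTE e0) andbF.
have gv : g v != 0 by rewrite -(rmorph0 g) (inj_eq ginj).
rewrite /root; apply/eqP; apply: (mulfI gv); rewrite mulr0 -(eqP rmu).
have -> : (map_poly g mu).[g e * z] = \sum_(i < size mu) g mu`_i * (g e * z) ^+ i.
  by rewrite /map_poly horner_poly.
have -> : (map_poly (g \o @mpolyC n k) p).[z] = \sum_(i < size mu) g (kap i)%:MP * z ^+ i.
  rewrite horner_coef; have sp : (size (map_poly (g \o @mpolyC n k) p) <= size mu)%N.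
    by rewrite size_map_poly; apply: size_poly.
  rewrite (big_ord_widen _ (fun i => (map_poly (g \o @mpolyC n k) p)`_i * z ^+ i) sp).
  rewrite big_mkcond; apply: eq_bigr => i _; case: ifP => hi.
    by rewrite coef_map /= coef_poly ltn_ord.
  have : p`_i = 0.
    by apply/nth_default; move: hi; rewrite size_map_poly => /negbT; rewrite -leqNgt.
  by rewrite coef_poly ltn_ord => ->; rewrite rmorph0 mul0r.
rewrite mulr_sumr; apply: eq_bigr => i _.
have eW : g (W i) = g (kap i)%:MP * g v by rewrite Wk // -mul_mpolyC rmorphM.
by rewrite mulrA [g v * _]mulrC -eW /W rmorphM rmorphXn exprMn; ring.
Qed.

Section ReverseMain.
Variables (k : fieldType) (A : comAlgType k) (br : A -> A -> A).
Hypotheses (char0 : [pchar k] =i pred0) (hA : affine A) (hbr : poisson_bracket br).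

Lemma poisson_central_relation (P : set A) z : rprime P -> frac_ok P z ->
  frac_poisson_central br P z -> forall c, P (br z.1 c * z.2 - z.1 * br z.2 c).
Proof.
case: z => a b [_ n1 _] hz hc c; have := hc (c, 1) n1.
by rewrite /frac_zero /= !(br1 hbr) !mulr1 !mulr0 !mul0r !subr0 addr0.
Qed.

(* The [x] with [b ^ m * x] in [(w) + P] form a stable ideal; by minimality a stable prime
   over it inside [P'] can only be [P']. *)
Lemma minimal_prime_poisson (P P' : set A) w b :
  rprime P -> stable (brackets br) P -> rprime P' -> P `<=` P' ->
  (forall P2, rprime P2 -> P `<` P2 -> P2 `<=` P' -> P' `<=` P2) ->
  P' w -> ~ P w -> ~ P' b -> (forall c, P (b * br w c - w * br b c)) ->
  stable (brackets br) P'.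
Proof.
move=> hP sP hP' sPP' hmin P'w nPw nb hw.
have [[I0 ID IM] n1 pr] := hP; have [[I0' ID' IM'] n1' pr'] := hP'.
have hI : rideal P by []. have hI' : rideal P' by [].
pose J : set A := fun x => exists m t, P (b ^+ m * x - t * w).
have hJ : rideal J.
  split; first by exists 0%N, 0; rewrite mulr0 mul0r subr0.
    move=> x z [m [t h]] [m' [t' h']]; exists (m + m')%N, (b ^+ m' * t + b ^+ m * t').
    rewrite [X in P X](_ : _ = b ^+ m' * (b ^+ m * x - t * w) + b ^+ m * (b ^+ m' * z - t' * w)).
      by apply: (ID); apply: (IM).
    by rewrite exprD; ring.
  move=> a x [m [t h]]; exists m, (a * t).
  rewrite [X in P X](_ : _ = a * (b ^+ m * x - t * w)); first exact: (IM).
  by ring.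
have sJ : stable (brackets br) J.
  move=> _ x [c ->] [m [t h]].
  have hd := br_derivation hbr c.
  (* The relation [b^m x = t w] modulo [P] is bracketed with [c] and multiplied by [b]; then
     [b {b^m, c} x] becomes [m t w {b, c}], and [b {w, c}] becomes [w {b, c}]. *)
  exists m.+1, (b * br t c + t * br b c - m%:R * t * br b c).
  have h1 : P (br (b ^+ m * x - t * w) c) by apply: (sP (fun y => br y c)) => //; exists c.
  have eb : b * br (b ^+ m) c = m%:R * b ^+ m * br b c.
    case: (m) => [|j]; first by rewrite expr0 (derivation1 (f := idfun) hd); ring.
    by rewrite (derivation_exp (f := idfun) _ _ hd) /= exprS; ring.
  have h2 : br (b ^+ m * x - t * w) c =
      b ^+ m * br x c + br (b ^+ m) c * x - (t * br w c + br t c * w).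
    by rewrite (derivation_sub _ _ hd) !(proj2 hd).
  rewrite [X in P X](_ : _ = b * br (b ^+ m * x - t * w) c
     - m%:R * br b c * (b ^+ m * x - t * w) + t * (b * br w c - w * br b c)).
    apply: (ID); last exact: (IM).
    by apply: rideal_sub => //; apply: (IM).
  by rewrite h2 [b * (_ - _)]mulrBr [b * (_ + br _ c * x)]mulrDr [b * (br (b ^+ m) c * x)]mulrA eb exprS; ring.
have sPJ : P `<=` J by move=> x Px; exists 0%N, 0; rewrite mul0r subr0 expr0 mul1r.
have sJP' : J `<=` P'.
  move=> x [m [t h]]; have : P' (b ^+ m * x).
    have e : b ^+ m * x = (b ^+ m * x - t * w) + t * w by ring.
    by rewrite e; apply: (ID'); [exact: sPP'|exact: (IM')].
  by case/pr' => // /(rprime_exp hP').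
have [|||||Q [hQ sQ sJQ dQ]] := @stable_prime_exists A (brackets br) J (fun x => ~ P' x).
- by move=> _ [c ->]; split; [exact: br_derivation|exact: alg_char0].
- by [].
- by [].
- by split=> // x y nx ny /pr'[].
- by move=> x /sJP' h; apply.
have sQP' : Q `<=` P' by move=> x Qx; apply: contrapT => nx; apply: (dQ x Qx).
have Qw : Q w by apply: sJQ; exists 0%N, 1; rewrite expr0 !mul1r subrr.
have <- : Q = P' => //.
apply/seteqP; split=> //; apply: hmin => //; split; first exact: subset_trans sPJ sJQ.
by move=> h; apply: nPw; apply: h.
Qed.

End ReverseMain.

Section ReverseTheorem.
Variables (k : fieldType) (A : comAlgType k) (br : A -> A -> A).
Hypotheses (char0 : [pchar k] =i pred0) (hA : affine A) (hbr : poisson_bracket br).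

Definition poisson_successors (P : set A) : set (set A) :=
  [set Q : set A | poisson_prime br Q /\ P `<=` Q /\
     exists n, has_height P n /\ has_height Q n.+1].

Lemma natr_inj (F : fieldType) : [pchar F] =i pred0 -> injective (fun m => m%:R : F).
Proof.
move=> /pcharf0P h i j; wlog ij : i j / (i <= j)%N.
  by move=> hw; have [/hw//|/ltnW/hw hji] := leqP i j => /esym/hji.
move=> /eqP; rewrite eq_sym -subr_eq0 -natrB // h subn_eq0 => ji.
by apply/eqP; rewrite eqn_leq ij.
Qed.

Section Pencil.
Variables (P : set A) (a b : A) (K : fieldType) (f : {rmorphism A -> K}).
Hypotheses (hP : rprime P) (sP : stable (brackets br) P) (nb : ~ P b).
Hypothesis rel : forall c, P (br a c * b - a * br b c).
Hypotheses (f0 : forall a, f a = 0 <-> P a).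
Hypothesis trans : ~ algebraicOver (f \o in_alg A) (f a / f b).
Variables (n : nat) (y : 'I_n -> A).
Hypotheses (hi : independent_mod y P) (hn : normalizes y P).

Let g : {rmorphism {mpoly k[n]} -> K} := f \o evm y.
Let ginj : injective g. Proof. exact: independent_inj f0 hi. Qed.
Let gM c e : g (c%:R * e) = c%:R * g e.
Proof. by have -> := rmorphM g c%:R e; rewrite rmorph_nat. Qed.

Let fb : f b != 0. Proof. by apply/eqP => /f0. Qed.

Variables (b' : A) (e : {mpoly k[n]}).
Hypotheses (e0 : e != 0) (he : P (b * b' - evm y e)).

Let ge : g e = f b * f b'.
Proof. by apply/esym/eqP; rewrite -subr_eq0 -rmorphM -rmorphB; apply/eqP/f0. Qed.

Variables (mu : {poly {mpoly k[n]}}).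
Hypotheses (mmu : mu \is monic) (rmu : root (map_poly g mu) (f (a * b')))
  (dmu : forall p, root (map_poly g p) (f (a * b')) -> divides mu p).

Let z := f a / f b.
Let ez : f (a * b') = g e * z.
Proof. by rewrite ge rmorphM /z; field. Qed.

(** The value of [mu] at [c e] is the constant term of the minimal polynomial of [a b' - c e], which
    equals [b' (a - c b)] modulo [P]. *)
Definition pencil_good (c : nat) :=
  exists q, [/\ prime_elt q, divides q mu.[c%:R * e] & ~ divides q e].

(** A prime over [q] through [b' (a - c b)] contains neither [b] nor [b'], because [q] does not
    divide [e], which is [b b'] modulo [P]. So it contains [a - c b], and [minimal_prime_poisson]
    applies. *)
Lemma pencil_prime c : pencil_good c ->
  exists2 Q, poisson_successors P Q & Q (a - c%:R * b) /\ ~ Q b.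
Proof.
case=> q [hq hqm nqe].
pose x := a * b' - c%:R * evm y e; pose mc := mu \Po ('X + (c%:R * e)%:P).
have fx : f x = f (a * b') - g (c%:R * e).
  by rewrite gM /x rmorphB [f (c%:R * _)]rmorphM rmorph_nat.
have fw : f x = f b' * f (a - c%:R * b).
  by rewrite fx ez rmorphM rmorph_nat ge rmorphB rmorphM rmorph_nat /z; field.
have nw : ~ P (a - c%:R * b).
  move=> /f0; rewrite rmorphB rmorphM rmorph_nat => /eqP; rewrite subr_eq0 => /eqP h.
  apply: trans; rewrite h mulfK //.
  have -> : (c%:R : K) = (f \o in_alg A) c%:R by rewrite rmorph_nat.
  exact: algebraic_id.
have fb' : f b' != 0.
  have : g e != 0 by rewrite -(rmorph0 g) (inj_eq ginj).
  by rewrite ge mulf_eq0 negb_or => /andP[].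
have nx : ~ P x.
  by move=> /f0/eqP; rewrite fw mulf_eq0 (negbTE fb') /= => /eqP/f0.
have hmc (p : {poly {mpoly k[n]}}) : P ((map_poly (evm y) p).[x]) -> divides mc p.
  move=> /f0; rewrite -horner_map -map_poly_comp -/g => hp.
  have [|h eh] := dmu (p := p \Po ('X - (c%:R * e)%:P)).
    rewrite /root map_comp_poly horner_comp rmorphB /= map_polyX map_polyC hornerXsubC.
    by rewrite -[X in _ - X]/(g (c%:R * e)) -fx hp.
  exists (h \Po ('X + (c%:R * e)%:P)).
  rewrite -comp_polyM -eh -comp_polyA comp_polyB comp_polyX comp_polyC addrK.
  by rewrite comp_polyXr.
have mc0 : mc`_0 = mu.[c%:R * e].
  by rewrite -horner_coef0 horner_comp hornerD hornerX hornerC add0r.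
rewrite -mc0 in hqm.
have [Q [hQ sPQ Qx hQq]] := prime_through hP hi hn nx hmc hq hqm.
have nQe : ~ Q (evm y e) by move=> /hQq.
have sub_e u : Q (b * u) -> u = b' -> Q (evm y e).
  move=> + eu; rewrite eu => h; have [hQI _ _] := hQ.
  have := rideal_sub hQI h (sPQ _ he); rewrite [X in Q X](_ : _ = evm y e) //; ring.
have [[Q0 QD QM] Q1 Qpr] := hQ.
have nQb : ~ Q b by move=> h; apply: nQe; apply: (sub_e b') => //; rewrite mulrC; apply: (QM).
have nQb' : ~ Q b' by move=> h; apply: nQe; apply: (sub_e b') => //; apply: (QM).
have Qw : Q (a - c%:R * b).
  have : Q (b' * (a - c%:R * b)).
    rewrite [X in Q X](_ : _ = x - c%:R * (b * b' - evm y e)); last by rewrite /x; ring.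
    by apply: rideal_sub => //; apply: (QM); apply: sPQ.
  by case/Qpr.
have hmin := minimal_over hP hQ sPQ hi hn hq hQq.
have sPQ' : P `<` Q by split=> // h; apply: nx; apply: h.
have sQ : stable (brackets br) Q.
  apply: (minimal_prime_poisson char0 hbr hP sP hQ sPQ hmin Qw nw nQb) => d.
  have hd := br_derivation hbr d.
  rewrite (derivation_sub _ _ hd) (proj2 hd).
  have -> : br c%:R d = 0.
    rewrite -[c%:R]/(1 *+ c) -scaler_nat (brZ hbr) (derivation1 (f := idfun) hd).
    by rewrite scaler0.
  rewrite [X in P X](_ : _ = br a d * b - a * br b d); first exact: rel.
  by rewrite /=; ring.
exists Q => //; split; first exact/(poisson_primeE br).
split=> //; exact: (height_succ char0 hA hP hQ sPQ' hmin).
Qed.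

(** Different [c] need different primes: two members of the pencil in the same [Q] differ by a
    nonzero scalar times [b], which is outside [Q]. *)
Lemma pencil_good_finite : finite_set (poisson_successors P) -> finite_set pencil_good.
Proof.
move=> hS.
have /choice[F hF] c : exists Q, (pencil_good c -> poisson_successors P Q /\
    (Q (a - c%:R * b) /\ ~ Q b)) /\ (~ pencil_good c -> Q = set0).
  have [hc|nc] := pselect (pencil_good c); last by exists set0.
  by have [Q hQ hQ'] := pencil_prime hc; exists Q.
have eF : F @^-1` (poisson_successors P) = pencil_good.
  apply/seteqP; split=> c; last by move=> hc; case: (hF c) => /(_ hc)[].
  move=> hc; apply: contrapT => nc; case: (hF c) => _ /(_ nc) h.
  by move: hc; rewrite /= h => -[[/prime_idealE[[] //]]].
rewrite -eF; apply: finite_preimage => // c d; rewrite !in_setE eF => gc gd ecd.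
apply/eqP; apply: contraT => ncd.
have [/(_ gc)[hQ [Qc nQb]] _] := hF c; have [/(_ gd)[_ [Qd _]] _] := hF d.
rewrite -ecd in Qd; case: hQ => [[/prime_idealE[QI _ Qpr] _] _].
have := rideal_sub QI Qd Qc.
have -> : a - d%:R * b - (a - c%:R * b) = ((c%:R - d%:R) : k)%:A * b.
  by rewrite scalerBl !scaler_nat; ring.
case/Qpr => // h; have [_ _ QM] := QI; case: nQb.
have cd0 : (c%:R - d%:R : k) != 0.
  by rewrite subr_eq0; apply: contraNneq ncd => /(natr_inj char0) ->.
rewrite [b](_ : _ = ((c%:R - d%:R : k)^-1 *: b) * ((c%:R - d%:R : k)%:A)).
  exact: (QM).
by rewrite mulr_algr scalerA mulfV // scale1r.
Qed.

(** For a bad [c] every prime factor of [mu (c e)] divides [e], and [D] bounds their number, so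
    [mu (c e)] divides [e ^+ D] and is a scalar times one of finitely many products. Infinitely many
    bad [c] would share one product, making [a / b] algebraic by [proportional_values]. *)
Lemma pencil_infinite : ~ finite_set (poisson_successors P).
Proof.
move=> /pencil_good_finite hfin.
have muc0 c : mu.[c%:R * e] != 0.
  apply/eqP => /eqP/factor_theorem[h eh].
  have rh : root (map_poly g h) (f (a * b')).
    have := rmu; rewrite eh [map_poly g _]rmorphM rootM => /orP[//|].
    rewrite -[GRing.RMorphism.sort _ _]/(map_poly g _).
    have -> : map_poly g ('X - (c%:R * e)%:P) = 'X - (c%:R * g e)%:P.
      by rewrite rmorphB /= map_polyX map_polyC /= -gM.
    rewrite root_XsubC ez -subr_eq0.
    have ge0 : g e != 0 by rewrite -(rmorph0 g) (inj_eq ginj).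
    rewrite [c%:R * _]mulrC -mulrBr mulf_eq0 (negbTE ge0) /=.
    rewrite subr_eq0 => /eqP h'; case: trans; rewrite -/z h'.
    have -> : (c%:R : K) = (f \o in_alg A) c%:R by rewrite rmorph_nat.
    exact: algebraic_id.
  have [d ed] := dmu rh; have h0 : h != 0.
    by apply: contraNneq (monic_neq0 mmu) => h0; rewrite eh h0 mul0r.
  have d0 : d != 0 by apply: contraNneq h0 => d0; rewrite ed d0 mul0r.
  have m0 := monic_neq0 mmu; have x0 := monic_neq0 (monicXsubC (c%:R * e)).
  have : size mu = size (d * (mu * ('X - (c%:R * e)%:P)))%R by rewrite mulrA -ed -eh.
  rewrite (size_mul d0 (mulf_neq0 m0 x0)) (size_mul m0 x0) size_XsubC.
  move: d0 m0; rewrite -!size_poly_gt0; move: (size d) (size mu) => u v; clear; lia.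
pose D := (\max_(i < size mu) msize (mu`_i * e ^+ i)%R)%N.
have hD c : (msize mu.[c%:R * e] <= D)%N.
  rewrite horner_coef; apply: leq_trans (msize_sum _ _ _) _; apply/bigmax_leqP => i _.
  apply: leq_trans (leq_bigmax i); rewrite exprMn mulrCA.
  have -> : (c%:R ^+ i : {mpoly k[n]}) = (c%:R ^+ i)%:MP by rewrite rmorphXn rmorph_nat.
  by rewrite mul_mpolyC; apply: msizeZ_le.
have fac := @factorial_mpoly k n.
have e1 : e ^+ D != 0 by rewrite expf_neq0.
have [u [s [hu hs es]]] := factorialP fac e1.
pose B (m : (size s).-tuple bool) : set nat :=
  fun c => exists al : k, mu.[c%:R * e] = al *: \prod_(p <- mask m s) p.
have [||c|m _ hB] := @infinite_bigcup_mem _ _ (~` pencil_good) setT B.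
- move=> h; apply: infinite_nat; rewrite -(setUv pencil_good).
  by rewrite finite_setU; split.
- exact: finite_finset.
- move=> ngc.
  have [h2 eh2] : divides mu.[c%:R * e] (e ^+ D).
    apply: factorial_divides_exp => // [q hq hqm|v r hv hr er].
      by apply: contrapT => nqe; apply: ngc; exists q.
    rewrite -ltnS; apply: leq_trans (leqW (hD c)); rewrite er.
    have [al al0 ->] := mpoly_unitC hv.
    by rewrite mul_mpolyC msizeZ //; apply: msize_prod_primes.
  have [|m [v [hv ev]]] := @divisor_mask _ s u mu.[c%:R * e] h2 hs hu.
    by rewrite -es eh2 mulrC.
  have [al al0 eal] := mpoly_unitC hv.
  by exists m => //; exists al; rewrite ev eal mul_mpolyC.
have [t [tinj ht]] := infinite_injection hB.
pose cs : seq k := [seq (t i)%:R | i <- iota 0 (size mu)].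
apply: trans.
have h : algebraicOver (g \o @mpolyC n k) z.
  apply: (@proportional_values _ _ _ g mu e (\prod_(p <- mask m s) p) z cs) => //.
  - rewrite prodf_seq_neq0; apply/allP => p /mem_mask ps /=.
    by case: (hs p ps).
  - by rewrite -ez.
  - rewrite map_inj_in_uniq ?iota_uniq // => i j _ _ /(natr_inj char0); exact: tinj.
  - by rewrite size_map size_iota.
  - move=> c /mapP[i _ ->]; have [al hal] := ht i; exists al.
    by rewrite -hal rmorph_nat.
have [p p0 rp] := h; exists p => //.
rewrite -(eq_map_poly (f := g \o @mpolyC n k)) // => c.
by rewrite /= evmC.
Qed.

End Pencil.

Theorem finite_rational (P : set A) : poisson_prime br P ->
  finite_set (poisson_successors P) -> poisson_rational br P.
Proof.
move=> /(poisson_primeE br)[hP sP] hfin [a b] hz hc.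
have [K [f [f0 _]]] := residue_field hP.
apply/(frac_algebraicE f0 hz) => /=; apply: contrapT => trans.
have [n [y [hi hn]]] := has_dim_exists char0 (proj1 hA) hP.
have [b' [e [e0 he]]] := inverse_denominator hP hn hz.
have ginj : injective (f \o evm y) by exact: independent_inj f0 hi.
have [|mu [mmu rmu dmu]] := @minpoly_integral _ _ (f \o evm y) (f (a * b'))
    (@int_closed_mpoly k n) ginj.
  exact/(integral_modE _ _ f0).
have rel := poisson_central_relation hbr hP hz hc.
exact: (pencil_infinite hP sP hz rel f0 trans hi hn e0 he mmu rmu dmu).
Qed.

End ReverseTheorem.

(** * Homogenisation and degree bounds *)

Section ClosedPredicates.
Variables (k : comNzRingType).

Lemma poly_closed (R : comNzRingType) (T : {poly R} -> Prop) :
  (forall p q, T p -> T q -> T (p + q)) -> (forall p q, T p -> T q -> T (p * q)) ->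
  (forall c, T c%:P) -> T 'X -> forall p, T p.
Proof.
move=> hD hM hC hX; elim/poly_ind => [|p c hp]; first exact: hC.
by apply: (hD) => //; apply: (hM).
Qed.

Lemma mpoly_closed n (T : {mpoly k[n]} -> Prop) :
  (forall p q, T p -> T q -> T (p + q)) -> (forall p q, T p -> T q -> T (p * q)) ->
  (forall c, T c%:MP) -> (forall i, T 'X_i) -> forall p, T p.
Proof.
move=> hD hM hC hX p; rewrite [p]mpolyE.
apply: (big_ind T) => [||m _]; [exact: (hC 0)|exact: hD|].
rewrite -mul_mpolyC; apply: (hM) => //; rewrite mpolyXE_id.
apply: (big_ind T) => [||i _]; [exact: (hC 1)|exact: hM|].
elim: (m i) => [|j IH]; first exact: (hC 1).
by rewrite exprS; apply: (hM).
Qed.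
End ClosedPredicates.

Lemma derivation_map_poly (R : comNzRingType) (d : R -> R) :
  derivation_to id d -> derivation_to id (map_poly d).
Proof.
move=> hd; have d0 := derivation0 hd; split=> p q; apply/polyP => i.
  by rewrite coefD !coef_map_id0 // coefD (proj1 hd).
rewrite coefD !coefM coef_map_id0 // coefM (derivation_sum _ _ _ hd) -big_split.
by apply: eq_bigr => j _ /=; rewrite !coef_map_id0 // (proj2 hd).
Qed.

Lemma derivation_map_polyC (R : comNzRingType) (d : R -> R) c :
  derivation_to id d -> map_poly d c%:P = (d c)%:P.
Proof.
move=> hd; apply/polyP => i; rewrite (coef_map_id0 _ _ (derivation0 hd)) !coefC.
by case: eqP => // _; exact: derivation0 hd.
Qed.

Lemma derivation_map_polyX (R : comNzRingType) (d : R -> R) :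
  derivation_to id d -> map_poly d 'X = 0.
Proof.
move=> hd; apply/polyP => i; rewrite (coef_map_id0 _ _ (derivation0 hd)) coefX coef0.
by case: eqP => _; [exact: (derivation1 (f := idfun) hd)|exact: derivation0 hd].
Qed.

Lemma derivation_poly (R S : comNzRingType) (psi : {rmorphism {poly R} -> S}) (d : S -> S) u p :
  derivation_to id d -> (forall c, d (psi c%:P) = 0) -> d (psi 'X) = u ->
  psi p^`() * u = d (psi p).
Proof.
move=> hd hC hX; move: p; apply: poly_closed => [p q hp hq|p q hp hq|c|].
- by rewrite derivD !rmorphD mulrDl hp hq (proj1 hd).
- by rewrite derivM rmorphD !rmorphM (proj2 hd) -hp -hq; ring.
- by rewrite derivC rmorph0 mul0r hC.
- by rewrite derivX rmorph1 mul1r hX.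
Qed.

Lemma derivation_ext (k S : comNzRingType) n (phi : {rmorphism {poly {mpoly k[n]}} -> S}) d1 d2 p :
  derivation_to phi d1 -> derivation_to phi d2 -> (forall c, d1 c%:MP%:P = d2 c%:MP%:P) ->
  (forall i, d1 ('X_i)%:P = d2 ('X_i)%:P) -> d1 'X = d2 'X -> d1 p = d2 p.
Proof.
move=> h1 h2 hC hX hT; move: p.
apply: poly_closed => [p q hp hq|p q hp hq|c|] //.
- by rewrite (proj1 h1) (proj1 h2) hp hq.
- by rewrite (proj2 h1) (proj2 h2) hp hq.
move: c; apply: mpoly_closed => [p q hp hq|p q hp hq|c|i] //.
- by rewrite polyCD (proj1 h1) (proj1 h2) hp hq.
- by rewrite polyCM (proj2 h1) (proj2 h2) hp hq.
Qed.

Lemma derivation_mpoly0 (k S : comNzRingType) n (psi : {rmorphism {mpoly k[n]} -> S}) (d : S -> S) p :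
  derivation_to id d -> (forall c, d (psi c%:MP) = 0) -> (forall i, d (psi 'X_i) = 0) ->
  d (psi p) = 0.
Proof.
move=> hd hC hX; move: p; apply: mpoly_closed => [p q hp hq|p q hp hq|c|i] //.
- by rewrite rmorphD (proj1 hd) hp hq addr0.
- by rewrite rmorphM (proj2 hd) hp hq mulr0 mul0r addr0.
Qed.

Lemma msizeC_le (k : fieldType) n (c : k) : (msize (c%:MP : {mpoly k[n]}) <= 1)%N.
Proof. by rewrite msizeC leq_b1. Qed.

Section WeightedDegree.
Variables (k : fieldType) (n w : nat).
Implicit Types p q : {poly {mpoly k[n]}}.

(* The disjunction keeps vanishing coefficients from bounding [w * i]; recall that [msize]
   is the total degree plus one. *)
Definition wle (N : nat) p : Prop :=
  forall i, p`_i = 0 \/ (msize p`_i + w * i <= N.+1)%N.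

Lemma msize_bound_sum (T : Type) (s : seq T) (P : pred T) (F : T -> {mpoly k[n]}) c N :
  (forall i, P i -> F i = 0 \/ (msize (F i) + c <= N)%N) ->
  (\sum_(i <- s | P i) F i) = 0 \/ (msize (\sum_(i <- s | P i) F i) + c <= N)%N.
Proof.
move=> h; apply: (big_ind (fun x : {mpoly k[n]} => x = 0 \/ (msize x + c <= N)%N)) => //.
  by left.
move=> x y [->|hx] [->|hy]; rewrite ?add0r ?addr0; [by left|by right|by right|right].
by have := msizeD_le x y; move: (msize (x + y)) (msize x) (msize y) hx hy; lia.
Qed.

Lemma wle0 N : wle N 0. Proof. by move=> i; rewrite coef0; left. Qed.

Lemma wle_mono N M p : (N <= M)%N -> wle N p -> wle M p.
Proof. by move=> NM h i; have [->|hi] := h i; [left|right; apply: leq_trans hi _]. Qed.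

Lemma wleD N p q : wle N p -> wle N q -> wle N (p + q).
Proof.
move=> hp hq i; rewrite coefD; have hd := msizeD_le p`_i q`_i.
have [->|hi] := hp i; have [->|hj] := hq i; rewrite ?add0r ?addr0;
  [by left|by right|by right|right].
by move: hi hj hd; move: (msize (_ + _)) (msize _) (msize _) => a b c; lia.
Qed.

Lemma wle_sum (T : Type) (s : seq T) (P : pred T) (F : T -> {poly {mpoly k[n]}}) N :
  (forall i, P i -> wle N (F i)) -> wle N (\sum_(i <- s | P i) F i).
Proof. by move=> h; apply: (big_ind (wle N)) => //; [apply: wle0|apply: wleD]. Qed.

Lemma wleC N (r : {mpoly k[n]}) : (msize r <= N.+1)%N -> wle N r%:P.
Proof.
move=> hr [|i]; rewrite coefC /=; last by left.
by right; rewrite muln0 addn0.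
Qed.

Lemma wleX : wle w 'X.
Proof.
move=> i; rewrite coefX; case: eqP => [->|]; last by left.
by right; rewrite msize1 muln1.
Qed.

Lemma wleM N M p q : wle N p -> wle M q -> wle (N + M) (p * q).
Proof.
move=> hp hq l; rewrite coefM; apply: msize_bound_sum => -[i /= hi] _.
have [->|pi0] := eqVneq p`_i 0; first by left; rewrite mul0r.
have [->|qi0] := eqVneq q`_(l - i) 0; first by left; rewrite mulr0.
right; have [/eqP|h1] := hp i; first by rewrite (negbTE pi0).
have [/eqP|h2] := hq (l - i)%N; first by rewrite (negbTE qi0).
rewrite (msizeM pi0 qi0).
have -> : (w * l = w * i + w * (l - i))%N by rewrite -mulnDr subnKC.
have := pi0; rewrite -msize_poly_eq0 -lt0n.
move: h1 h2; move: (msize _) (msize _) (w * i)%N (w * (l - i))%N => a b c d; clear; lia.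
Qed.

Lemma wleZ (c : k) N p : wle N p -> wle N (c%:MP%:P * p).
Proof.
move=> h; rewrite -[N]add0n; apply: wleM => //; apply: wleC.
exact: leq_trans (msizeC_le _ _) _.
Qed.
End WeightedDegree.

Section Homogenization.
Variables (k : fieldType) (n : nat) (lam : 'I_n -> k).
Local Notation Rx := {mpoly k[n.+1]}.
Local Notation wid := (widen_ord (leqnSn n)).

(* On the source side the last variable of [Rx] is the homogenising variable [s]: [psi1] sends
   [x_j] to [(y_j - lam_j y_max) s], [s] to [s] and [Y] to [y_max s]. *)
Definition line_coord (j : 'I_n) : Rx := 'X_(lift ord_max j) - lam j *: 'X_ord_max.

Definition hvar (i : 'I_n.+1) : {poly Rx} :=
  if unlift ord_max i is Some j then (line_coord j)%:P * 'X else 'X.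

Definition psi0 : {rmorphism Rx -> {poly Rx}} := mmap (polyC \o @mpolyC n.+1 k) hvar.

Definition psi1 : {rmorphism {poly Rx} -> {poly Rx}} :=
  horner_eval (('X_ord_max)%:P * 'X) \o map_poly psi0.

Definition tau0 : {rmorphism {mpoly k[n]} -> Rx} := mmap (@mpolyC n.+1 k) line_coord.

Definition tau1 : {rmorphism {poly {mpoly k[n]}} -> Rx} :=
  horner_eval 'X_ord_max \o map_poly tau0.

Lemma psi0C c : psi0 c%:MP = c%:MP%:P. Proof. by rewrite /psi0 /= mmapC. Qed.

Lemma psi0X i : psi0 'X_i = hvar i.
Proof. by rewrite /psi0 /= mmapX mmap1U. Qed.

Lemma psi1C c : psi1 c%:P = psi0 c.
Proof. by rewrite /psi1 /= map_polyC /horner_eval hornerC. Qed.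

Lemma psi1X : psi1 'X = ('X_ord_max)%:P * 'X.
Proof. by rewrite /psi1 /= map_polyX /horner_eval hornerX. Qed.

Definition hom (e : nat) (p : Rx) : {poly Rx} :=
  shear_homog (@mpolyC n.+1 k) (fun j => 'X_(wid j)) 'X_ord_max lam e p.

(** Multiplying all arguments of a form of degree [e] by [s] factors out [s] to the power [e];
    setting the homogenising variable to one gives back [p]. *)
Lemma psi1_hom e p : (msize p <= e.+1)%N -> psi1 (hom e p) = p%:P * 'X^e.
Proof.
move=> hp; rewrite /hom /shear_homog rmorph_sum [in RHS](mpolyE p) rmorph_sum mulr_suml.
rewrite big_seq [RHS]big_seq; apply: eq_bigr => m ms.
have hm : (mdeg m <= e)%N by rewrite -ltnS; apply: leq_trans hp; apply: msize_mdeg_lt.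
have hs i : psi1 (shear_subst (@mpolyC n.+1 k) (fun j => 'X_(wid j)) lam i) =
    ('X_i)%:P * 'X.
  rewrite /shear_subst; have [j ->|->] := unliftP ord_max i; last exact: psi1X.
  rewrite rmorphD rmorphM !psi1C psi0C psi1X psi0X /hvar.
  have -> : wid j = lift ord_max j by apply/val_inj; rewrite [RHS]lift_max.
  by rewrite liftK /line_coord rmorphB -mul_mpolyC rmorphM /=; ring.
rewrite rmorphM psi1C rmorphM psi0C rmorphXn psi0X /hvar unlift_none.
rewrite rmorph_prod (eq_bigr (fun i => ('X_i ^+ m i)%:P * 'X^(m i))); last first.
  by move=> i _; rewrite rmorphXn hs exprMn rmorphXn.
rewrite big_split /= prodrXr -mdegE -(rmorph_prod (@polyC _)) -mpolyXE_id.
rewrite -mul_mpolyC rmorphM /= -[in RHS](subnK hm) exprD; ring.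
Qed.

Lemma coef_psi0 r e : (psi0 r)`_e = tau0 (top_form r e).
Proof.
rewrite {1}[r]mpolyE rmorph_sum coef_sum /top_form rmorph_sum [RHS]big_mkcond /=.
apply: eq_bigr => m _; rewrite -!mul_mpolyC rmorphM psi0C coefCM.
have -> : psi0 'X_[m] = (tau0 'X_[mrestr m])%:P * 'X^(mdeg m).
  rewrite mpolyXE_id mdeg_restr rmorph_prod big_ord_recr /= rmorphXn psi0X /hvar unlift_none.
  rewrite exprD mulrA; congr (_ * _); rewrite mpolyXE_id rmorph_prod rmorph_prod mdegE.
  rewrite -prodrXr -big_split; apply: eq_bigr => j _ /=.
  rewrite !rmorphXn psi0X /hvar mnmE.
  have -> : wid j = lift ord_max j by apply/val_inj; rewrite [RHS]lift_max.
  rewrite liftK exprMn /tau0 /= mmapX mmap1U //.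
rewrite coefCM coefXn eq_sym; case: eqP => _; last by rewrite !mulr0.
by rewrite mulr1 rmorphM /tau0 /= mmapC.
Qed.

Lemma coef_psi1 p N : (psi1 p)`_N =
  tau1 (\poly_(i < size p) if (i <= N)%N then top_form p`_i (N - i) else 0).
Proof.
set V := \poly_(i < _) _.
rewrite -[psi1 p]/((map_poly psi0 p).[('X_ord_max)%:P * 'X]).
rewrite -[tau1 V]/((map_poly tau0 V).['X_ord_max]).
rewrite (horner_coef_wide _ (size_poly _ _)) coef_sum; have sV : (size (map_poly tau0 V) <= size p)%N.
  by apply: leq_trans (size_poly _ _) _; apply: size_poly.
rewrite (horner_coef_wide _ sV); apply: eq_bigr => i _.
rewrite !coef_map /= coef_poly ltn_ord exprMn mulrA -rmorphXn coefMXn.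
rewrite ltnNge; case: leqP => _ /=; last by rewrite raddf0 mul0r.
by rewrite coefMC coef_psi0.
Qed.
End Homogenization.

Lemma size_multiple (R : idomainType) (V c s : {poly R}) e :
  V = c * s -> (e < size s)%N -> (size V <= e)%N -> V = 0.
Proof.
have [-> ->|c0] := eqVneq c 0; first by rewrite mul0r.
have [-> ->|s0 eV] := eqVneq s 0; first by rewrite mulr0.
rewrite eV (size_mul c0 s0); move: c0; rewrite -size_poly_gt0.
by move: (size c) (size s) => a b; clear; lia.
Qed.

Section DirectionalLift.
Variables (k : fieldType) (n w : nat) (lam : 'I_n -> k).
Local Notation Rx := {mpoly k[n.+1]}.
Local Notation hom := (hom lam).
Local Notation psi1 := (psi1 lam).
Local Notation psi0 := (psi0 lam).
Local Notation tau0 := (tau0 lam).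
Local Notation tau1 := (tau1 lam).

Definition shear : {rmorphism Rx -> {poly {mpoly k[n]}}} :=
  mmap (polyC \o @mpolyC n k) (shear_subst (@mpolyC n k) (fun j => 'X_j) lam).

Lemma shearE e p : shear p = shear_homog (@mpolyC n k) (fun j => 'X_j) 1 lam e p.
Proof. by apply: eq_bigr => m _; rewrite expr1n mulr1. Qed.

Lemma shearC c : shear c%:MP = c%:MP%:P. Proof. by rewrite /shear /= mmapC. Qed.

Lemma shearX i : shear 'X_i = shear_subst (@mpolyC n k) (fun j => 'X_j) lam i.
Proof. by rewrite /shear /= mmapX mmap1U. Qed.

Lemma shearK : cancel tau1 shear.
Proof.
apply: (poly_rmorph_ext (f := shear \o tau1) (g := idfun)) => [c|]; last first.
  by rewrite /= map_polyX /horner_eval hornerX shearX /shear_subst unlift_none.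
rewrite -[LHS]/(shear (tau1 c%:P)).
have -> : tau1 c%:P = tau0 c by rewrite [LHS]/= map_polyC /horner_eval hornerC.
apply: (mpoly_rmorph_ext (f := shear \o tau0) (g := @polyC _)) => [a|i].
  by rewrite [LHS]/= mmapC shearC.
rewrite [LHS]/= mmapX mmap1U /line_coord rmorphB -mul_mpolyC rmorphM shearC !shearX.
by rewrite /shear_subst liftK unlift_none addrK.
Qed.

Lemma low_degree_multiple q e (V : {poly {mpoly k[n]}}) : (top_form q e).@[lam] = 1 -> (msize q <= e.+1)%N ->
  (size V <= e)%N -> divides q (tau1 V) -> V = 0.
Proof.
move=> hq sq sV [c hc]; have := congr1 shear hc; rewrite shearK rmorphM => eV.
have [s1 s2] := shear_top (@mpolyC n k) (fun j => 'X_j) 1 lam sq.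
rewrite -shearE hq /= in s1 s2.
apply: (size_multiple eV _ sV).
by rewrite ltnNge; apply/negP => h; move: s2; rewrite nth_default // => /esym/eqP; rewrite oner_eq0.
Qed.

Lemma hom_monic q e : (top_form q e).@[lam] = 1 -> (msize q <= e.+1)%N ->
  hom e q \is monic /\ size (hom e q) = e.+1.
Proof.
move=> hq sq.
have [s1 s2] := shear_top (@mpolyC n.+1 k) (fun j => 'X_(widen_ord (leqnSn n) j))
  'X_ord_max lam sq.
have s : size (hom e q) = e.+1.
  apply/eqP; rewrite eqn_leq s1 ltnNge; apply/negP => h.
  by move: s2; rewrite nth_default // hq => /esym/eqP; rewrite oner_eq0.
by split=> //; rewrite monicE lead_coefE s /= [X in X == _]s2 hq.
Qed.

(** Modulo the monic [hom e q] only a remainder of degree below [e] in the last variable is left.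
    The coefficients of its image then have degree below [e] along the direction [lam], in which [q]
    is monic of degree [e], so they cannot be nonzero multiples of [q]. *)
Lemma psi1_kernel q e p : (top_form q e).@[lam] = 1 -> (msize q <= e.+1)%N ->
  (forall N, divides q (psi1 p)`_N) <-> divides (hom e q) p.
Proof.
move=> hq sq; have [mq szq] := hom_monic hq sq.
have qI := divides_ideal q; split=> [h|[u ->] N]; last first.
  by rewrite rmorphM psi1_hom // mulrA mulrAC coefMC; exists (psi1 u * 'X^e)`_N.
have [u [v [ep sv]]] : exists u v, p = u * hom e q + v /\ (size v <= e)%N.
  exists (divp p (hom e q)), (modp p (hom e q)); split.
    exact: Pdiv.IdomainMonic.divp_eq.
  by rewrite -ltnS -szq ltn_modp monic_neq0.
have hv N : divides q (psi1 v)`_N.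
  have eN : (psi1 p)`_N = (psi1 u * 'X^e)`_N * q + (psi1 v)`_N.
    by rewrite ep rmorphD rmorphM psi1_hom // mulrA mulrAC coefD coefMC.
  have hN := h N.
  rewrite eN in hN.
  have h2 : divides q ((psi1 u * 'X^e)`_N * q) by exists (psi1 u * 'X^e)`_N.
  exact: (rideal_add qI h2 hN).
suff -> : p = u * hom e q by exists u.
rewrite [LHS]ep; suff -> : v = 0 by rewrite addr0.
apply/polyP => i; rewrite coef0; apply/eqP; apply: contraT => vi.
have iv : (i < size v)%N.
  by rewrite ltnNge; apply: contra vi => iv; rewrite nth_default.
(* This exponent selects the leading form of coefficient [i], which is nonzero. *)
have := hv (i + (msize v`_i).-1)%N; rewrite coef_psi1.
move=> /(low_degree_multiple hq sq) h0.
have := h0 _ => /(_ (leq_trans (size_poly _ _) sv))/polyP/(_ i).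
rewrite coef_poly iv leq_addr addKn coef0 => /eqP.
by rewrite (negbTE (top_form_neq0 vi)).
Qed.

(** The direction that keeps every [line_coord] fixed and moves the last coordinate with unit
    speed. *)
Definition dir (p : Rx) : Rx :=
  p^`M(ord_max) + \sum_j lam j *: p^`M(lift ord_max j).

Lemma mderiv_derivation m (i : 'I_m) : derivation_to id (@mderiv m k i).
Proof.
by split=> p q; [exact: mderivD|rewrite mderivM /= addrC].
Qed.

Lemma dir_derivation : derivation_to id dir.
Proof.
split=> p q; rewrite /dir.
  rewrite mderivD (eq_bigr (fun j => lam j *: p^`M(lift ord_max j) + lam j *: q^`M(lift ord_max j))).
    by rewrite big_split /=; ring.
  by move=> j _; rewrite mderivD scalerDr.
rewrite mderivM (eq_bigr (fun j => p * (lam j *: q^`M(lift ord_max j)) +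
    lam j *: p^`M(lift ord_max j) * q)).
  by rewrite big_split /= -mulr_sumr -mulr_suml; ring.
by move=> j _; rewrite mderivM scalerDr -scalerAr -scalerAl addrC.
Qed.

Lemma dirC c : dir c%:MP = 0.
Proof. by rewrite /dir mderivC big1 ?addr0 // => j _; rewrite mderivC scaler0. Qed.

Lemma mderivXU m (i j : 'I_m) : mderiv i ('X_j : {mpoly k[m]}) = (i == j)%:R.
Proof.
rewrite mderivX mnm1E eq_sym; case: eqP => [->|_]; last by rewrite scale0r.
by rewrite scale1r -[X in 'X_[X]](_ : 0%MM = _) ?mpolyX0 //; apply/mnmP => l; rewrite mnmBE subnn mnm0E.
Qed.

Lemma dir_max : dir 'X_ord_max = 1.
Proof.
rewrite /dir mderivXU eqxx big1 ?addr0 // => j _.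
by rewrite mderivXU eq_sym (negbTE (neq_lift _ _)) scaler0.
Qed.

Lemma dir_line j : dir (line_coord lam j) = 0.
Proof.
rewrite /line_coord (derivation_sub _ _ dir_derivation) -mul_mpolyC (proj2 dir_derivation).
rewrite dirC mul0r addr0 dir_max mulr1 /dir mderivXU (negbTE (neq_lift _ _)) add0r.
rewrite (bigD1 j) //= mderivXU eqxx big1 => [|i ij].
  by rewrite addr0 -mul_mpolyC mulr1 subrr.
rewrite mderivXU (inj_eq (@lift_inj _ ord_max)) (negbTE ij) scaler0 //.
Qed.

(** Along [dir] only the image [y_max s] of the polynomial variable moves, with derivative [s]; this
    accounts for the extra factor ['X]. *)
Lemma psi1_deriv p : psi1 p^`() * 'X = map_poly dir (psi1 p).
Proof.
have hd := derivation_map_poly dir_derivation.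
have dC c := derivation_map_polyC c dir_derivation.
have dX := derivation_map_polyX dir_derivation.
apply: (derivation_poly _ hd) => [c|]; last first.
  by rewrite psi1X (proj2 hd) dX dC dir_max mulr0 add0r mul1r.
rewrite psi1C; apply: (derivation_mpoly0 _ hd) => [a|i].
  by rewrite psi0C dC dirC.
rewrite psi0X /hvar; case: unliftP => [j _|_] //.
by rewrite (proj2 hd) dX dC dir_line mulr0 mul0r addr0.
Qed.
End DirectionalLift.

Lemma deriv_derivation (R : comNzRingType) : derivation_to id (@deriv R).
Proof. by split=> p q; [exact: derivD|rewrite derivM /= addrC]. Qed.

Lemma fraction_char0 (K : idomainType) (k : fieldType) (i : {rmorphism k -> K}) :
  [pchar k] =i pred0 -> [pchar {fraction K}] =i pred0.
Proof. by move=> k0 p; rewrite (fmorph_pchar (@tofrac K \o i)) k0. Qed.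

Section GradedLift.
Variables (k : fieldType) (n w : nat).
Local Notation Rx := {mpoly k[n]}.
Variables (Ry : idomainType) (psi : {rmorphism {poly Ry} -> {poly Rx}}).
Variables (hom : nat -> Rx -> {poly Ry}).
Hypothesis psi_hom : forall e r, (msize r <= e.+1)%N -> psi (hom e r) = r%:P * 'X^e.
Hypothesis psi_size : forall p N, (msize (psi p)`_N <= N.+1)%N.
Hypothesis hom1 : hom 0 1 = 1.

Variable Psi : {rmorphism {poly {poly Ry}} -> {poly {poly Rx}}}.
Hypothesis PsiC : forall p, Psi p%:P = map_poly polyC (psi p).
Hypothesis PsiX : Psi 'X = 'X%:P * 'X^w.

(** Homogenisation when the outer variable has weight [w]. If [wle w M a] holds, nonzero
    coefficients have [w * i <= M], so the truncated subtraction is exact where it matters. *)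
Definition homT M (a : {poly Rx}) : {poly {poly Ry}} :=
  \sum_(i < size a) (hom (M - w * i) a`_i)%:P * 'X^i.

Lemma Psi_hom M a : wle w M a -> Psi (homT M a) = a%:P * 'X^M.
Proof.
move=> ha; have ea : a = \sum_(i < size a) (a`_i)%:P * 'X^i.
  by rewrite -[LHS]coefK poly_def; apply: eq_bigr => i _; rewrite mul_polyC.
rewrite /homT (rmorph_sum Psi) [in RHS]ea rmorph_sum mulr_suml.
apply: eq_bigr => i _; rewrite (rmorphM Psi) PsiC (rmorphXn Psi) PsiX.
have hi : (msize (a`_i)%R <= (M - w * i).+1)%N /\ (a`_i != 0 -> (w * i <= M)%N).
  have [->|h] := ha i; first by rewrite msize0 eqxx.
  split=> [|ai0]; first by move: (msize _) (w * i)%N h => u v; clear; lia.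
  have : (0 < msize (a`_i)%R)%N by rewrite lt0n msize_poly_eq0.
  by move: (msize _) (w * i)%N h => u v; clear; lia.
rewrite (psi_hom (proj1 hi)).
have [->|/(proj2 hi) hM] := eqVneq a`_i 0; first by rewrite !mul0r rmorph0 !mul0r.
have -> : 'X^M = 'X^(M - w * i) * ('X^w) ^+ i :> {poly {poly Rx}}.
  by rewrite -exprM -exprD subnK.
rewrite rmorphM /= map_polyC map_polyXn /= exprMn rmorphM rmorphXn /=; ring.
Qed.

Lemma homT_monic M f : f \is monic -> (M = w * (size f).-1)%N ->
  homT M f \is monic.
Proof.
move=> mf eM; have s0 : (0 < size f)%N by rewrite size_poly_gt0 monic_neq0.
have e1 : homT M f = \poly_(i < size f) hom (M - w * i) f`_i.
  by rewrite poly_def; apply: eq_bigr => i _; rewrite mul_polyC.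
have c1 : hom (M - w * (size f).-1) f`_(size f).-1 = 1.
  by rewrite -lead_coefE (monicP mf) eM subnn hom1.
have sz : size (homT M f) = size f.
  rewrite e1 -(prednK s0) size_poly_eq // c1; exact: oner_neq0.
by rewrite monicE lead_coefE sz e1 coef_poly ltn_predL s0 c1.
Qed.

Lemma Psi_wle a N : wle w N (Psi a)`_N.
Proof.
move: a N; apply: poly_closed => [p q hp hq N|p q hp hq N|c N|N].
- by rewrite rmorphD coefD; apply: wleD.
- rewrite rmorphM coefM; apply: wle_sum => -[i /= hi] _.
  by have := wleM (hp i) (hq (N - i)%N); rewrite subnKC.
- by rewrite PsiC coef_map; apply: wleC; apply: psi_size.
- rewrite PsiX coefMXn coefC; case: ltnP => [_|h]; first exact: wle0.
  case: eqP => h2; last exact: wle0.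
  have -> : N = w by move: h h2; clear; lia.
  exact: wleX.
Qed.

Lemma Psi_deriv a : Psi a^`() * 'X^w = map_poly (@deriv Rx) (Psi a).
Proof.
have hd := derivation_map_poly (@deriv_derivation Rx).
have dC c := derivation_map_polyC c (@deriv_derivation Rx).
have dX := derivation_map_polyX (@deriv_derivation Rx).
apply: (derivation_poly _ hd) => [c|].
  rewrite PsiC; apply/polyP => i; rewrite coef_map coef_map /= coef0.
  exact: derivC.
rewrite PsiX (proj2 hd) dC derivX.
suff -> : map_poly (@deriv Rx) 'X^w = 0 by rewrite mulr0 add0r mul1r.
case: (w) => [|v]; first by rewrite expr0 dC derivC.
by rewrite (derivation_exp (f := idfun) _ _ hd) dX mulr0.
Qed.

Variables (q : Rx) (qh : {poly Ry}) (e : nat) (dq : Rx).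
Hypotheses (qh_psi : psi qh = q%:P * 'X^e) (mqh : qh \is monic) (sqh : (1 < size qh)%N).
Hypothesis dqh_psi : psi qh^`() * 'X = dq%:P * 'X^e.
Hypothesis ker_psi : forall p, (forall N, divides q (psi p)`_N) <-> divides qh p.

(* [residue_lift_morph] applied to the homogenised curve, with [T] of weight [w]: the
   coefficient of [s ^ (e + M)] of its solution has weighted degree at most [e + M]. *)
Lemma graded_lift (Q : set {poly Rx}) (f : {poly Rx}) :
  [pchar k] =i pred0 -> int_closed Ry -> rprime Q -> Q f -> f \is monic ->
  wle w (w * (size f).-1) f -> (forall r, Q r%:P <-> divides q r) ->
  exists b, [/\ wle w (e + w * (size f).-1) b, Q (b - f^`() * dq%:P) &
    forall a, Q a -> exists u v, b * a = u * q%:P + v * f].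
Proof.
move=> char0 hRy hQ Qf mf wf hq; set M := (w * _)%N in wf *.
have [K [pi [pi0 _]]] := residue_field hQ.
(* The variable of [{poly K}] is the homogenising variable [s], so [F a = 0] says that every
   coefficient of [Psi a] in [s] lies in [Q]. *)
pose F : {rmorphism {poly {poly Ry}} -> {fraction {poly K}}} :=
  @tofrac {poly K} \o map_poly pi \o Psi.
have F0 a : F a = 0 <-> forall N, Q (Psi a)`_N.
  split=> [h N|h].
    have h' : map_poly pi (Psi a) = 0.
      by apply: (@tofrac_inj {poly K}); rewrite rmorph0; exact: h.
    by apply/pi0; rewrite -coef_map h' coef0.
  rewrite [F a]/= (_ : map_poly pi (Psi a) = 0) ?rmorph0 //; apply/polyP => N.
  by rewrite coef_map coef0; apply/pi0/h.
have FC p : F p%:P = 0 <-> divides qh p.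
  rewrite F0 -ker_psi; split=> h N; have := h N.
    by rewrite PsiC coef_map => /hq.
  by rewrite PsiC coef_map => /hq.
have k2 : [pchar {fraction {poly K}}] =i pred0.
  exact: (@fraction_char0 {poly K} k (polyC \o pi \o polyC \o @mpolyC n k)).
pose fh := homT M f.
have efh : Psi fh = f%:P * 'X^M by exact: Psi_hom.
have mfh : fh \is monic by apply: homT_monic.
have Fr r : F r%:P%:P = 0 -> r = 0.
  move=> /FC[c hc]; apply/eqP; rewrite -polyC_eq0; apply/eqP.
  apply: (size_multiple hc sqh); exact: size_polyC_leq1.
have Ffh : F fh = 0.
  apply/F0 => N; rewrite efh coefCM; case: hQ => -[_ _ QM] _ _.
  by rewrite mulrC; apply: QM.
have [G [hG hG2]] := residue_lift_morph hRy Fr k2 mqh mfh FC Ffh.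
(* Differentiating [qh] costs one power of [s] and differentiating [fh] costs [w]; after the shift
   by [w.+1] the product of both derivatives is [f' dq] times [s] to the power [e + M]. *)
pose b := (Psi G * 'X^(w.+1))`_(e + M).
exists b; split.
- rewrite /b coefMXn; case: ltnP => h; first exact: wle0.
  by apply: (wle_mono (leq_subr _ _)); apply: Psi_wle.
- have : forall N, Q (Psi (G - qh^`()%:P * fh^`()))`_N.
    by apply/F0; rewrite (rmorphB F) (rmorphM F) hG subrr.
  have dfh : Psi fh^`() * 'X^w = f^`()%:P * 'X^M.
    rewrite Psi_deriv efh (proj2 (derivation_map_poly (@deriv_derivation Rx))).
    rewrite (derivation_map_polyC _ (@deriv_derivation Rx)).
    have hX : map_poly (@deriv Rx) 'X^M = 0.
      apply/polyP => i; rewrite coef_map /= coefXn coef0; case: eqP => _.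
        by rewrite derivC.
      by rewrite deriv0.
    by rewrite hX mulr0 add0r.
  have dqh : Psi qh^`()%:P * 'X = dq%:P%:P * 'X^e.
    rewrite PsiC -[X in _ * X](map_polyX (@polyC Rx)) -rmorphM dqh_psi rmorphM /=.
    by rewrite map_polyC map_polyXn.
  have eqn : Psi (G - qh^`()%:P * fh^`()) * 'X^(w.+1) =
      Psi G * 'X^(w.+1) - (f^`() * dq%:P)%:P * 'X^(e + M).
    rewrite (rmorphB Psi) (rmorphM Psi) mulrBl; congr (_ - _).
    rewrite exprS mulrACA dqh dfh exprD rmorphM /=; ring.
  move=> hN; have -> : b - f^`() * dq%:P = (Psi (G - qh^`()%:P * fh^`()) * 'X^(w.+1))`_(e + M).
    by rewrite eqn coefB coefCM coefXn eqxx mulr1.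
  rewrite coefMXn; case: ltnP => _ //.
  by case: hQ => -[].
- move=> a Qa.
  have [L hL] : exists L, wle w L a.
    exists (\max_(i < size a) (msize (a`_i)%R + w * i))%N => i.
    have [si|si] := ltnP i (size a); last by left; rewrite nth_default.
    right; apply: leqW; exact: (leq_bigmax (Ordinal si)).
  have [|u [v huv]] := hG2 (homT L a).
    apply/F0 => N; rewrite (Psi_hom hL) coefCM; case: hQ => -[_ _ QM] _ _.
    by rewrite mulrC; apply: QM.
  have eqn : Psi G * a%:P * 'X^L = Psi u * q%:P%:P * 'X^e + Psi v * f%:P * 'X^M.
    rewrite -mulrA -(Psi_hom hL) -rmorphM huv rmorphD !rmorphM efh PsiC qh_psi rmorphM /=.
    by rewrite map_polyC map_polyXn; ring.
  exists (Psi u * 'X^e * 'X^(w.+1))`_(e + M + L), (Psi v * 'X^M * 'X^(w.+1))`_(e + M + L).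
  rewrite -!coefMC -coefD.
  have -> : Psi u * 'X^e * 'X^(w.+1) * q%:P%:P + Psi v * 'X^M * 'X^(w.+1) * f%:P =
      Psi G * a%:P * 'X^L * 'X^(w.+1) by rewrite eqn; ring.
  have -> : Psi G * a%:P * 'X^L * 'X^(w.+1) = Psi G * 'X^(w.+1) * a%:P * 'X^L by ring.
  by rewrite [RHS]coefMXn ltnNge leq_addl addnK.
Qed.
End GradedLift.

Section SizeClosed.
Variables (k : fieldType) (n : nat).
Local Notation Rx := {mpoly k[n]}.

Definition hsize (p : {poly Rx}) : Prop := forall N, (msize p`_N <= N.+1)%N.

Lemma hsizeD p q : hsize p -> hsize q -> hsize (p + q).
Proof.
move=> hp hq N; rewrite coefD; apply: leq_trans (msizeD_le _ _) _.
by rewrite geq_max hp hq.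
Qed.

Lemma hsizeM p q : hsize p -> hsize q -> hsize (p * q).
Proof.
move=> hp hq N; rewrite coefM; apply: leq_trans (msize_sum _ _ _) _.
apply/bigmax_leqP => -[i /= hi] _.
have [->|p0] := eqVneq p`_i 0; first by rewrite mul0r msize0.
have [->|q0] := eqVneq q`_(N - i) 0; first by rewrite mulr0 msize0.
rewrite (msizeM p0 q0); have := hp i; have := hq (N - i)%N.
by move: (msize _) (msize _) => a b; clear -hi; lia.
Qed.

Lemma hsizeC r : (msize r <= 1)%N -> hsize r%:P.
Proof. by move=> h N; rewrite coefC; case: eqP => [->|] //; rewrite msize0. Qed.

Lemma hsizeCX r : (msize r <= 2)%N -> hsize (r%:P * 'X).
Proof. by move=> h [|[|N]]; rewrite coefMX ?coefC /= ?msize0. Qed.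

Lemma hsize_poly (R : comNzRingType) (g : {rmorphism {poly R} -> {poly Rx}}) p :
  (forall c, hsize (g c%:P)) -> hsize (g 'X) -> hsize (g p).
Proof.
move=> hC hX; move: p; apply: poly_closed => // [p q hp hq|p q hp hq].
  by rewrite rmorphD; apply: hsizeD.
by rewrite rmorphM; apply: hsizeM.
Qed.

Lemma hsize_mpoly m (g : {rmorphism {mpoly k[m]} -> {poly Rx}}) p :
  (forall c, hsize (g c%:MP)) -> (forall i, hsize (g 'X_i)) -> hsize (g p).
Proof.
move=> hC hX; move: p; apply: mpoly_closed => // [p q hp hq|p q hp hq].
  by rewrite rmorphD; apply: hsizeD.
by rewrite rmorphM; apply: hsizeM.
Qed.
End SizeClosed.

Section CoordinateLift.
Variables (k : fieldType) (n w : nat).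
Hypothesis char0 : [pchar k] =i pred0.
Local Notation Rx := {mpoly k[n.+1]}.

Lemma msizeU m (i : 'I_m) : msize ('X_i : {mpoly k[m]}) = 2%N.
Proof. by rewrite msizeX mdeg1. Qed.

Lemma psi1_size (lam : 'I_n -> k) (p : {poly Rx}) : hsize (psi1 lam p).
Proof.
apply: hsize_poly => [c|]; last by rewrite psi1X; apply: hsizeCX; rewrite msizeU.
rewrite psi1C; apply: hsize_mpoly => [a|i].
  by rewrite psi0C; apply: hsizeC; exact: msizeC_le.
rewrite psi0X /hvar; case: unliftP => [j _|_].
  apply: hsizeCX; rewrite /line_coord; apply: leq_trans (msizeD_le _ _) _.
  by rewrite msizeU geq_max /= msizeN; apply: leq_trans (msizeZ_le _ _) _; rewrite msizeU.
by rewrite -['X]mul1r; apply: hsizeCX; rewrite msize1.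
Qed.

Variables (Q : set {poly Rx}) (f : {poly Rx}) (q : Rx).
Hypotheses (hQ : rprime Q) (Qf : Q f) (mf : f \is monic).
Hypothesis wf : wle w (w * (size f).-1) f.
Hypotheses (hq : forall r, Q r%:P <-> divides q r) (q0 : q != 0).

(** With [C] the quotient by [f], the last clause reads [b Q] in [q C]: the fraction [b / q] has no
    pole over [q] other than a simple one along [Q]. It is applied to derivatives [r] of [q]. *)
Definition liftable (r : Rx) : Prop :=
  exists b, [/\ wle w ((msize q).-1 + w * (size f).-1) b, Q (b - f^`() * r%:P) &
    forall a, Q a -> exists u v, b * a = u * q%:P + v * f].

Lemma liftableD r s : liftable r -> liftable s -> liftable (r + s).
Proof.
case=> b [wb Qb hb] [c [wc Qc hc]]; exists (b + c); split; first exact: wleD.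
- case: hQ => -[_ QD _] _ _; have := QD _ _ Qb Qc.
  by rewrite [X in Q X](_ : _ = b + c - f^`() * (r + s)%:P) // rmorphD; ring.
- move=> a /[dup] /hb[u [v e1]] /hc[u' [v' e2]]; exists (u + u'), (v + v').
  by rewrite mulrDl e1 e2; ring.
Qed.

Lemma liftableZ (c : k) r : liftable r -> liftable (c *: r).
Proof.
case=> b [wb Qb hb]; exists (c%:MP%:P * b); split; first exact: wleZ.
- case: hQ => -[_ _ QM] _ _; have := QM c%:MP%:P _ Qb.
  by rewrite [X in Q X](_ : _ = c%:MP%:P * b - f^`() * (c *: r)%:P) // -mul_mpolyC rmorphM /=; ring.
- move=> a /hb[u [v e1]]; exists (c%:MP%:P * u), (c%:MP%:P * v).
  by rewrite -[LHS]mulrA e1; ring.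
Qed.

Lemma top_formZ (c : k) (p : Rx) e : c != 0 -> top_form (c *: p) e = c *: top_form p e.
Proof.
move=> c0; rewrite /top_form (perm_big _ (msuppZ p c0)) scaler_sumr /=.
by apply: eq_bigr => m _; rewrite mcoeffZ scalerA.
Qed.

Lemma liftable_dir_monic (lam : 'I_n -> k) :
  (top_form q (msize q).-1).@[lam] = 1 -> liftable (dir lam q).
Proof.
set e := (msize q).-1 => tq; have sq : (msize q <= e.+1)%N by rewrite /e leqSpred.
have [mqh sqh] := hom_monic tq sq.
have e0 : (0 < e)%N.
  rewrite lt0n; apply/eqP => e0; have h1 : (msize q <= 1)%N by rewrite -e0.
  have [_ nQ1 _] := hQ; apply: nQ1; apply/(hq 1); exists (q@_0)^-1%:MP.
  have c0 : q@_0 != 0.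
    by apply: contraNneq q0 => c0; rewrite (msize1_polyC h1) c0 mpolyC0.
  by rewrite {2}(msize1_polyC h1) -mpolyCM mulVf.
have shd := dir_derivation lam.
pose Psi : {rmorphism {poly {poly Rx}} -> {poly {poly Rx}}} :=
  horner_eval ('X%:P * 'X^w) \o map_poly (map_poly polyC \o psi1 lam).
apply: (@graded_lift k n.+1 w Rx (psi1 lam) (hom lam) (@psi1_hom k n lam)
   (@psi1_size lam) _ Psi _ _ q (hom lam e q)) => //.
- by rewrite /hom /shear_homog msupp1 big_seq1 mcoeff1 eqxx mdeg0 mulr1 rmorph1 mul1r big1 // => i _; rewrite mnm0E expr0.
- by move=> p; rewrite [LHS]/= map_polyC /horner_eval hornerC.
- by rewrite [LHS]/= map_polyX /horner_eval hornerX.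
- exact: psi1_hom.
- by rewrite sqh.
- rewrite psi1_deriv psi1_hom // (proj2 (derivation_map_poly shd)).
  have hX : map_poly (dir lam) 'X^e = 0.
    rewrite -(prednK e0) (derivation_exp (f := idfun) _ _ (derivation_map_poly shd)).
    by rewrite (derivation_map_polyX shd) mulr0.
  by rewrite hX mulr0 add0r (derivation_map_polyC _ shd).
- by move=> p; apply: psi1_kernel.
- exact: int_closed_mpoly.
Qed.
End CoordinateLift.

Section CoordinateLift2.
Variables (k : fieldType) (n w : nat).
Hypothesis char0 : [pchar k] =i pred0.
Local Notation Rx := {mpoly k[n.+1]}.
Variables (Q : set {poly Rx}) (f : {poly Rx}) (q : Rx).
Hypotheses (hQ : rprime Q) (Qf : Q f) (mf : f \is monic).
Hypothesis wf : wle w (w * (size f).-1) f.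
Hypotheses (hq : forall r, Q r%:P <-> divides q r) (q0 : q != 0).

Lemma dirZ lam (c : k) (p : Rx) : dir lam (c *: p) = c *: dir lam p.
Proof.
by rewrite -!mul_mpolyC (proj2 (dir_derivation lam)) dirC mul0r addr0.
Qed.

Lemma liftable_dir (lam : 'I_n -> k) :
  (top_form q (msize q).-1).@[lam] != 0 -> liftable w Q f q (dir lam q).
Proof.
set c := _.@[lam] => c0; pose q1 := c^-1 *: q.
have ci0 : c^-1 != 0 by rewrite invr_eq0.
have eq1 : q = c%:MP * q1 by rewrite mul_mpolyC scalerA mulfV // scale1r.
have sz1 : msize q1 = msize q by rewrite msizeZ.
have [|||b [wb Qb hb]] := @liftable_dir_monic k n w char0 Q f q1 hQ Qf mf wf _ _ lam.
- move=> r; rewrite hq; split=> -[u ->].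
    by exists (u * c%:MP); rewrite {1}eq1 mulrA.
  by exists (u * c^-1%:MP); rewrite -mulrA mul_mpolyC.
- by rewrite scaler_eq0 negb_or ci0.
- by rewrite sz1 top_formZ // mevalZ mulVf.
have h1 : liftable w Q f q (dir lam q1).
  exists b; split; [by rewrite -sz1|exact: Qb|].
  move=> a /hb[u [v ->]]; exists (u * (c^-1)%:MP%:P), v.
  by rewrite -[_ * _ * q%:P]mulrA -rmorphM mul_mpolyC.
have := liftableZ hQ c h1.
by rewrite -dirZ -mul_mpolyC -eq1.
Qed.

(** The product of [p] with its translate by a unit vector is a nonzero polynomial, and any point
    where it does not vanish will do. *)
Lemma top_form_shift (j : 'I_n) (p : {mpoly k[n]}) : p != 0 ->
  exists v, p.@[v] != 0 /\ p.@[fun l => v l + (l == j)%:R] != 0.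
Proof.
move=> p0; pose g : {rmorphism {mpoly k[n]} -> {mpoly k[n]}} :=
  mmap (@mpolyC n k) (fun l => 'X_l + (l == j)%:R).
have eg v r : (g r).@[v] = r.@[fun l => v l + (l == j)%:R].
  move: r; apply: (mpoly_rmorph_ext (f := meval v \o g) (g := meval (fun l => v l + (l == j)%:R))) => [c|i].
    have gc : g c%:MP = c%:MP by exact: mmapC.
    by rewrite -[LHS]/((g c%:MP).@[v]) gc [LHS]mevalC; apply/esym; exact: mevalC.
  have gi : g 'X_i = 'X_i + (i == j)%:R by rewrite /g /= mmapX mmap1U.
  rewrite -[LHS]/((g 'X_i).@[v]) gi mevalD mevalXU; apply/esym; apply: etrans (mevalXU _ _) _.
  congr (_ + _).
  by case: (i == j); rewrite ?meval0 ?meval1.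
have g0 : g p != 0.
  have [v hv] := mpoly_nonvanishing char0 p0.
  apply: contraNneq hv => h; have := eg (fun l => v l - (l == j)%:R) p.
  rewrite h meval0 => e0; apply/eqP; apply: etrans (esym e0).
  by apply: meval_eq => l; rewrite subrK.
have [v] := mpoly_nonvanishing char0 (mulf_neq0 p0 g0).
by rewrite mevalM mulf_eq0 negb_or eg => /andP[h1 h2]; exists v.
Qed.

(* A coordinate direction is the difference of two directions in which [q] is monic. *)
Lemma liftable_coord (i : 'I_n.+1) : liftable w Q f q q^`M(i).
Proof.
have t0 := top_form_neq0 q0.
have Ld j : liftable w Q f q q^`M(lift ord_max j).
  have [v [v1 v2]] := top_form_shift j t0.
  have := liftableD hQ (liftable_dir v2) (liftableZ hQ (-1) (liftable_dir v1)).
  rewrite [X in liftable _ _ _ _ X](_ : _ = q^`M(lift ord_max j)) // scaleN1r /dir.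
  rewrite opprD addrACA subrr add0r -sumrB (bigD1 j) //= eqxx big1 => [|l lj].
    by rewrite addr0 -scalerBl addrC addKr scale1r.
  by rewrite (negbTE lj) addr0 subrr.
have [j ->|->] := unliftP ord_max i; first exact: Ld.
have [v v1] := mpoly_nonvanishing char0 t0.
have hs : liftable w Q f q (\sum_j v j *: q^`M(lift ord_max j)).
  apply: (big_ind (liftable w Q f q)) => [||j _]; [|exact: (liftableD hQ)|exact: (liftableZ hQ)].
  by rewrite -(scale0r (dir v q)); apply: (liftableZ hQ); exact: liftable_dir.
have := liftableD hQ (liftable_dir v1) (liftableZ hQ (-1) hs).
by rewrite scaleN1r /dir addrK.
Qed.
End CoordinateLift2.

(** * Lie derivatives of logarithmic forms *)

Section DerivationExtension.
Variables (R : comNzRingType) (E : fieldType) (f : {rmorphism R -> E}) (d : R -> E).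
Hypotheses (ff : isfrac f) (hd : derivation_to f d) (hk : forall r, f r = 0 -> d r = 0).

Let quo (a b : R) : E := (d a * f b - f a * d b) / (f b ^+ 2).

Let quo_wd a b a' b' : f b != 0 -> f b' != 0 -> f a / f b = f a' / f b' ->
  quo a b = quo a' b'.
Proof.
move=> b0 b0' e; have ea : f a = f a' * f b / f b' by apply: (mulIf (invr_neq0 b0)); rewrite e; field; rewrite b0 b0'.
have e2 : d (a * b' - a' * b) = 0.
  by apply: hk; rewrite rmorphB !rmorphM ea; field.
have {e2} ed : d a = (d a' * f b + f a' * d b - f a * d b') / f b'.
  apply: (mulIf b0'); rewrite divfK //; apply/eqP; rewrite -subr_eq0 -[X in _ == X]e2.
  by rewrite (derivation_sub _ _ hd) !(proj2 hd); apply/eqP; ring.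
by rewrite /quo ed ea; field; rewrite b0 b0'.
Qed.

(** The quotient rule is well defined because [d] kills the kernel of [f]. Allowing a kernel lets a
    derivation of [A] that preserves [P] act on the residue field of [P]. *)
Lemma derivation_extend : exists D : E -> E, derivation_to id D /\ forall r, D (f r) = d r.
Proof.
have d1 := derivation1 hd.
have /choice[D hD] x : exists y, forall a b, f b != 0 -> x = f a / f b -> y = quo a b.
  have [a [b [b0 ->]]] := ff x; exists (quo a b) => a' b' b0' e; exact: quo_wd.
exists D; split; last first.
  move=> r; have -> : D (f r) = quo r 1 by apply: hD; rewrite rmorph1 ?oner_neq0 ?divr1.
  by rewrite /quo rmorph1 d1 expr1n divr1 mulr1 mulr0 subr0.
split=> x y; have [a [b [b0 ex]]] := ff x; have [a' [b' [b0' ey]]] := ff y.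
  rewrite (hD _ a b b0 ex) (hD _ a' b' b0' ey) (hD _ (a * b' + a' * b) (b * b')).
  - by rewrite /quo (proj1 hd) !(proj2 hd) !(rmorphD, rmorphM); field; rewrite b0 b0'.
  - by rewrite rmorphM mulf_neq0.
  - by rewrite ex ey !(rmorphD, rmorphM); field; rewrite b0 b0'.
rewrite /= (hD _ a b b0 ex) (hD _ a' b' b0' ey) (hD _ (a * a') (b * b')).
- by rewrite ex ey /quo !(proj2 hd) !rmorphM; field; rewrite b0 b0'.
- by rewrite rmorphM mulf_neq0.
- by rewrite ex ey !rmorphM; field; rewrite b0 b0'.
Qed.
End DerivationExtension.

Section LieDivision.
Variables (K : fieldType) (C Q : set K).
Hypotheses (CD : forall x y, C x -> C y -> C (x + y)) (CN : forall x, C x -> C (- x)).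
Hypothesis CM : forall x y, C x -> C y -> C (x * y).
Hypotheses (QC : forall x, Q x -> C x) (QD : forall x y, Q x -> Q y -> Q (x + y)).
Hypothesis QM : forall x y, C x -> Q y -> Q (x * y).
Hypothesis Qprime : forall x y, C x -> C y -> Q (x * y) -> Q x \/ Q y.
Hypothesis C1 : C 1.
Variables (q : K) (n : nat) (g : K -> K) (D : 'I_n -> K -> K) (b : 'I_n -> K).
Hypotheses (q0 : q != 0) (Qq : Q q).
Hypothesis reduced : forall x, Q x -> (forall y, Q y -> C (x * y / q)) -> C (x / q).
Hypotheses (hg : derivation_to id g) (gC : forall x, C x -> C (g x)).
Hypothesis gQ : forall x, Q x -> Q (g x).
Hypotheses (hD : forall j, derivation_to id (D j)) (DC : forall j x, C x -> C (D j x)).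
Hypotheses (bC : forall j, C (b j)) (bD : forall j, Q (b j - D j q)).
Hypothesis bQ : forall j x, Q x -> C (b j * x / q).
Hypothesis nbQ : exists i, ~ Q (b i).

Let QN x : Q x -> Q (- x).
Proof. by move=> h; rewrite -mulN1r; apply: (QM) => //; apply: (CN). Qed.

(* Near [Q] the element [b j / q] is the logarithmic derivative of [q] along [D j]. *)
Lemma log_derivative j x : Q x -> Q (D j x - b j * x / q).
Proof.
move=> Qx; have [i nQi] := nbQ.
pose z := b i * x / q; have Cz : C z := bQ i Qx.
(* Differentiating [q z = b_i x] gives [b_i D_j x = (D_j q) z] modulo [Q], which is
   [b_j z = b_i b_j x / q]; then [b_i], being outside [Q], is cancelled. *)
have e1 : b i * D j x + D j (b i) * x = q * D j z + D j q * z.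
  have eqz : q * z = b i * x by rewrite /z mulrC divfK.
  by have /= h := proj2 (hD j) q z; have /= <- := proj2 (hD j) (b i) x; rewrite -h eqz.
have e2 : b i * (D j x - b j * x / q) = (q * D j z - D j (b i) * x) - (b j - D j q) * z.
  rewrite mulrBr; have -> : b i * D j x = q * D j z + D j q * z - D j (b i) * x by rewrite -e1 addrK.
  by rewrite /z; field.
have : Q (b i * (D j x - b j * x / q)).
  rewrite e2; apply: (QD); last by apply: QN; rewrite mulrC; apply: (QM).
  apply: (QD); first by rewrite mulrC; apply: (QM) => //; apply: (DC).
  by apply: QN; apply: (QM) => //; apply: (DC).
case/Qprime => //.
by apply: (CD); [apply: (DC); apply: (QC)|apply: (CN); apply: (bQ)].
Qed.

Variables (F : K) (nu : 'I_n -> 'I_n -> K).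
Hypotheses (CF : C F) (Cnu : forall j l, C (nu j l)).
Hypothesis comm_q : forall j,
  F * (g (D j q) - D j (g q)) = \sum_l nu j l * D l q.

(* The one-form with components [b j / q] has a simple logarithmic pole along [Q] and no other
   pole over [q]; its Lie derivative along a field tangent to [Q] is regular. *)
Lemma lie_division j :
  C ((F * g (b j) - F * (b j * g q / q) - \sum_l nu j l * b l) / q).
Proof.
have hr : C (b j * g q / q) by apply: (bQ); apply: (gQ).
have CB x y : C x -> C y -> C (x - y) by move=> hx hy; apply: (CD) => //; apply: (CN).
have QB x y : Q x -> Q y -> Q (x - y) by move=> hx hy; apply: (QD) => //; apply: QN.
have Csum (e : 'I_n -> K) : (forall l, C (e l)) -> C (\sum_l e l).
  by move=> h; apply: (big_ind C) => //; rewrite -(subrr 1); apply: (CB).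
have Qsum (e : 'I_n -> K) : (forall l, Q (e l)) -> Q (\sum_l e l).
  by move=> h; apply: (big_ind Q) => //; rewrite -(subrr q); apply: (QB).
(* It remains to see that the numerator is in [Q] and multiplies [Q] into [q C]. For the first,
   [b_j] is replaced by [D_j q] under [g], [comm_q] exchanges [g] with [D_j], and [log_derivative]
   is applied to [g q]. *)
apply: reduced => [|y Qy].
  have e : F * g (b j) - F * (b j * g q / q) - \sum_l nu j l * b l =
     F * (g (b j - D j q)) + F * (D j (g q) - b j * g q / q) - \sum_l nu j l * (b l - D l q).
    have -> : \sum_l nu j l * (b l - D l q) = \sum_l nu j l * b l - \sum_l nu j l * D l q.
      by rewrite -sumrB; apply: eq_bigr => l _; rewrite mulrBr.
    by rewrite -comm_q (derivation_sub _ _ hg); ring.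
  rewrite e; apply: (QB); last by apply: (Qsum) => l; apply: (QM).
  apply: (QD); apply: (QM) => //; first by apply: (gQ).
  by apply: log_derivative; apply: (gQ).
(* For the second, [q s = b_j y] is differentiated along [g], which trades [g(b_j) y / q] for terms
   already known to lie in [C]. *)
pose s := b j * y / q; have Cs : C s := bQ j Qy.
have es : g (b j) * y + b j * g y = q * g s + g q * s.
  have h1 : q * s = b j * y by rewrite /s mulrC divfK.
  by have /= h2 := proj2 hg q s; have /= h3 := proj2 hg (b j) y; rewrite -h2 h1 h3 addrC.
have e : (F * g (b j) - F * (b j * g q / q) - \sum_l nu j l * b l) * y / q =
   F * (g s - b j * g y / q) - \sum_l nu j l * (b l * y / q).
  have -> : \sum_l nu j l * (b l * y / q) = (\sum_l nu j l * b l) * y / q.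
    by rewrite -mulrA mulr_suml; apply: eq_bigr => l _; rewrite !mulrA.
  have -> : g s = (g (b j) * y + b j * g y - g q * s) / q.
    by rewrite es addrK mulrC mulKf.
  by rewrite /s; field.
rewrite e; apply: (CB).
  by apply: (CM) => //; apply: (CB); [apply: (gC)|apply: (bQ); apply: (gQ)].
by apply: (Csum) => l; apply: (CM) => //; apply: (bQ).
Qed.
End LieDivision.

Section MpolyDerivative.
Variables (k : fieldType) (n : nat).
Implicit Types p : {mpoly k[n]}.

Lemma msize_mderiv p i : (msize p^`M(i) <= (msize p).-1)%N.
Proof.
rewrite /mderiv; apply: leq_trans (msize_sum _ _ _) _; apply/bigmax_leqP_seq => m mp _.
have hm : (mdeg m < msize p)%N by apply: msize_mdeg_lt.
have [mi|mi] := eqVneq (m i) 0%N; first by rewrite mi mul0r scale0r msize0.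
apply: leq_trans (msizeZ_le _ _) _; rewrite msizeX.
have -> : mdeg (m - U_(i)) = (mdeg m).-1.
  have /(congr1 mdeg) : (m - U_(i) + U_(i))%MM = m by rewrite submK // lep1mP.
  by rewrite mdegD mdeg1 addn1 => <-.
have : (0 < mdeg m)%N by rewrite mdegE (bigD1 i) //= addn_gt0 lt0n mi.
by move: (mdeg m) (msize p) hm => a b; clear; lia.
Qed.

Lemma mderiv_nonconstant p : [pchar k] =i pred0 -> (1 < msize p)%N -> exists i, p^`M(i) != 0.
Proof.
move=> /pcharf0P k0 sp; apply: contrapT => h.
have p0 : p != 0 by apply: contraTneq sp => ->; rewrite msize0.
have [m [mp m0]] : exists m, p@_m != 0 /\ mdeg m = (msize p).-1.
  by exists (mlead p); rewrite -mcoeff_msupp mlead_supp // -(mlead_deg p0).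
have [i mi] : exists i, m i != 0%N.
  apply: contrapT => hi; have em : m = 0%MM.
    by apply/mnmP => i; rewrite mnm0E; apply/eqP; apply: contraT => mi; case: hi; exists i.
  by move: m0 sp; rewrite em mdeg0; move: (msize p) => a; clear; lia.
apply: h; exists i; apply/negP => /eqP/mpolyP/(_ (m - U_(i))%MM).
have le : (U_(i) <= m)%MM by rewrite lep1mP.
rewrite mcoeff_deriv submK // mcoeff0 => /eqP.
by rewrite -mulr_natr mulf_eq0 (negbTE mp) k0.
Qed.

(** In characteristic zero some derivative is nonzero, and its smaller degree forbids divisibility.
    The index found is one at which the form [W_Q] really has its pole. *)
Lemma prime_elt_mderiv p : [pchar k] =i pred0 -> prime_elt p ->
  exists i, ~ divides p p^`M(i).
Proof.
move=> k0 [p0 pu _]; have sp : (1 < msize p)%N.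
  rewrite ltnNge; apply/negP => h1; have ep := msize1_polyC h1.
  case/negP: pu; rewrite ep rmorph_unit // unitfE.
  by apply: contraNneq p0 => c0; rewrite ep c0 mpolyC0.
have [i hi] := mderiv_nonconstant k0 sp; exists i => -[c ec].
have c0 : c != 0 by apply: contraNneq hi => c0; rewrite ec c0 mul0r.
have := msize_mderiv p i; rewrite ec (msizeM c0 p0).
by move: c0; rewrite -msize_poly_eq0; move: (msize c) (msize p) sp => a b; clear; lia.
Qed.
End MpolyDerivative.

Lemma wle_exists (k : fieldType) n w (p : {poly {mpoly k[n]}}) : exists N, wle w N p.
Proof.
exists (\max_(i < size p) (msize (p`_i)%R + w * i))%N => i.
have [si|si] := ltnP i (size p); last by left; rewrite nth_default.
right; apply: leqW; exact: (leq_bigmax (Ordinal si)).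
Qed.

Lemma wle_monomial (k : fieldType) n w N (c : {mpoly k[n]}) i :
  (msize c + w * i <= N.+1)%N -> wle w N (c%:P * 'X^i).
Proof.
move=> h j; rewrite coefCM coefXn; case: eqP => [->|_]; last by left; rewrite mulr0.
by right; rewrite mulr1.
Qed.

Lemma wle_deriv (k : fieldType) n w N (p : {poly {mpoly k[n]}}) :
  wle w N p -> wle w N p^`().
Proof.
move=> h i; rewrite coef_deriv; have [e|hi] := h i.+1; first by left; rewrite e mul0rn.
right; rewrite -mulr_natl -mpolyC_nat mul_mpolyC.
apply: leq_trans hi; rewrite mulnS leq_add //; last exact: leq_addl.
exact: msizeZ_le.
Qed.

Lemma wle_mderiv (k : fieldType) n w N (p : {poly {mpoly k[n]}}) l :
  wle w N p -> wle w N (map_poly (mderiv l) p).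
Proof.
move=> h i; rewrite coef_map /=; have [->|hi] := h i; first by left; rewrite mderiv0.
right; apply: leq_trans hi; rewrite leq_add2r; apply: leq_trans (msize_mderiv _ _) _.
exact: leq_pred.
Qed.

Lemma uniform_bound (n : nat) (P : 'I_n -> nat -> Prop) :
  (forall i N M, (N <= M)%N -> P i N -> P i M) -> (forall i, exists N, P i N) ->
  exists N, forall i, P i N.
Proof.
move=> hm /choice[N hN]; exists (\max_i N i)%N => i; apply: hm (hN i).
exact: leq_bigmax.
Qed.

Lemma size_sub_lead (R : idomainType) (p f : {poly R}) : f \is monic ->
  (size f <= size p)%N ->
  (size (p - (lead_coef p)%:P * 'X^(size p - size f) * f)%R < size p)%N.
Proof.
move=> mf le; have f0 : (0 < size f)%N by rewrite size_poly_gt0 monic_neq0.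
have p0 : (0 < size p)%N by exact: leq_trans le.
rewrite -[X in (_ < X)%N](prednK p0) ltnS; apply/leq_sizeP => j hj.
rewrite coefB -mulrA coefCM coefXnM; have [->|nj] := eqVneq j (size p).-1.
  have -> : ((size p).-1 < size p - size f)%N = false.
    by apply/negbTE; rewrite -leqNgt; move: (size p) (size f) f0 p0 => a b; clear; lia.
  have -> : ((size p).-1 - (size p - size f))%N = (size f).-1.
    by move: (size p) (size f) f0 p0 le => a b; clear; lia.
  by rewrite -!lead_coefE (monicP mf) mulr1 subrr.
have hp : (size p <= j)%N by rewrite -(prednK p0) ltn_neqAle eq_sym nj.
rewrite nth_default // ltnNge (leq_trans (leq_subr _ _) hp) /= nth_default ?mulr0 ?subrr //.
by move: (size p) (size f) hp le => a b; clear; lia.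
Qed.

Section Frame.
Variables (k : fieldType) (d w : nat) (K : fieldType).
Local Notation Rx := {mpoly k[d]}.
Local Notation S := {poly Rx}.
Variables (ev : {rmorphism S -> K}) (f : S).
Hypotheses (char0 : [pchar k] =i pred0) (mf : f \is monic).
Hypothesis wf : wle w (w * (size f).-1) f.
Hypotheses (evf : forall p, ev p = 0 <-> divides f p) (eff : isfrac ev).
Hypothesis F0 : ev f^`() != 0.
Variables (v : S) (g0 : Rx).
Hypotheses (hv : ev v * ev f^`() = ev g0%:P).

Definition inC : set K := fun x => exists p, x = ev p.

Definition degC (N : nat) (x : K) : Prop := exists2 p, wle w N p & x = ev p.

Lemma inCD x y : inC x -> inC y -> inC (x + y).
Proof. by case=> p -> [r ->]; exists (p + r); rewrite rmorphD. Qed.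
Lemma inCN x : inC x -> inC (- x).
Proof. by case=> p ->; exists (- p); rewrite rmorphN. Qed.
Lemma inCM x y : inC x -> inC y -> inC (x * y).
Proof. by case=> p -> [r ->]; exists (p * r); rewrite rmorphM. Qed.
Lemma inC1 : inC 1. Proof. by exists 1; rewrite rmorph1. Qed.

Lemma degC_inC N x : degC N x -> inC x. Proof. by case=> p _ ->; exists p. Qed.

Lemma degC_exists x : inC x -> exists N, degC N x.
Proof. by case=> p ->; have [N hN] := wle_exists w p; exists N, p. Qed.

Lemma degC_mono N M x : (N <= M)%N -> degC N x -> degC M x.
Proof. by move=> NM [p hp ->]; exists p => //; apply: wle_mono hp. Qed.

Lemma degCD N x y : degC N x -> degC N y -> degC N (x + y).
Proof. by case=> p hp -> [r hr ->]; exists (p + r); rewrite ?rmorphD //; apply: wleD. Qed.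

Lemma degCN N x : degC N x -> degC N (- x).
Proof.
case=> p hp ->; exists (((-1)%:MP)%:P * p); first exact: wleZ.
by rewrite rmorphM mpolyCN polyCN rmorphN /= rmorph1 mulN1r.
Qed.

Lemma degCM N M x y : degC N x -> degC M y -> degC (N + M) (x * y).
Proof. by case=> p hp -> [r hr ->]; exists (p * r); rewrite ?rmorphM //; apply: wleM. Qed.

Lemma degC_sum N n (e : 'I_n -> K) : (forall i, degC N (e i)) -> degC N (\sum_i e i).
Proof.
move=> h; apply: (big_ind (degC N)) => // [|x y]; last exact: degCD.
by exists 0; [exact: wle0|rewrite rmorph0].
Qed.

Let sf : (1 < size f)%N.
Proof.
rewrite ltnNge; apply: contraNN F0 => h; have ef := size1_polyC h.
by rewrite ef derivC rmorph0.
Qed.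

Lemma ev_injC r : ev r%:P = 0 -> r = 0.
Proof.
move=> /evf[c hc]; apply/eqP; rewrite -polyC_eq0; apply/eqP.
by apply: (size_multiple hc sf); apply: size_polyC_leq1.
Qed.

Lemma ev_inj_small (p : S) : (size p < size f)%N -> ev p = 0 -> p = 0.
Proof.
move=> sp /evf[c hc]; apply: (@size_multiple _ _ _ _ (size f).-1 hc).
  by rewrite prednK // (ltn_trans _ sf).
by move: sp; move: (size p) (size f) => a b; clear; lia.
Qed.

(** By [wf] the polynomial [f] is no heavier than its leading power, so removing leading terms with
    multiples of [f] never raises the weighted degree. *)
Lemma degC_reduced N x : degC N x -> exists p, [/\ wle w N p, (size p < size f)%N & x = ev p].
Proof.
case=> p hp ->; have [m] := ubnP (size p); elim: m p hp => // m IH p hp.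
rewrite ltnS => sp; have [lt|ge] := ltnP (size p) (size f); first by exists p.
have s0 : (0 < size p)%N by apply: leq_trans ge; exact: ltnW.
set c := lead_coef p; set i := (size p - size f)%N.
pose r := p - c%:P * 'X^i * f.
have hi : ((size p).-1 = i + (size f).-1)%N.
  by rewrite /i; move: (size p) (size f) ge sf => a b; clear; lia.
have c0 : c != 0 by rewrite lead_coef_eq0 -size_poly_gt0.
have wc : wle w (N - w * (size f).-1) (c%:P * 'X^i).
  apply: wle_monomial; have [/eqP|] := hp (size p).-1; first by rewrite -lead_coefE (negbTE c0).
  rewrite -lead_coefE -/c hi mulnDr; have : (0 < msize c)%N by rewrite lt0n msize_poly_eq0.
  move: (msize c) (w * i)%N (w * (size f).-1)%N => x1 x2 x3; clear; lia.
have wN : (w * (size f).-1 <= N)%N.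
  have [/eqP|] := hp (size p).-1; first by rewrite -lead_coefE (negbTE c0).
  rewrite -lead_coefE -/c hi mulnDr; have : (0 < msize c)%N by rewrite lt0n msize_poly_eq0.
  move: (msize c) (w * i)%N (w * (size f).-1)%N => x1 x2 x3; clear; lia.
have wr : wle w N r.
  apply: wleD => //; rewrite -mulN1r -[1]/(1%:MP%:P) -polyCN -mpolyCN; apply: wleZ.
  by rewrite -(subnK wN); apply: wleM.
have er : ev r = ev p.
  rewrite rmorphB rmorphM; have -> : ev f = 0 by apply/evf; exists 1; rewrite mul1r.
  by rewrite mulr0 subr0.
have sr : (size r < m)%N by apply: leq_trans sp; apply: size_sub_lead.
by have [p' [h1 h2 h3]] := IH r wr sr; exists p'; rewrite -er.
Qed.

(** Representatives reduced modulo [f] are unique and [q] is constant in the last variable, so the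
    division is coefficientwise and the degree of [q] is subtracted exactly. *)
Lemma degC_div N (q : Rx) x : q != 0 -> degC ((msize q).-1 + N) x ->
  inC (x / ev q%:P) -> degC N (x / ev q%:P).
Proof.
move=> q0 /degC_reduced[p [wp sp ->]] /degC_exists[M /degC_reduced[c [_ sc ec]]].
exists c => //; have evq0 : ev q%:P != 0.
  by apply: contra_neq q0 => /ev_injC.
have ep : p = q%:P * c.
  apply/eqP; rewrite -subr_eq0; apply/eqP/ev_inj_small; last first.
    by rewrite rmorphB rmorphM -ec mulrC divfK // subrr.
  apply: leq_ltn_trans (size_polyD _ _) _; rewrite size_polyN gtn_max sp /=.
  by rewrite mul_polyC; apply: leq_ltn_trans (size_scale_leq _ _) sc.
move=> i; have [->|ci0] := eqVneq c`_i 0; first by left.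
right; have := wp i; rewrite ep coefCM => -[/eqP|].
  by rewrite mulf_eq0 (negbTE q0) (negbTE ci0).
rewrite (msizeM q0 ci0); move: q0 ci0; rewrite -!msize_poly_eq0.
by move: (msize _) (msize _) (w * i)%N => x1 x2 x3; clear; lia.
Qed.

Definition kappa : {rmorphism k -> K} := ev \o polyC \o @mpolyC d k.
Local Notation y l := (ev ('X_l)%:P).
Local Notation th := (ev 'X).

Lemma derivation_ev (g : K -> K) p : derivation_to id g -> (forall c, g (kappa c) = 0) ->
  g (ev p) = \sum_l ev (map_poly (mderiv l) p) * g (y l) + ev p^`() * g th.
Proof.
move=> hg gk; have hm l : derivation_to id (map_poly (mderiv l)) := derivation_map_poly (@mderiv_derivation k d l).
have mC l c := derivation_map_polyC c (@mderiv_derivation k d l).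
have mX l := derivation_map_polyX (@mderiv_derivation k d l).
pose d1 p := g (ev p).
pose d2 p := \sum_l ev (map_poly (mderiv l) p) * g (y l) + ev p^`() * g th.
have h1 : derivation_to ev d1.
  split=> p' q; rewrite /d1; first by rewrite rmorphD (proj1 hg).
  by rewrite rmorphM (proj2 hg).
have h2 : derivation_to ev d2.
  split=> p' q; rewrite /d2.
    rewrite derivD rmorphD mulrDl addrACA -big_split; congr (_ + _).
    by apply: eq_bigr => l _; rewrite (proj1 (hm l)) rmorphD mulrDl.
  rewrite derivM rmorphD !rmorphM !mulrDr !mulrDl !mulr_sumr !mulr_suml.
  rewrite (eq_bigr (fun l => ev p' * (ev (map_poly (mderiv l) q) * g (y l)) +
      ev (map_poly (mderiv l) p') * g (y l) * ev q)).
    by rewrite big_split /=; ring.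
  by move=> l _; rewrite (proj2 (hm l)) rmorphD !rmorphM /=; ring.
apply: (@derivation_ext k K d ev d1 d2 p h1 h2) => [c|i|]; rewrite /d1 /d2.
- rewrite derivC rmorph0 mul0r addr0 -[LHS]/(g (kappa c)) gk big1 // => l _.
  by rewrite mC mderivC !rmorph0 mul0r.
- rewrite derivC rmorph0 mul0r addr0 (bigD1 i) //= mC mderivXU eqxx !rmorph1 mul1r.
  rewrite big1 ?addr0 // => l li.
  by rewrite mC mderivXU (negbTE li) !rmorph0 mul0r.
- rewrite derivX rmorph1 mul1r big1 ?add0r // => l _.
  by rewrite mX rmorph0 mul0r.
Qed.

Lemma derivation_evC (g : K -> K) r : derivation_to id g -> (forall c, g (kappa c) = 0) ->
  g (ev r%:P) = \sum_l ev (r^`M(l))%:P * g (ev ('X_l)%:P).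
Proof.
move=> hg gk; apply: etrans (derivation_ev _ hg gk) _.
rewrite derivC (rmorph0 ev) mul0r addr0.
by apply: eq_bigr => l _; rewrite (derivation_map_polyC _ (@mderiv_derivation k d l)).
Qed.

(** By the chain rule only the values on the finitely many generators matter, so [c] depends on [g]
    alone. *)
Lemma derivation_degC (g : K -> K) : derivation_to id g -> (forall c, g (kappa c) = 0) ->
  (forall l, inC (g (y l))) -> inC (g th) ->
  exists c, forall N x, degC N x -> degC (N + c) (g x).
Proof.
move=> hg gk hy ht.
have [c1 hc1] : exists c, forall l, degC c (g (y l)).
  apply: uniform_bound => [i N M NM|i]; first exact: degC_mono.
  exact: degC_exists.
have [c2 hc2] := degC_exists ht.
exists (maxn c1 c2) => N _ [p wp ->]; rewrite derivation_ev //; apply: degCD.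
  apply: degC_sum => l; apply: degCM; last by apply: degC_mono (hc1 l); exact: leq_maxl.
  by exists (map_poly (mderiv l) p) => //; apply: wle_mderiv.
apply: degCM; last by apply: degC_mono hc2; exact: leq_maxr.
by exists p^`() => //; apply: wle_deriv.
Qed.

(** Implicit differentiation gives [theta] a derivative with denominator [f'(theta)]; multiplying
    the coordinate field by [f'(theta)] makes it preserve [C]. *)
Lemma coordinate_derivation j : exists D : K -> K,
  [/\ derivation_to id D, forall c, D (kappa c) = 0,
      forall l, D (y l) = (l == j)%:R * ev f^`() & inC (D th)].
Proof.
have hm := derivation_map_poly (@mderiv_derivation k d j).
have mC c := derivation_map_polyC c (@mderiv_derivation k d j).
have mX := derivation_map_polyX (@mderiv_derivation k d j).
pose D0 (p : S) : K := ev f^`() * ev (map_poly (mderiv j) p) - ev (map_poly (mderiv j) f) * ev p^`().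
have hD0 : derivation_to ev D0.
  split=> p q; rewrite /D0.
    by rewrite (proj1 hm) derivD !rmorphD; ring.
  by rewrite (proj2 hm) derivM !rmorphD !rmorphM /=; ring.
have [|D [hD eD]] := derivation_extend eff hD0.
  move=> r /evf[c ->]; have ef : ev f = 0 by apply/evf; exists 1; rewrite mul1r.
  rewrite /D0 (proj2 hm) derivM !rmorphD !rmorphM /= ef; ring.
exists D; split=> // [c|l|].
- by rewrite -[kappa c]/(ev (c%:MP)%:P) eD /D0 mC mderivC derivC !rmorph0 !mulr0 subrr.
- rewrite eD /D0 mC mderivXU derivC rmorph0 mulr0 subr0 eq_sym.
  by case: eqP => _; rewrite ?rmorph0 ?rmorph1 mulrC.
- rewrite eD /D0 mX derivX rmorph0 rmorph1 mulr0 mulr1 sub0r; apply: inCN.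
  by exists (map_poly (mderiv j) f).
Qed.

End Frame.

Lemma sum_delta (K : comNzRingType) n (a : 'I_n -> K) l c :
  \sum_i a i * ((i == l)%:R * c) = a l * c.
Proof.
rewrite (bigD1 l) //= eqxx mul1r big1 ?addr0 // => i /negbTE ->.
by rewrite mul0r mulr0.
Qed.

Lemma lie_quotient (K : fieldType) (g : K -> K) n (b nu : 'I_n -> K) (c q F : K) :
  derivation_to id g -> q != 0 -> F != 0 ->
  F * (g (c / q) - \sum_l nu l / F * (b l / q)) =
  (F * g c - F * (c * g q / q) - \sum_l nu l * b l) / q.
Proof.
move=> hg q0 F0; have gq : g c = q * g (c / q) + g q * (c / q).
  by have /= <- := proj2 hg q (c / q); rewrite mulrC divfK.
have -> : \sum_l nu l / F * (b l / q) = (\sum_l nu l * b l) / F / q.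
  by rewrite !mulr_suml; apply: eq_bigr => l _; rewrite mulrACA mulrA.
by rewrite gq; field; rewrite q0 F0.
Qed.

Lemma mulqVK (K : fieldType) (q a : K) : q != 0 -> q * (a / q) = a.
Proof. by move=> q0; rewrite mulrC divfK. Qed.

Lemma mulqKV (K : fieldType) (q a : K) : q != 0 -> q * a / q = a.
Proof. by move=> q0; rewrite mulrC mulKf. Qed.

Lemma conductor_identity (K : fieldType) (v F a b q x : K) : q != 0 ->
  v * F * a * x / q = v * (b * x / q - x * (b - F * a) / q).
Proof. by move=> q0; field. Qed.

Section LieStep.
Variables (k : fieldType) (d w : nat) (K : fieldType).
Local Notation Rx := {mpoly k[d]}.
Local Notation S := {poly Rx}.
Variables (ev : {rmorphism S -> K}) (f : S).
Hypotheses (char0 : [pchar k] =i pred0) (mf : f \is monic).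
Hypothesis wf : wle w (w * (size f).-1) f.
Hypotheses (evf : forall p, ev p = 0 <-> divides f p) (eff : isfrac ev).
Hypothesis F0 : ev f^`() != 0.
Variables (v : S) (g0 : Rx).
Hypotheses (hv : ev v * ev f^`() = ev g0%:P).
Local Notation y l := (ev ('X_l)%:P).
Local Notation th := (ev 'X).
Local Notation F := (ev f^`()).
Local Notation inC := (inC ev).
Local Notation degC := (degC w ev).
Local Notation kappa := (kappa ev).

Definition admissible (g : K -> K) : Prop :=
  [/\ derivation_to id g, forall c, g (kappa c) = 0, forall l, inC (g (y l)) & inC (g th)].

Lemma admissible_inC g x : admissible g -> inC x -> inC (g x).
Proof.
case=> hg gk gy gt /(degC_exists w)[N hN].
have [c hc] := derivation_degC w hg gk gy gt.
exact: degC_inC (hc _ _ hN).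
Qed.

Variable (D : 'I_d -> K -> K).
Hypotheses (hD : forall j, derivation_to id (D j)) (Dk : forall j c, D j (kappa c) = 0).
Hypotheses (Dy : forall j l, D j (y l) = (l == j)%:R * F) (Dt : forall j, inC (D j th)).

Let DC j x : inC x -> inC (D j x).
Proof.
apply: admissible_inC; split=> // l; rewrite Dy; apply: inCM; last by exists f^`().
by exists (l == j)%:R; rewrite rmorph_nat.
Qed.

(* The commutator of [g] and [D j] is [\sum_l structure_coef g j l / F * D l]. *)
Definition structure_coef (g : K -> K) j l : K := g ((l == j)%:R * F) - D j (g (y l)).

Lemma coordinate_ev l (q : Rx) : D l (ev q%:P) = F * ev (q^`M(l))%:P.
Proof.
apply: etrans (derivation_evC _ (hD l) (Dk l)) _.
apply: etrans (eq_bigr _ (fun i _ => congr1 _ (Dy l i))) _.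
exact: etrans (sum_delta _ _ _) (mulrC _ _).
Qed.

Lemma commutator_ev g j (q : Rx) : admissible g ->
  F * (g (D j (ev q%:P)) - D j (g (ev q%:P))) =
  \sum_l structure_coef g j l * D l (ev q%:P).
Proof.
case=> hg gk gy gt; pose X x := g (D j x) - D j (g x).
have hX : derivation_to id X.
  split=> a b; rewrite /X; first by rewrite (proj1 (hD j)) !(proj1 hg) (proj1 (hD j)); ring.
  by rewrite (proj2 (hD j)) !(proj1 hg) !(proj2 hg) (proj1 (hD j)) !(proj2 (hD j)) /=; ring.
have Xk c : X (kappa c) = 0.
  by rewrite /X Dk gk (derivation0 hg) (derivation0 (hD j)) subrr.
have -> : g (D j (ev q%:P)) - D j (g (ev q%:P)) = X (ev q%:P) by [].
have -> : X (ev q%:P) = _ := derivation_evC q hX Xk; rewrite mulr_sumr.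
apply: eq_bigr => l _; rewrite coordinate_ev.
by rewrite /X Dy /structure_coef; ring.
Qed.

(** [N] is chosen before [Q]. Each term of the numerator has degree at most [e] plus a constant, [e]
    being the degree of [q]; the numerator is divisible by [q] by [lie_division], and [degC_div]
    removes [e]. *)
Lemma lie_step g : admissible g -> exists N, forall (Q : set S) (q : Rx) (b : 'I_d -> S),
  rprime Q -> Q f -> (forall r, Q r%:P <-> divides q r) -> prime_elt q -> ~ divides q g0 ->
  (forall p p', Q p -> g (ev p) = ev p' -> Q p') ->
  (forall j, [/\ wle w ((msize q).-1 + w * (size f).-1) (b j), Q (b j - f^`() * (q^`M(j))%:P) &
    forall a, Q a -> exists u v, b j * a = u * q%:P + v * f]) ->
  forall j, degC N (F * (g (ev (b j) / ev q%:P) -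
     \sum_l structure_coef g j l / F * (ev (b l) / ev q%:P))).
Proof.
move=> ag; have [hg gk gy gt] := ag.
have [cg hcg] := derivation_degC w hg gk gy gt.
have Cnu j l : inC (structure_coef g j l).
  apply: inCD; last by apply: inCN; apply: DC.
  apply: (admissible_inC ag); apply: inCM; last by exists f^`().
  by exists (l == j)%:R; rewrite rmorph_nat.
have [cn hcn] : exists c, forall j, forall l, degC c (structure_coef g j l).
  apply: uniform_bound => [i N M NM h l|j]; first exact: degC_mono (h l).
  apply: uniform_bound => [i N M NM|l]; first exact: degC_mono.
  exact: degC_exists.
have [cF hcF] : exists c, degC c F by apply: degC_exists; exists f^`().
set c0 := (w * (size f).-1)%N; exists (c0 + cg + cF + cn)%N.
move=> Q q b hQ Qf hq pq nqg gQ hb j; have [[Q00 QD0 QM0] nQ1 Qpr] := hQ.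
have q0 : q != 0 by case: pq.
have eq0 : ev q%:P != 0 by apply: contra_neq q0 => /(ev_injC evf F0).
set e := (msize q).-1 in hb *.
have QE p p' : Q p' -> ev p = ev p' -> Q p.
  move=> Qp' ep; have /evf[c hc] : ev (p - p') = 0 by rewrite rmorphB ep subrr.
  by rewrite -(subrK p' p); apply: QD0 => //; rewrite hc; apply: QM0.
pose Qs : set K := fun x => exists2 p, Q p & x = ev p.
have QsE p : Qs (ev p) -> Q p by case=> p' Qp' ep; apply: QE Qp' ep.
have evff : ev f = 0 by apply/evf; exists 1; rewrite mul1r.
have divQ j' x : Qs x -> inC (ev (b j') * x / ev q%:P).
  case=> a Qa ->; have [_ _ /(_ a Qa)[u [u' h]]] := hb j'; exists u.
  by rewrite -rmorphM h rmorphD !rmorphM evff mulr0 addr0 mulfK.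
(* Since [v f'] equals [g0] in [K], the choice of [q] not dividing [g0] keeps [f'] outside [Q]. *)
have nQf' : ~ Q f^`().
  move=> h; apply: nqg; apply/hq; apply: (QE _ (v * f^`())); first exact: QM0.
  by rewrite rmorphM hv.
have [i0 hi0] := prime_elt_mderiv char0 pq.
(* Both [b_i0 x] and [x (b_i0 - f' dq/dy_i0)] lie in [q C], hence so does [v] times their
   difference, which is [g0 (dq/dy_i0) x]. As [q] is prime and divides neither factor, it divides
   every coefficient of the reduced representative of [x]. *)
have red x : Qs x -> (forall z, Qs z -> inC (x * z / ev q%:P)) -> inC (x / ev q%:P).
  move=> Qx hx; have [p0 _ ex0] := Qx.
  have [N /(degC_reduced mf wf evf F0)[p [_ sp ex]]] : exists N, degC N x.
    by apply: degC_exists; exists p0.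
  have : inC (ev (g0 * q^`M(i0))%:P * ev p / ev q%:P).
    have -> : ev (g0 * q^`M(i0))%:P * ev p / ev q%:P =
       ev v * (ev (b i0) * x / ev q%:P - x * ev (b i0 - f^`() * (q^`M(i0))%:P) / ev q%:P).
      rewrite polyCM [ev (_ * _)](rmorphM ev) -hv [ev (_ - _)](rmorphB ev).
      rewrite [ev (_ * _)](rmorphM ev) -ex; exact: conductor_identity.
    apply: inCM; first by exists v.
    apply: inCD; first exact: divQ.
    by apply: inCN; apply: hx; exists (b i0 - f^`() * (q^`M(i0))%:P) => //; case: (hb i0).
  move=> /(degC_exists w)[N' /(degC_reduced mf wf evf F0)[c [_ sc ec]]].
  have ep : (g0 * q^`M(i0))%:P * p = q%:P * c.
    apply/eqP; rewrite -subr_eq0; apply/eqP/(ev_inj_small evf F0); last first.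
      rewrite (rmorphB ev) [ev (_ * _)](rmorphM ev) [ev (_ * c)](rmorphM ev) -ec.
      by apply/eqP; rewrite subr_eq0 eq_sym; apply/eqP; exact: mulqVK.
    apply: leq_ltn_trans (size_polyD _ _) _; rewrite size_polyN gtn_max !mul_polyC.
    by rewrite (leq_ltn_trans (size_scale_leq _ _) sp) (leq_ltn_trans (size_scale_leq _ _) sc).
  have /choice[r hr] i : exists r, p`_i = r * q.
    have := congr1 (fun s : S => s`_i) ep; rewrite /= !coefCM => epi.
    case: pq => _ _ pr; have [|/pr[]|] // := pr (g0 * q^`M(i0)) p`_i.
    by exists c`_i; rewrite epi mulrC.
  have [P epP] : exists P, p = q%:P * P.
    exists (\poly_(i < size p) r i); apply/polyP => i; rewrite coefCM coef_poly.
    by case: ltnP => hi; [rewrite hr mulrC|rewrite nth_default // mulr0].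
  by exists P; rewrite ex epP (rmorphM ev); exact: mulqKV.
have Qqp : Q q%:P by apply/hq; exists 1; rewrite mul1r.
have Qq : Qs (ev q%:P) := ex_intro2 _ _ q%:P Qqp erefl.
have gQs x : Qs x -> Qs (g x).
  case=> p Qp ->; have [p' ep'] := admissible_inC ag (ex_intro _ p erefl : inC (ev p)).
  by exists p' => //; apply: gQ Qp ep'.
have DQ l : D l (ev q%:P) = ev (f^`() * (q^`M(l))%:P).
  by rewrite coordinate_ev rmorphM.
have Cev p : inC (ev p) by exists p.
have Z : inC ((F * g (ev (b j)) - F * (ev (b j) * g (ev q%:P) / ev q%:P) -
    \sum_l structure_coef g j l * ev (b l)) / ev q%:P).
  apply: (@lie_division K inC Qs _ _ _ _ _ _ _ _ (ev q%:P) d g D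
    (fun l => ev (b l)) eq0 Qq red hg _ gQs hD DC (fun l => Cev (b l)) _ divQ _
    F (structure_coef g) (Cev _) Cnu _).
  - exact: inCD.
  - exact: inCN.
  - exact: inCM.
  - by move=> x [p _ ->].
  - by move=> x x' [p Qp ->] [p' Qp' ->]; exists (p + p'); [exact: QD0|rewrite rmorphD].
  - by move=> x x' [p ->] [p' Qp' ->]; exists (p * p'); [exact: QM0|rewrite rmorphM].
  - move=> x x' [p ->] [p' ->]; rewrite -rmorphM => /QsE/Qpr[h|h]; [left|right];
      by [exists p|exists p'].
  - exact: inC1.
  - by move=> x; apply: admissible_inC.
  - move=> l; rewrite DQ -rmorphB; exists (b l - f^`() * (q^`M(l))%:P) => //.
    by case: (hb l).
  - exists i0 => /QsE h; case: (hb i0) => _ h2 _.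
    have : Q (f^`() * (q^`M(i0))%:P).
      have := QD0 _ _ h (QM0 (-1) _ h2).
      by rewrite [X in Q X](_ : _ = f^`() * (q^`M(i0))%:P) //; ring.
    by case/Qpr => // /hq.
  - by move=> l; apply: commutator_ev.
have -> : F * (g (ev (b j) / ev q%:P) - \sum_l structure_coef g j l / F * (ev (b l) / ev q%:P)) =
   (F * g (ev (b j)) - F * (ev (b j) * g (ev q%:P) / ev q%:P) -
    \sum_l structure_coef g j l * ev (b l)) / ev q%:P.
  exact: lie_quotient.
apply: (degC_div mf wf evf F0) => //; rewrite -/e.
have hbd l : degC (e + c0) (ev (b l)) by case: (hb l) => h _ _; exists (b l).
have wq : wle w e q%:P by apply: wleC; exact: leqSpred.
have hqd : degC e (ev q%:P) := ex_intro2 _ _ q%:P wq erefl.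
(* The numerator carries the degree [e] twice, from [b j] and from [q]; the division takes one of
   them away. *)
have hr : degC (e + c0 + cg) (ev (b j) * g (ev q%:P) / ev q%:P).
  apply: (degC_div mf wf evf F0 q0 _ (divQ j _ (gQs _ Qq))); rewrite -/e.
  apply: (degC_mono _ (degCM (hbd j) (hcg _ _ hqd))); clear; lia.
apply: degCD; last first.
  apply: degCN; apply: degC_sum => l.
  apply: (@degC_mono _ _ _ _ _ (cn + (e + c0))); first by clear; lia.
  exact: degCM.
apply: degCD; last apply: degCN.
  apply: (@degC_mono _ _ _ _ _ (cF + (e + c0 + cg))); first by clear; lia.
  by apply: degCM => //; apply: hcg.
apply: (@degC_mono _ _ _ _ _ (cF + (e + c0 + cg))); first by clear; lia.
exact: degCM.
Qed.
End LieStep.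

(** * Constant relations *)

Lemma left_kernel (F : fieldType) (m : nat) (J : finType) (A : 'I_m -> J -> F) :
  (#|J| < m)%N -> exists u : 'I_m -> F, (exists i, u i != 0) /\
  forall j, \sum_i u i * A i j = 0.
Proof.
move=> lt; pose B := \matrix_(i < m, j < #|J|) A i (enum_val j).
have : kermx B != 0.
  by rewrite -mxrank_eq0 mxrank_ker -lt0n subn_gt0 (leq_ltn_trans (rank_leq_col _) lt).
case/rowV0Pn => u /sub_kermxP hu u0; exists (fun i => u ord0 i); split.
  apply: contrapT => h; case/eqP: u0; apply/rowP => i; rewrite mxE.
  by apply/eqP; apply: contraT => ui; case: h; exists i.
move=> j; have := congr1 (fun M : 'rV_#|J| => M ord0 (enum_rank j)) hu.
rewrite [RHS]mxE mxE => h; rewrite -[RHS]h; apply: eq_bigr => i _.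
by rewrite mxE enum_rankK.
Qed.

Lemma derivation_const_sum (K : fieldType) (g : K -> K) n (a w : 'I_n -> K) :
  derivation_to id g ->
  g (\sum_i a i * w i) = \sum_i g (a i) * w i + \sum_i a i * g (w i).
Proof.
move=> hg; rewrite (derivation_sum _ _ _ hg) -big_split; apply: eq_bigr => i _ /=.
by rewrite (proj2 hg) /= addrC.
Qed.

Section ConstantRelations.
Variables (k K : fieldType) (kappa : {rmorphism k -> K}) (r d : nat).
Variables (g : 'I_r -> K -> K) (M : 'I_r -> 'I_d -> 'I_d -> K).
Hypotheses (hg : forall i, derivation_to id (g i)) (gk : forall i c, g i (kappa c) = 0).

(* The Lie derivative along [g i] of a one-form, in a frame with structure functions [M i]. *)
Definition lie i (w : 'I_d -> K) (j : 'I_d) : K := g i (w j) - \sum_l M i j l * w l.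

Lemma lie_sum i n (a : 'I_n -> K) (w : 'I_n -> 'I_d -> K) j :
  lie i (fun j => \sum_s a s * w s j) j =
  \sum_s g i (a s) * w s j + \sum_s a s * lie i (w s) j.
Proof.
rewrite /lie (derivation_const_sum _ _ (hg i)) -addrA; congr (_ + _).
have -> : \sum_l M i j l * (\sum_s a s * w s l) = \sum_s a s * \sum_l M i j l * w s l.
  under eq_bigr do rewrite mulr_sumr; rewrite exchange_big; apply: eq_bigr => s _.
  by rewrite mulr_sumr; apply: eq_bigr => l _; rewrite mulrCA.
by rewrite -sumrB; apply: eq_bigr => s _; rewrite mulrBr.
Qed.

(* A relation of minimal support, normalised to have a coefficient 1, is killed by every
   [g i]: differentiating it gives a relation of smaller support. *)
Lemma constant_relation n (w : 'I_n -> 'I_d -> K) (a : 'I_n -> K) :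
  (forall i s j, lie i (w s) j = 0) -> (exists s, a s != 0) ->
  (forall j, \sum_s a s * w s j = 0) ->
  exists b : 'I_n -> K, [/\ exists s, b s != 0, forall i s, g i (b s) = 0 &
    forall j, \sum_s b s * w s j = 0].
Proof.
move=> hw; have [m] := ubnP #|[pred s | a s != 0]|.
elim: m a => // m IH a; rewrite ltnS => le [s0 hs0] ha.
pose a' s := a s / a s0.
have ha' j : \sum_s a' s * w s j = 0.
  rewrite (eq_bigr (fun s => (a s0)^-1 * (a s * w s j))).
    by rewrite -mulr_sumr ha mulr0.
  by move=> s _; rewrite /a' mulrAC mulrC.
have [hc|] := pselect (forall i s, g i (a' s) = 0).
  by exists a'; split=> //; exists s0; rewrite /a' mulfV // oner_neq0.
move=> /existsNP[i /existsNP[s1 /eqP hs1]].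
apply: (IH (fun s => g i (a' s))) => [||j].
- apply: leq_trans le; apply: proper_card; apply/properP; split.
    apply/fintype.subsetP => s; rewrite !inE; apply: contraNneq => as0.
    by rewrite /a' as0 mul0r (derivation0 (hg i)).
  exists s0; rewrite !inE // /a' mulfV // (derivation1 (f := idfun) (hg i)).
  by rewrite eqxx.
- by exists s1.
have := lie_sum i a' w j; rewrite [X in _ + X]big1 => [|s _]; last by rewrite hw mulr0.
rewrite addr0 => <-; rewrite /lie ha' (derivation0 (hg i)) sub0r big1 ?oppr0 // => l _.
by rewrite ha' mulr0.
Qed.

Variables (F : K) (T : finType) (v : T -> K) (W : nat -> 'I_d -> K).
Hypothesis F0 : F != 0.
Hypothesis hW : forall s i j, exists c : T -> k,
  F * lie i (W s) j = \sum_t kappa (c t) * v t.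

(** The forms are cut into [d + 1] blocks. Each block has a nontrivial [k]-combination with
    vanishing Lie derivatives, and [d + 1] vectors of [K^d] are dependent; [constant_relation] then
    makes the coefficients constants. *)
Theorem constant_relation_exists : exists (J : finType) (e : J -> nat) (b : J -> K),
  [/\ injective e, exists s, b s != 0, forall i s, g i (b s) = 0 &
    forall j, \sum_s b s * W (e s) j = 0].
Proof.
(* [X] indexes the [k]-linear conditions on a block: a field, a component and a spanning vector. A
   block needs one form more than that. *)
pose X : finType := ('I_r * 'I_d * T)%type; pose m := #|X|.+1.
have /choice[c hc] (x : nat * 'I_r * 'I_d) : exists c : T -> k,
  F * lie x.1.2 (W x.1.1) x.2 = \sum_t kappa (c t) * v t by exact: hW.
have /choice[u hu] (s : nat) : exists u : 'I_m -> k, (exists i, u i != 0) /\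
    forall x : X, \sum_i u i * c ((s * m + i)%N, x.1.1, x.1.2) x.2 = 0.
  exact: (@left_kernel k m X (fun i x => c ((s * m + i)%N, x.1.1, x.1.2) x.2)).
pose om (s : 'I_d.+1) j := \sum_(i < m) kappa (u s i) * W (s * m + i)%N j.
have hom i s j : lie i (om s) j = 0.
  apply: (mulfI F0); rewrite mulr0 lie_sum [X in X + _]big1 => [|l _]; last by rewrite gk mul0r.
  rewrite add0r mulr_sumr.
  rewrite (eq_bigr (fun l : 'I_m => \sum_t kappa (u s l * c ((s * m + l)%N, i, j) t) * v t)).
    rewrite exchange_big big1 // => t _; rewrite -mulr_suml -rmorph_sum.
    by have /= -> := proj2 (hu s) (i, j, t); rewrite rmorph0 mul0r.
  move=> l _; rewrite mulrCA (hc ((s * m + l)%N, i, j)) mulr_sumr.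
  by apply: eq_bigr => t _; rewrite rmorphM mulrA.
have [|a [a0 ha]] := @left_kernel K d.+1 'I_d om; first by rewrite card_ord.
have [b [[s0 b0] gb hb]] := constant_relation hom a0 ha.
(* Division with remainder by [m] makes [s * m + i] injective, so distinct pairs refer to distinct
   forms. *)
exists ('I_d.+1 * 'I_m)%type, (fun x : 'I_d.+1 * 'I_m => (x.1 * m + x.2)%N), (fun x => b x.1 * kappa (u x.1 x.2)).
split.
- move=> [s i] [s' i'] /= e.
  have es : s = s'.
    apply/val_inj; have := congr1 (fun x => x %/ m)%N e.
    by rewrite !divnMDl // !divn_small ?addn0 ?ltn_ord.
  by rewrite -es in e *; congr (_, _); apply/val_inj; apply: addnI e.
- have [[i ui] _] := hu s0; exists (s0, i); rewrite mulf_neq0 //=.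
  by rewrite fmorph_eq0.
- by move=> i [s l] /=; rewrite (proj2 (hg i)) gk gb mulr0 mul0r addr0.
- move=> j; rewrite -[RHS](hb j) (eq_bigr (fun x : 'I_d.+1 * 'I_m =>
     b x.1 * (kappa (u x.1 x.2) * W (x.1 * m + x.2)%N j))) => [|x _]; last by rewrite mulrA.
  rewrite -(pair_bigA _ (fun s i => b s * (kappa (u s i) * W (s * m + i)%N j))) /=.
  by apply: eq_bigr => s _; rewrite mulr_sumr.
Qed.
End ConstantRelations.

(** * Rationality implies finitely many successors *)

Lemma common_denominator (R : idomainType) (E : fieldType) (i : {rmorphism R -> E}) (q : {poly E}) :
  isfrac i -> exists r p, i r != 0 /\ (i r)%:P * q = map_poly i p.
Proof.
move=> fi; elim/poly_ind: q => [|q c [r [p [r0 e]]]].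
  by exists 1, 0; rewrite rmorph1 oner_neq0 mulr0 rmorph0.
have [a [b [b0 ->]]] := fi c; exists (r * b), (b%:P * p * 'X + (r * a)%:P).
split; first by rewrite rmorphM mulf_neq0.
have -> : (i (r * b))%:P * (q * 'X + (i a / i b)%:P) =
    (i b)%:P * ((i r)%:P * q) * 'X + (i (r * a))%:P.
  have -> : i (r * a) = i (r * b) * (i a / i b) by rewrite !rmorphM; field.
  by rewrite (rmorphM i) !polyCM; ring.
by rewrite e rmorphD !rmorphM /= !map_polyC map_polyX /= ?polyCM.
Qed.

Section AffineFrame.
Variables (k : fieldType) (A : comAlgType k) (P : set A) (n : nat) (y : 'I_n -> A).
Hypotheses (char0 : [pchar k] =i pred0) (hfg : finitely_generated A) (hP : rprime P).
Hypotheses (hi : independent_mod y P) (hn : normalizes y P).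
Variables (K : fieldType) (f : {rmorphism A -> K}).
Hypotheses (f0 : forall a, f a = 0 <-> P a) (ff : isfrac f).
Local Notation Rx := {mpoly k[n]}.

Definition evt (t : A) : {rmorphism {poly Rx} -> A} := horner_eval t \o map_poly (evm y).

Lemma evtC t c : evt t c%:P = evm y c.
Proof. by rewrite [LHS]/= map_polyC /horner_eval hornerC. Qed.

Lemma evtE t p : f (evt t p) = (map_poly (f \o evm y) p).[f t].
Proof. by rewrite map_poly_comp horner_map. Qed.

(** The primitive element theorem combines two elements as [a *+ m - t] with [m] a natural number,
    so the generator remains the image of an element of [A]. *)
Lemma primitive_generator : exists t, forall a, exists p r, r != 0 /\
  f a * f (evm y r) = f (evt t p).
Proof.
have ginj := independent_inj f0 hi.
have [E [i [h [iinj fi hg]]]] := fraction_embed ginj.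
pose gen t x := exists q, (map_poly h q).[f t] = x.
have emap q : map_poly (h \o i) q = map_poly (f \o evm y) q.
  by apply: eq_map_poly => c; exact: hg.
have alg a : exists2 q : {poly E}, q != 0 & root (map_poly h q) (f a).
  have [q mq rq] := (integral_modE y a f0).1 (hn a).
  exists (map_poly i q); first by rewrite monic_neq0 // monic_map.
  by rewrite -map_poly_comp emap.
have k2 : [pchar E] =i pred0 by move=> p; rewrite (fmorph_pchar (i \o @mpolyC n k)) char0.
case: hfg => s hs.
have [t ht] : exists t, forall a, a \in s -> gen t (f a).
  clear hs; elim: s => [|a s [t ht]]; first by exists 0.
  have [q q0 rq] := alg a; have [q' q0' rq'] := alg t.
  have [m [[u hu] [u' hu']]] := pchar0_PET q0' rq' q0 rq k2.
  exists (a *+ m - t) => b; rewrite inE => /orP[/eqP->|/ht[u2 <-]].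
    by exists u'; rewrite -hu' rmorphB rmorphMn.
  exists (u2 \Po u); rewrite map_comp_poly horner_comp -hu.
  by rewrite rmorphB rmorphMn.
pose B : set A := fun a => gen t (f a).
have Bt : B = setT.
  suff hB : subalgebra B by exact: (hs B hB ht).
  split; first by exists 1; rewrite [RHS]rmorph1 [X in X.[_]]rmorph1 hornerC.
  split; first by move=> a b [q e1] [q' e2]; exists (q + q'); rewrite !rmorphD hornerD e1 e2.
  split; first by move=> a b [q e1] [q' e2]; exists (q * q'); rewrite !rmorphM hornerM e1 e2.
  move=> c a [q e1]; exists ((i c%:MP)%:P * q); rewrite rmorphM /= map_polyC hornerM hornerC /= e1.
  have -> : h (i c%:MP) = f c%:A by rewrite hg /= evmC.
  by rewrite -rmorphM mulr_algl.
have genA a : B a by rewrite Bt.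
exists t => a; have [q hq] := genA a.
have [r [p [r0 e]]] := common_denominator q fi.
exists p, r; split; first by apply: contraNneq r0 => ->; rewrite rmorph0.
have -> : f (evm y r) = h (i r) by rewrite hg.
rewrite evtE -emap.
by rewrite map_poly_comp -e rmorphM /= map_polyC hornerM hornerC hq mulrC.
Qed.

Lemma affine_frame : exists (t : A) (m : {poly Rx}) (w : nat),
  [/\ m \is monic, wle w (w * (size m).-1) m, forall p, f (evt t p) = 0 <-> divides m p,
    f (evt t m^`()) != 0 & forall a, exists p r, r != 0 /\ f a * f (evm y r) = f (evt t p)].
Proof.
have [t ht] := primitive_generator.
have ginj := independent_inj f0 hi.
have [|m [mm rm dm]] := @minpoly_integral _ _ (f \o evm y) (f t) (@int_closed_mpoly k n) ginj.
  exact/(integral_modE _ _ f0).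
have hm p : f (evt t p) = 0 <-> divides m p.
  rewrite evtE; split=> [h|[c ->]]; first by apply: dm; rewrite /root h.
  by rewrite rmorphM hornerM (rootP rm) mulr0.
(* The weight of [theta] exceeds the degree of every coefficient, so no term of [m] is heavier than
   the leading one. *)
exists t, m, (\max_(i < size m) msize (m`_i)%R)%N; set w := (\max_(i < _) _)%N.
have sm : (1 < size m)%N.
  rewrite ltnNge; apply/negP => h; have em := size1_polyC h.
  have c1 : m`_0 = 1 by have := monicP mm; rewrite {1}em lead_coefC.
  have m1 : m = 1 by rewrite em c1.
  by have /eqP := (hm m).2 (ex_intro _ 1 (esym (mul1r _))); rewrite m1 !rmorph1 oner_eq0.
split=> //.
- move=> i; have [si|si] := ltnP i (size m); last by left; rewrite nth_default.
  right; have [ei|ni] := eqVneq i (size m).-1.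
    by rewrite ei -lead_coefE (monicP mm) msize1 add1n.
  have hw : (msize (m`_i)%R <= w)%N := leq_bigmax (Ordinal si).
  apply: leqW; apply: leq_trans (leq_add hw (leqnn _)) _; rewrite -mulnS leq_mul2l.
  by apply/orP; right; move: ni si; move: (size m) => a; clear; lia.
- apply/eqP => /hm[c hc]; have m'0 : m^`() = 0.
    apply: (@size_multiple _ _ _ _ (size m).-1 hc); first by rewrite prednK // ltnW.
    apply/leq_sizeP => j hj; rewrite coef_deriv nth_default ?mul0rn //.
    by move: hj sm; move: (size m) => a; clear; lia.
  have := congr1 (fun p : {poly Rx} => p`_(size m).-2) m'0.
  rewrite coef_deriv coef0; have -> : (size m).-2.+1 = (size m).-1 by move: sm; case: (size m) => [|[]].
  rewrite -lead_coefE (monicP mm) => /eqP; rewrite -mulr_natr mul1r -mpolyC_nat mpolyC_eq0.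
  by have /pcharf0P -> := char0; move: sm; case: (size m) => [|[]].
Qed.
End AffineFrame.

Lemma mulqVKr (K : fieldType) (a b c : K) : b != 0 -> a * c = b * c * (a / b).
Proof. by move=> b0; field. Qed.

Lemma left_kernel_domain (R : idomainType) (m n : nat) (A : 'I_m -> 'I_n -> R) :
  (n < m)%N -> exists u : 'I_m -> R, (exists i, u i != 0) /\
  forall j, \sum_i u i * A i j = 0.
Proof.
move=> lt; have [|u [[i0 ui0] hu]] := @left_kernel {fraction R} m 'I_n (fun i j => tofrac (A i j)).
  by rewrite card_ord.
have /choice[a ha] i : exists a : R * R, a.2 != 0 /\ u i = tofrac a.1 / tofrac a.2.
  have [x [y [y0 e]]] := isfrac_tofrac (u i); exists (x, y); split=> //=.
  by apply: contraNneq y0 => ->; rewrite tofrac0.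
pose c i := (a i).1 * \prod_(l | l != i) (a l).2.
pose D := \prod_l (a l).2.
have D0 : D != 0 by apply/prodf_neq0 => l _; case: (ha l).
have ec i : tofrac (c i) = tofrac D * u i.
  have [ai0 ->] := ha i; rewrite /c /D [in RHS](bigD1 i) //=.
  rewrite (rmorphM (@tofrac R)) [in RHS](rmorphM (@tofrac R)) /=.
  have : tofrac (a i).2 != 0 by rewrite tofrac_eq0.
  exact: mulqVKr.
exists c; split.
  exists i0; rewrite -tofrac_eq0 ec mulf_neq0 // tofrac_eq0 //.
move=> j; apply/eqP; rewrite -tofrac_eq0 (rmorph_sum (@tofrac R)).
rewrite (eq_bigr (fun i => tofrac D * (u i * tofrac (A i j)))) => [|i _].
  by rewrite -mulr_sumr hu mulr0.
by rewrite (rmorphM (@tofrac R)) /= ec mulrA.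
Qed.

Lemma prime_elt_msize (k : fieldType) n (q : {mpoly k[n]}) : prime_elt q -> (1 < msize q)%N.
Proof.
move=> [q0 qu _]; rewrite ltnNge; apply/negP => h1; have ep := msize1_polyC h1.
case/negP: qu; rewrite ep rmorph_unit // unitfE.
by apply: contraNneq q0 => c0; rewrite ep c0 mpolyC0.
Qed.

Lemma remove_common_power (k : fieldType) n (q : {mpoly k[n]}) m (c : 'I_m -> {mpoly k[n]}) :
  prime_elt q -> (exists i, c i != 0) -> exists e (c' : 'I_m -> {mpoly k[n]}),
  (forall i, c i = q ^+ e * c' i) /\ exists i, ~ divides q (c' i).
Proof.
move=> hq [i0]; have [N] := ubnP (msize (c i0)); elim: N c => // N IH c.
rewrite ltnS => le ci0.
have [hc|] := pselect (forall i, divides q (c i)); last first.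
  by move=> /existsNP[i hi]; exists 0%N, c; split=> [j|]; [rewrite mul1r|exists i].
have /choice[c1 hc1] i : exists a, c i = a * q by exact: hc.
have c10 : c1 i0 != 0 by apply: contraNneq ci0 => h; rewrite hc1 h mul0r.
have [|e [c' [h1 h2]]] := IH c1 _ c10.
  apply: leq_trans le; rewrite hc1 (msizeM c10); last by case: hq.
  have := prime_elt_msize hq; move: c10; rewrite -msize_poly_eq0.
  by move: (msize (c1 i0)) (msize q) => a b; clear; lia.
by exists e.+1, c'; split=> // i; rewrite hc1 h1 exprSr; ring.
Qed.

Section Fibres.
Variables (k : fieldType) (A : comAlgType k) (P : set A) (n : nat) (y : 'I_n -> A).
Hypotheses (char0 : [pchar k] =i pred0) (hfg : finitely_generated A) (hP : rprime P).
Hypotheses (hi : independent_mod y P) (hn : normalizes y P).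

(** Given too many primes over [(q)], pick for each an element outside it and inside the others.
    These elements are linearly dependent over the polynomial ring; once powers of [q] are
    cancelled, some coefficient is not divisible by [q], which forces its element into its own
    prime. *)
Lemma fibre_finite (q : {mpoly k[n]}) : prime_elt q ->
  finite_set [set Q : set A | [/\ rprime Q, P `<=` Q & forall r, Q (evm y r) <-> divides q r]].
Proof.
move=> hq; apply: contrapT => /infinite_injection[u [uinj hu]].
have [K [f [f0 ff]]] := residue_field hP.
have [t [m [w [mm wm evm0 F0 ht]]]] := affine_frame char0 hfg hi hn f0.
pose ev : {rmorphism {poly {mpoly k[n]}} -> K} := f \o evt y t.
have evm1 p : ev p = 0 <-> divides m p by exact: evm0.
have F1 : ev m^`() != 0 := F0.
pose N := size m.
have hQ i := hu i.
have /choice[z hz] (ij : nat * nat) : exists z, ij.1 != ij.2 -> u ij.2 z /\ ~ u ij.1 z.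
  have [e|ne] := eqVneq ij.1 ij.2; first by exists 0.
  have [hQ1 sP1 e1] := hQ ij.1; have [hQ2 sP2 e2] := hQ ij.2.
  apply: contrapT => h; case/eqP: ne; apply: uinj.
  have s21 : u ij.2 `<=` u ij.1.
    by move=> x hx; apply: contrapT => nx; apply: h; exists x.
  apply/seteqP; split=> //.
  apply: (incomparable hQ2 hQ1 s21 (y := y)) => [a|r].
    exact: integral_mod_sub sP2 (hn a).
  by move=> /e1 h1; apply/e2.
pose x (i : 'I_N.+1) := \prod_(j <- [seq j <- enum 'I_N.+1 | j != i]) z (val i, val j).
have x_notin (i : 'I_N.+1) : ~ u i (x i).
  have [hQi _ _] := hQ i; move=> /(rprime_prod hQi)[j]; rewrite mem_filter => /andP[ji _].
  by have [|_] := hz (val i, val j) => //=; rewrite eq_sym.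
have x_in (i j : 'I_N.+1) : j != i -> u j (x i).
  move=> ji; have [[[_ _ hM] _ _] _ _] := hQ j.
  have js : j \in [seq j <- enum 'I_N.+1 | j != i] by rewrite mem_filter ji mem_enum.
  rewrite /x (bigD1_seq j js) /=; last by rewrite filter_uniq // enum_uniq.
  by rewrite mulrC; apply: hM; have [|h _] := hz (val i, val j); rewrite //= eq_sym.
have /choice[pr hpr] (i : 'I_N.+1) : exists pr : {poly {mpoly k[n]}} * {mpoly k[n]},
    [/\ pr.2 != 0, (size pr.1 < size m)%N & f (x i) * f (evm y pr.2) = ev pr.1].
  have [p [r [r0 e]]] := ht (x i).
  have [M hM] : exists M, degC w ev M (ev p) by apply: degC_exists; exists p.
  have [p' [_ sp' ep']] := degC_reduced mm wm evm1 F1 hM.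
  by exists (p', r); split=> //; exact: etrans e ep'.
have [c [c0 hc]] := left_kernel_domain (fun i j => (pr i).1`_j) (ltnSn N).
pose c2 i := c i * (pr i).2.
have hc2 : \sum_i f (evm y (c2 i)) * f (x i) = 0.
  have -> : \sum_i f (evm y (c2 i)) * f (x i) = ev (\sum_i (c i)%:P * (pr i).1).
    rewrite (rmorph_sum ev); apply: eq_bigr => i _; have [_ _ e] := hpr i.
    rewrite (rmorphM ev) -e /c2 rmorphM rmorphM -[ev _]/(f (evt y t _)) evtC.
    by rewrite -mulrA [f (evm y (pr i).2) * _]mulrC.
  suff -> : \sum_i (c i)%:P * (pr i).1 = 0 by rewrite rmorph0.
  apply/polyP => j; rewrite coef0 coef_sum.
  have [lt|ge] := ltnP j N.
    by rewrite -[RHS](hc (Ordinal lt)); apply: eq_bigr => i _; rewrite coefCM.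
  rewrite big1 // => i _; have [_ si _] := hpr i.
  by rewrite coefCM nth_default ?mulr0 // (leq_trans (ltnW si)).
have [|e [c' [hc' [i1 hi1]]]] := remove_common_power hq (c := c2).
  by have [i0 ci0] := c0; exists i0; rewrite mulf_neq0 //; case: (hpr i0).
have Pc : P (\sum_i evm y (c' i) * x i).
  apply/f0; have : f (evm y (q ^+ e)) * f (\sum_i evm y (c' i) * x i) = 0.
    have -> : f (\sum_i evm y (c' i) * x i) = \sum_i f (evm y (c' i)) * f (x i).
      apply: etrans (rmorph_sum f _ _ _) _; apply: eq_bigr => i _; exact: rmorphM.
    rewrite -[RHS]hc2 mulr_sumr; apply: eq_bigr => i _.
    by rewrite hc' [evm y (_ * _)]rmorphM [f (_ * _)]rmorphM mulrA.
  have qe0 : f (evm y (q ^+ e)) != 0.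
    have ginj := independent_inj f0 hi.
    rewrite -(rmorph0 (f \o evm y)); apply: contra_neq (_ : q ^+ e != 0) => [/ginj //|].
    by rewrite expf_neq0 //; case: hq.
  by move/eqP; rewrite mulf_eq0 (negbTE qe0) => /eqP.
have [hQ1 sP1 e1] := hQ i1; have [[_ hD hM] _ hpr1] := hQ1.
have : u i1 (evm y (c' i1) * x i1).
  have := sP1 _ Pc; rewrite (bigD1 i1) //= addrC; apply: rideal_add; first by case: hQ1.
  apply: (rideal_sum _ _ _ (p := fun i => i != i1)); first by case: hQ1.
  by move=> i ii; apply: (hM); apply: x_in; rewrite eq_sym.
case/hpr1 => [/e1 //|]; exact: x_notin.
Qed.
End Fibres.

Section Successors.
Variables (k : fieldType) (A : comAlgType k) (br : A -> A -> A).
Hypotheses (char0 : [pchar k] =i pred0) (hA : affine A) (hbr : poisson_bracket br).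

Lemma prime_chain_extend (P P' Q : set A) h : prime_chain h P -> rprime P' -> rprime Q ->
  P `<` P' -> P' `<` Q -> prime_chain h.+2 Q.
Proof.
case=> f [h1 [h2 h3]] hP' hQ l1 l2.
exists (fun i => if (i <= h)%N then f i else if i == h.+1 then P' else Q); split; last first.
  split; last by rewrite ltnNge leqnSn /= gtn_eqF.
  move=> i hi; have [ih|ih] := leqP i.+1 h; first by rewrite (ltnW ih); exact: h2.
  have [ei|ni] := eqVneq i h; first by rewrite ei leqnn eqxx h3.
  have -> : i = h.+1 by move: ih ni hi; clear; lia.
  by rewrite ltnn eqxx gtn_eqF.
move=> i _; case: ifP => [ih|_]; first exact: h1.
by case: ifP => _; apply/prime_idealE.
Qed.

Variables (P : set A) (n : nat) (y : 'I_n -> A).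
Hypotheses (hP : rprime P) (hi : independent_mod y P) (hn : normalizes y P).

(** Going down gives a prime [P'] inside [Q] exactly over [(q)]. If it were smaller than [Q], a
    chain ending at [P] would extend by two steps to [Q], against the heights. *)
Lemma successor_contraction (Q : set A) : poisson_successors br P Q ->
  [/\ rprime Q, stable (brackets br) Q, P `<=` Q &
    exists2 q, prime_elt q & forall r, Q (evm y r) <-> divides q r].
Proof.
case=> /(poisson_primeE br)[hQ sQ] [sPQ [h [[cP nP] [cQ nQ]]]]; split=> //.
have ltPQ : P `<` Q.
  split=> // sQP; case: nP; have <- // : Q = P.
  by apply/seteqP.
have [r [Qr nPr]] := contraction_neq0 hP hQ ltPQ hn.
have r0 : r != 0.
  apply/eqP => r0; apply: nPr; rewrite r0 [evm y 0](rmorph0 (evm y)); by case: hP => -[].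
have [q hq Qq] := @factorial_mpoly k n _ (rprime_preim (evm y) hQ) r Qr r0.
have [P' [hP' sPP' sP'Q hqP']] := going_down hP hQ sPQ hi hn hq Qq.
exists q => // s; split=> [Qs|/hqP' hs]; last exact: sP'Q.
apply/hqP'; apply: contrapT => nP's; apply: nQ.
apply: (prime_chain_extend cP hP' hQ); split=> //.
  move=> sP'P; have /hi q0 : P (evm y q) by apply: sP'P; apply/hqP'; exists 1; rewrite mul1r.
  by case: hq; rewrite q0 eqxx.
by move=> sQP'; apply: nP's; apply: sQP'.
Qed.

(** Fibres being finite, infinitely many successors have infinitely many contractions. Only finitely
    many of these contain [g], and distinct contractions have non-associated generators. *)
Lemma independent_successors (g : {mpoly k[n]}) : g != 0 ->
  ~ finite_set (poisson_successors br P) ->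
  exists (Q : nat -> set A) (q : nat -> {mpoly k[n]}),
    [/\ forall i, [/\ rprime (Q i), stable (brackets br) (Q i) & P `<=` Q i],
      forall i, prime_elt (q i) /\ ~ divides (q i) g,
      forall i r, Q i (evm y r) <-> divides (q i) r &
      forall i j, divides (q i) (q j) -> i = j].
Proof.
move=> g0 hinf; pose c (Q : set A) : set {mpoly k[n]} := fun r => Q (evm y r).
pose I := c @` poisson_successors br P.
have Iq J : I J -> exists2 q, prime_elt q & J = divides q.
  case=> Q /successor_contraction[_ _ _ [q hq e]] <-; exists q => //.
  by apply/seteqP; split=> r /e.
have Iinf : ~ finite_set I.
  move=> hI; apply: hinf; have : finite_set (\bigcup_(J in I) [set Q | poisson_successors br P Q /\ c Q = J]).
    apply: bigcup_finite => // J /Iq[q hq eJ].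
    apply: sub_finite_set (fibre_finite char0 (proj1 hA) hP hi hn hq).
    move=> Q [/successor_contraction[hQ _ sPQ _] e]; split=> // r.
    by rewrite -[Q _]/(c Q r) e eJ.
  apply: sub_finite_set => Q hQ; exists (c Q) => //; by exists Q.
have [u [s [hu hs eg]]] := factorialP (@factorial_mpoly k n) g0.
have fin_g : finite_set [set J | I J /\ J g].
  apply: (@sub_finite_set _ _ ((fun q : {mpoly k[n]} => divides q : set _) @` [set` s])); last first.
    by apply: finite_image; exact: finite_seq.
  move=> J [/Iq[q hq ->]]; rewrite eg => /(divides_prime hq hs hu)[p ps [v hv ep]].
  exists p => //; have [_ _ _] := hq.
  apply/seteqP; split=> r [a ->]; first by exists (a * v); rewrite ep mulrA.
  by exists (a * v^-1); rewrite ep -mulrA mulKr.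
have [J [Jinj hJ]] : exists J : nat -> set {mpoly k[n]}, injective J /\ forall i, I (J i) /\ ~ J i g.
  apply: (infinite_injection (S := fun J => I J /\ ~ J g)) => hfin; apply: Iinf.
  have : finite_set ((fun J : set {mpoly k[n]} => I J /\ ~ J g) `|` [set J | I J /\ J g]).
    by rewrite finite_setU.
  by apply: sub_finite_set => X IX; have [h|h] := pselect (X g); [right|left].
have /choice[Q hQ] i : exists Q, poisson_successors br P Q /\ c Q = J i.
  by have [[Q h1 h2] _] := hJ i; exists Q.
have /choice[q hq] i : exists q, prime_elt q /\ J i = divides q.
  by have [/Iq[q h1 h2] _] := hJ i; exists q.
have eQ i r : Q i (evm y r) <-> divides (q i) r.
  by have [_ <-] := hq i; have [_ <-] := hQ i.
exists Q, q; split=> //.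
- by move=> i; have [/successor_contraction[]] := hQ i.
- by move=> i; have [h1 h2] := hq i; have [_] := hJ i; rewrite h2.
- move=> i j hij; apply: Jinj; have [h1 ->] := hq i; have [h2 ->] := hq j.
  have [a ea] := hij; have [b eb] := prime_elt_assoc h2 h1 hij.
  apply/seteqP; split=> r [x ->]; first by exists (x * b); rewrite eb mulrA.
  by exists (x * a); rewrite ea mulrA.
Qed.
End Successors.

(** Reduced representatives are combinations of boundedly many monomials in [y] and [theta]. This is
    the finite dimensional space that receives all the Lie derivatives. *)
Lemma degC_basis (k : fieldType) (d w : nat) (K : fieldType)
    (ev : {rmorphism {poly {mpoly k[d]}} -> K}) (f : {poly {mpoly k[d]}}) N :
  f \is monic -> wle w (w * (size f).-1) f -> (forall p, ev p = 0 <-> divides f p) ->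
  ev f^`() != 0 ->
  exists (T : finType) (v : T -> K), forall x, degC w ev N x ->
    exists c : T -> k, x = \sum_t kappa ev (c t) * v t.
Proof.
move=> mf wf evf F0.
exists ('I_(size f) * 'X_{1..d < N.+1})%type,
  (fun t : 'I_(size f) * 'X_{1..d < N.+1} => ev ('X_[t.2])%:P * ev 'X ^+ t.1) => x /(degC_reduced mf wf evf F0)[p [wp sp ->]].
exists (fun t : 'I_(size f) * 'X_{1..d < N.+1} => (p`_t.1)@_(t.2)).
have ep : p = \sum_(i < size f) (p`_i)%:P * 'X^i.
  rewrite -[LHS]coefK poly_def (big_ord_widen (size f) (fun i => p`_i *: 'X^i) (ltnW sp)).
  rewrite big_mkcond; apply: eq_bigr => i _; rewrite mul_polyC.
  by case: ltnP => // h; rewrite nth_default // scale0r.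
rewrite {1}ep (rmorph_sum ev).
rewrite -(pair_bigA _ (fun (i : 'I_(size f)) (m : 'X_{1..d < N.+1}) =>
   kappa ev (p`_i)@_m * (ev ('X_[m])%:P * ev 'X ^+ i))) /=.
apply: eq_bigr => i _; rewrite (rmorphM ev) (rmorphXn ev).
have sp2 : (msize (p`_i)%R <= N.+1)%N.
  have [->|h] := wp i; first by rewrite msize0.
  exact: leq_trans (leq_addr _ _) h.
rewrite {1}(mpolywE sp2) (rmorph_sum (@polyC _)) (rmorph_sum ev) mulr_suml.
apply: eq_bigr => m _; rewrite -mul_mpolyC (rmorphM (@polyC _)) (rmorphM ev) mulrA.
by [].
Qed.

(** An integral equation of [z], multiplied by a power of [q], becomes one for [x] whose lower terms
    are all multiples of [q]; so a power of [x] is in [I]. *)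
Lemma integral_multiple_mem (B : comNzRingType) (K : fieldType) (ev : {rmorphism B -> K})
    (I : set B) x q z :
  rprime I -> (forall b, ev b = 0 -> I b) -> I q -> ev x = ev q * z ->
  integralOver ev z -> I x.
Proof.
move=> hI hk Iq ex [p mp rp].
have [[I0 ID IM] _ _] := hI.
have s0 : (0 < size p)%N by rewrite size_poly_gt0 monic_neq0.
pose D := (size p).-1.
pose b := \sum_(i < size p) p`_i * q ^+ (D - i) * x ^+ i.
have Ib : I b.
  apply: hk; rewrite (rmorph_sum ev).
  rewrite (eq_bigr (fun i : 'I_(size p) => ev q ^+ D * ((map_poly ev p)`_i * z ^+ i))).
    have sz : (size (map_poly ev p) <= size p)%N by apply: size_poly.
    by rewrite -mulr_sumr -(horner_coef_wide z sz) (rootP rp) mulr0.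
  move=> i _; have iD : (i <= D)%N by rewrite -ltnS prednK.
  rewrite !(rmorphM ev) !(rmorphXn ev) ex coef_map exprMn.
  by rewrite -(subnK iD) exprD addnK; ring.
apply: (rprime_exp (n := D) hI).
have eb : b = \sum_(i < D) p`_i * q ^+ (D - i) * x ^+ i + x ^+ D.
  rewrite /b -(prednK s0) big_ord_recr /= -lead_coefE.
  by rewrite (monicP mp) subnn mulr1 mul1r.
have Is : I (\sum_(i < D) p`_i * q ^+ (D - i) * x ^+ i).
  apply: rideal_sum; first by case: hI.
  move=> i _; have -> : (D - i)%N = (D - i).-1.+1 by rewrite prednK // subn_gt0.
  by rewrite exprS [_ * (q * _)]mulrCA -mulrA mulrC; apply: (IM).
by move: Ib; rewrite eb; apply: rideal_add => //; case: hI.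
Qed.

Section Central.
Variables (k : fieldType) (A : comAlgType k) (br : A -> A -> A).
Hypotheses (hbr : poisson_bracket br).
Variables (P : set A) (hP : rprime P).

(** The map sending [x] to [{a, x} b - a {b, x}] is a derivation, so the elements it sends into [P]
    form a subalgebra. Finitely many Hamiltonian fields thus suffice to detect centrality. *)
Lemma central_of_generators (s : seq A) a b :
  (forall B : set A, subalgebra B -> (forall x, x \in s -> B x) -> B = setT) ->
  (forall x, x \in s -> P (br a x * b - a * br b x)) ->
  frac_poisson_central br P (a, b).
Proof.
move=> hs hx; have [[P0 PD PM] _ _] := hP.
pose B : set A := fun x => P (br a x * b - a * br b x).
have brM c u v : br c (u * v) = u * br c v + br c u * v.
  by rewrite br_anti // (proj2 (br_derivation hbr c)) /= !(br_anti hbr _ c); ring.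
have brD c u v : br c (u + v) = br c u + br c v.
  by rewrite br_anti // (proj1 (br_derivation hbr c)) !(br_anti hbr _ c); ring.
have brZr (c : k) u v : br u (c *: v) = c *: br u v.
  by rewrite br_anti // brZ // (br_anti hbr v) scalerN opprK.
have hB : B = setT.
  apply: (hs B _ hx); split; first by rewrite /B !br1 // mul0r mulr0 subrr.
  split=> [u v hu hv|].
    rewrite /B [X in P X](_ : _ = (br a u * b - a * br b u) + (br a v * b - a * br b v)).
      exact: PD.
    by rewrite !brD; ring.
  split=> [u v hu hv|c u hu].
    rewrite /B [X in P X](_ : _ = u * (br a v * b - a * br b v) + v * (br a u * b - a * br b u)).
      by apply: PD; apply: PM.
    by rewrite !brM; ring.
  rewrite /B [X in P X](_ : _ = (c%:A) * (br a u * b - a * br b u)); first exact: PM.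
  by rewrite !brZr mulr_algl scalerBr -scalerAl -scalerAr.
move=> [c d] _; rewrite /frac_zero /fbracket /=.
have hBx x : B x by rewrite hB.
rewrite [X in P X](_ : _ = d * (br a c * b - a * br b c) - c * (br a d * b - a * br b d)).
  by apply: rideal_sub; [case: hP|apply: (PM); exact: hBx|apply: (PM); exact: hBx].
ring.
Qed.
End Central.

Lemma common_multiplier (k : fieldType) d (E : eqType) (K : fieldType)
    (f : E -> K) (ev : {rmorphism {poly {mpoly k[d]}} -> K}) (s : seq E) :
  (forall a, exists p r, r != 0 /\ f a * ev r%:P = ev p) ->
  exists2 G, G != 0 & forall x, x \in s -> inC ev (f x * ev G%:P).
Proof.
move=> h; elim: s => [|a s [G G0 hG]]; first by exists 1; rewrite ?oner_neq0.
have [p [r [r0 e]]] := h a; exists (r * G); first exact: mulf_neq0.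
have eG : ev (r * G)%:P = ev r%:P * ev G%:P by rewrite polyCM rmorphM.
move=> x; rewrite inE eG => /orP[/eqP->|/hG hx].
  by exists (p * G%:P); rewrite mulrA e (rmorphM ev).
rewrite mulrCA; apply: inCM => //; by exists r%:P.
Qed.

(* Looking at the pole along [Q s0], a relation between the [beta s / q s] with integral
   coefficients forces [beta s0] into [Q s0]. *)
Lemma relation_pole (B : comNzRingType) (K : fieldType) (ev : {rmorphism B -> K})
    (J : finType) (beta q : J -> B) (c : J -> K) (s0 : J) (I : set B) :
  rprime I -> (forall x, ev x = 0 -> I x) -> (forall s, ev (q s) != 0) -> I (q s0) ->
  (forall s, s != s0 -> ~ I (q s)) -> c s0 != 0 ->
  (forall s, integralOver ev (c s / c s0)) ->
  \sum_s c s * (ev (beta s) / ev (q s)) = 0 -> I (beta s0).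
Proof.
move=> hI hk hq Iq nIq c0 hc hsum.
pose Pi (A : pred J) := \prod_(l | A l) q l.
pose z := - \sum_(s | s != s0) c s / c s0 * ev (beta s * Pi (fun l => (l != s0) && (l != s))).
have : I (beta s0 * Pi (fun l => l != s0)).
  apply: (@integral_multiple_mem _ _ ev I _ (q s0) z hI hk Iq).
    have e s : s != s0 -> c s / c s0 * ev (beta s * Pi (fun l => (l != s0) && (l != s))) =
        c s * (ev (beta s) / ev (q s)) * (ev (Pi (fun l => l != s0)) / c s0).
      move=> ss0; have -> : Pi (fun l => l != s0) = q s * Pi (fun l => (l != s0) && (l != s)).
        by rewrite /Pi (bigD1 s).
      by rewrite !(rmorphM ev); move: (hq s) => qs0; field; rewrite qs0 c0.
    have hs : \sum_(s | s != s0) c s * (ev (beta s) / ev (q s)) = - (c s0 * (ev (beta s0) / ev (q s0))).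
      by apply/eqP; rewrite -addr_eq0 addrC; apply/eqP; rewrite -[RHS]hsum [RHS](bigD1 s0).
    rewrite /z (eq_bigr _ e) -mulr_suml hs (rmorphM ev).
    by move: (hq s0) => qs0; field; rewrite qs0 c0.
  apply: integral_opp; apply: (big_ind (integralOver ev)) => [||s _].
  - exact: integral0.
  - by move=> x x'; apply: integral_add.
  - by apply: integral_mul => //; apply: integral_id.
have [_ _ hpr] := hI; case/hpr => // h; exfalso.
move: h; rewrite /Pi -big_filter => /(rprime_prod hI)[l]; rewrite mem_filter => /andP[ls _].
exact: nIq.
Qed.

Lemma isfrac_cofinal (A B : comNzRingType) (K : fieldType) (f : {rmorphism A -> K})
    (ev : {rmorphism B -> K}) : isfrac f ->
  (forall a, exists p r, ev r != 0 /\ f a * ev r = ev p) -> isfrac ev.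
Proof.
move=> ff h x; have [a [b [b0 ->]]] := ff x.
have [p [r [r0 e]]] := h a; have [p' [r' [r0' e']]] := h b.
exists (p * r'), (p' * r); rewrite !(rmorphM ev) -e -e'; split.
  by rewrite !mulf_neq0.
by field; rewrite b0 r0 r0'.
Qed.

Section RationalFinite.
Variables (k : fieldType) (A : comAlgType k) (br : A -> A -> A).
Hypotheses (char0 : [pchar k] =i pred0) (hA : affine A) (hbr : poisson_bracket br).
Variables (P : set A) (n : nat) (y : 'I_n.+1 -> A).
Hypotheses (hP : rprime P) (sP : stable (brackets br) P).
Hypotheses (hi : independent_mod y P) (hn : normalizes y P).
Variables (K : fieldType) (f : {rmorphism A -> K}).
Hypotheses (f0 : forall a, f a = 0 <-> P a) (ff : isfrac f).
Local Notation S := {poly {mpoly k[n.+1]}}.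
Variables (tt : {rmorphism S -> A}) (ev : {rmorphism S -> K}) (m : S) (w : nat).
Hypotheses (hev : forall p, ev p = f (tt p)) (httC : forall r, tt r%:P = evm y r).
Hypotheses (mm : m \is monic) (wm : wle w (w * (size m).-1) m).
Hypotheses (evm0 : forall p, ev p = 0 <-> divides m p) (F0 : ev m^`() != 0).
Hypothesis hta : forall a, exists p r, r != 0 /\ f a * ev r%:P = ev p.
Hypothesis rat : poisson_rational br P.

Let evC0 r : r != 0 -> ev r%:P != 0.
Proof. by apply: contra_neq => /(ev_injC evm0 F0). Qed.

Lemma frame_isfrac : isfrac ev.
Proof.
apply: (isfrac_cofinal ff) => a.
by have [p [r [/evC0 r0 e]]] := hta a; exists p, r%:P.
Qed.

Lemma induced_derivation a : exists D : K -> K, derivation_to id D /\ forall x, D (f x) = f (br x a).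
Proof.
have hd := br_derivation hbr a.
apply: (derivation_extend ff) => [|r /f0 Pr].
  split=> u v; first by rewrite (proj1 hd) rmorphD.
  by rewrite (proj2 hd) rmorphD !rmorphM.
by apply/f0; apply: (sP (d := fun x => br x a)) => //; exists a.
Qed.

Lemma constant_algebraic (s : seq A) (g : A -> K -> K) z :
  (forall B : set A, subalgebra B -> (forall x, x \in s -> B x) -> B = setT) ->
  (forall a, derivation_to id (g a) /\ forall x, g a (f x) = f (br x a)) ->
  (forall a, a \in s -> g a z = 0) -> algebraicOver (f \o in_alg A) z.
Proof.
move=> hs hg hz; have [a [b [b0 ez]]] := ff z.
have ok : frac_ok P (a, b) by rewrite /frac_ok /= => /f0/eqP; rewrite (negbTE b0).
rewrite ez; apply/(frac_algebraicE f0 ok); apply: rat => //.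
apply: (central_of_generators hbr hP hs) => x xs.
apply/f0; have [hgx ex] := hg x.
have ea : f a = z * f b by rewrite ez divfK.
rewrite rmorphB !rmorphM -!ex ea (proj2 hgx) (hz x xs) /=; ring.
Qed.

(** A nonzero multiple of [f'(theta)] that is a polynomial in [y], in the role of a discriminant:
    its finitely many prime factors are the contractions to be avoided. *)
Lemma frame_multiplier : exists v g0, g0 != 0 /\ ev v * ev m^`() = ev g0%:P.
Proof.
have nPF : ~ P (tt m^`()) by move=> /f0/eqP; rewrite -hev (negbTE F0).
have [b' [r [r0 /f0]]] := inverse_denominator hP hn nPF.
rewrite rmorphB rmorphM -hev -httC -hev => /eqP; rewrite subr_eq0 => /eqP e.
have [p [r' [r0' e']]] := hta b'.
exists p, (r * r'); split; first exact: mulf_neq0.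
by rewrite polyCM (rmorphM ev) -e -e'; ring.
Qed.

Theorem rational_finite_frame : finite_set (poisson_successors br P).
Proof.
apply: contrapT => hinf.
have [v [g0 [g00 hv]]] := frame_multiplier.
have [[s hs] _] := hA.
have /choice[Dl hDl] := induced_derivation.
have /choice[D hD] (j : 'I_n.+1) : exists Dj : K -> K, [/\ derivation_to id Dj,
      forall c, Dj (kappa ev c) = 0, forall l, Dj (ev ('X_l)%:P) = (l == j)%:R * ev m^`() &
      inC ev (Dj (ev 'X))].
  exact: coordinate_derivation evm0 frame_isfrac j.
(* The brackets of the generators [theta] and [y l] of [C] with the generators of [A]. They are
   finitely many, so one [G] clears their denominators and [G] times each Hamiltonian field
   preserves [C]. *)
pose xs := [seq br x.1 x.2 | x <- [seq (u, a) | u <- tt 'X :: [seq y l | l <- enum 'I_n.+1], a <- s]].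
have [G G0 hG] := common_multiplier xs hta.
have evG := evC0 G0.
pose g (i : 'I_(size s)) (x : K) := ev G%:P * Dl s`_i x.
have hg i : derivation_to id (g i).
  have [h _] := hDl s`_i; split=> a b; rewrite /g; first by rewrite (proj1 h) mulrDr.
  by rewrite (proj2 h) /=; ring.
have gf i x : g i (f x) = ev G%:P * f (br x s`_i) by rewrite /g; have [_ ->] := hDl s`_i.
have evy l : ev ('X_l)%:P = f (y l) by rewrite hev httC evmX.
have inxs u i : u \in tt 'X :: [seq y l | l <- enum 'I_n.+1] -> (i < size s)%N -> br u s`_i \in xs.
  move=> hu si; apply/mapP; exists (u, s`_i) => //.
  by apply/allpairsP; exists (u, s`_i); split=> //; exact: mem_nth.
have kg i c : g i (kappa ev c) = 0.
  rewrite -[kappa ev c]/(ev (c%:MP)%:P) hev httC evmC gf (brZ hbr).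
  by rewrite (derivation1 (f := idfun) (br_derivation hbr s`_i)) scaler0 rmorph0 mulr0.
have adm i : admissible ev (g i).
  split=> // [l|].
    rewrite evy gf mulrC; apply: hG; apply: inxs => //.
    by rewrite inE; apply/orP; right; apply: map_f; rewrite mem_enum.
  by rewrite hev gf mulrC; apply: hG; apply: inxs => //; rewrite inE eqxx.
have hD1 j : derivation_to id (D j) by case: (hD j).
have hD2 j c : D j (kappa ev c) = 0 by case: (hD j).
have hD3 j l : D j (ev ('X_l)%:P) = (l == j)%:R * ev m^`() by case: (hD j).
have hD4 j : inC ev (D j (ev 'X)) by case: (hD j).
have /choice[N hN] i := lie_step char0 mm wm evm0 F0 hv hD1 hD2 hD3 hD4 (adm i).
have [Q [q [hQ hq hQq qinj]]] := independent_successors char0 hA hP hi hn g00 hinf.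
pose QQ i : set S := fun p => Q i (tt p).
have hQQ i : rprime (QQ i) by apply: rprime_preim; case: (hQ i).
have QQP i p : ev p = 0 -> QQ i p.
  by rewrite hev => /f0 Pp; have [_ _ sPQ] := hQ i; apply: sPQ.
have evm1 : ev m = 0 by apply/evm0; exists 1; rewrite mul1r.
have QQm i : QQ i m by exact: QQP.
have QQq i r : QQ i r%:P <-> divides (q i) r by rewrite -hQq /QQ httC.
have q0 i : q i != 0 by case: (hq i) => -[].
have /choice[b hb] (x : nat * 'I_n.+1) : exists b, [/\
   wle w ((msize (q x.1)).-1 + w * (size m).-1) b, QQ x.1 (b - m^`() * ((q x.1)^`M(x.2))%:P) &
   forall a, QQ x.1 a -> exists u v, b * a = u * (q x.1)%:P + v * m].
  exact: (liftable_coord char0 (hQQ x.1) (QQm x.1) mm wm (QQq x.1) (q0 x.1) x.2).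
pose W i j := ev (b (i, j)) / ev (q i)%:P.
pose Nmax := (\max_i N i)%N.
have [T [v' hv']] := degC_basis Nmax mm wm evm0 F0.
pose M i j l := structure_coef ev m D (g i) j l / ev m^`().
have hW i l j : exists c : T -> k,
    ev m^`() * lie g M l (W i) j = \sum_t kappa ev (c t) * v' t.
  apply: hv'; apply: (@degC_mono _ _ _ _ _ (N l)); first exact: leq_bigmax.
  apply: (hN l (QQ i) (q i) (fun j => b (i, j))) => //; first by case: (hq i).
  - by case: (hq i).
  (* That [g l] preserves [QQ i] is where the Poisson property of [Q i] enters. *)
  - move=> p p' Qp; rewrite hev gf => e; have [hQi sQ sPQ] := hQ i.
    have [[_ QD QM] _ _] := hQi.
    have : Q i (tt (G%:P) * br (tt p) s`_l - tt p').
      by apply: sPQ; apply/f0; rewrite rmorphB rmorphM -!hev e subrr.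
    have : Q i (tt (G%:P) * br (tt p) s`_l).
      by apply: QM; apply: (sQ (fun x => br x s`_l)) => //; exists s`_l.
    move=> h1 h2; have [hQI _ _] := hQi; have := rideal_sub hQI h1 h2.
    by rewrite opprB addrC subrK.
  - by move=> j'; exact: hb (i, j').
have [J [e [c [einj [s0 c0] gc hc]]]] := constant_relation_exists hg kg F0 hW.
have alg x : algebraicOver (f \o in_alg A) (c x).
  apply: (constant_algebraic hs hDl) => a /(nthP 0)[i si <-].
  have := gc (Ordinal si) x; rewrite /g /= => /eqP.
  by rewrite mulf_eq0 (negbTE evG) => /eqP.
(* Ratios of constants are algebraic over the field [k], hence integral over it, which is what
   [relation_pole] asks for. *)
have int x : integralOver ev (c x / c s0).
  have /integral_algebraic[p mp rp] := algebraic_div (alg x) (alg s0).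
  exists (map_poly (polyC \o @mpolyC n.+1 k) p); first exact: monic_map.
  rewrite -map_poly_comp; have -> : map_poly (ev \o (polyC \o @mpolyC n.+1 k)) p = map_poly (f \o in_alg A) p.
    by apply: eq_map_poly => a; rewrite [LHS]hev httC evmC.
  exact: rp.
have [hp ng] := hq (e s0).
have [j hj] := prime_elt_mderiv char0 hp.
have Qb : QQ (e s0) (b (e s0, j)).
  apply: (relation_pole (beta := fun x => b (e x, j)) (q := fun x => (q (e x))%:P)
    (hQQ (e s0)) (QQP (e s0)) _ _ _ c0 int (hc j)).
  - by move=> x; apply: evC0.
  - by apply/QQq; exists 1; rewrite mul1r.
  - by move=> x; apply: contra_neq_not => /QQq/qinj/einj.
have [_ h2 _] := hb (e s0, j); have [[_ QD QM] _ hpr] := hQQ (e s0).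
have [hQI _ _] := hQQ (e s0).
(* [b] in [Q] would give [f' dq/dy_j] in [Q], although [q] divides neither [g0] nor this
   derivative. *)
have : QQ (e s0) (m^`() * ((q (e s0))^`M(j))%:P).
  have := rideal_sub hQI Qb h2; rewrite opprB addrC subrK; exact.
case/hpr => [hm|/QQq //]; apply: ng; apply/QQq.
have h3 : QQ (e s0) (v * m^`() - g0%:P).
  by apply: QQP; rewrite (rmorphB ev) (rmorphM ev) hv subrr.
have := rideal_sub hQI (QM v _ hm) h3.
by rewrite opprB addrC subrK.
Qed.
End RationalFinite.

Theorem rational_finite (k : fieldType) (A : comAlgType k) (br : A -> A -> A) (P : set A) :
  [pchar k] =i pred0 -> affine A -> poisson_bracket br -> poisson_prime br P ->
  poisson_rational br P -> finite_set (poisson_successors br P).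
Proof.
move=> char0 hA hbr /(poisson_primeE br)[hP sP] rat.
have [[|n] [y [hi hn]]] := has_dim_exists char0 (proj1 hA) hP.
  (* Without variables every polynomial is a constant, so there is no prime element and hence no
     successor. *)
  apply: (@sub_finite_set _ _ set0) => // Q.
  case/(successor_contraction hP hi hn) => _ _ _ [q /prime_elt_msize hq _].
  have : (msize (q@_0%MM)%:MP <= 1)%N := msizeC_le 0 _.
  rewrite leqNgt [X in msize X](_ : _ = q) ?hq //; apply/mpolyP => m.
  have -> : m = 0%MM by apply/mnmP; case.
  by rewrite mcoeffC eqxx mulr1.
have [K [f [f0 ff]]] := residue_field hP.
have [t [m [w [mm wm evm0 F0 ht]]]] := affine_frame char0 (proj1 hA) hi hn f0.
apply: (@rational_finite_frame k A br char0 hA hbr P n y hP sP hi hn K f f0 ff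
  (evt y t) (f \o evt y t) m w) => //; first by move=> r; exact: evtC.
move=> a; have [p [r [r0 e]]] := ht a; exists p, r; split=> //.
by rewrite [X in _ * X](_ : _ = f (evm y r)) // -(evtC y t).
Qed.

Theorem theorem8p3 (k : fieldType) (A : comAlgType k) (br : A -> A -> A)
  (char0 : [pchar k] =i pred0)
  (hA : affine A) (hbr : poisson_bracket br)
  (P : set A) (hP : poisson_prime br P) :
  poisson_rational br P <->
  finite_set [set Q : set A | poisson_prime br Q /\ P `<=` Q /\
     exists n, has_height P n /\ has_height Q n.+1].
Proof.
split; first exact: rational_finite.
exact: finite_rational.
Qed.
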